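(* Every finite Frobenius complement is $2$-generated.
   Context: A finite group $H$ is $2$-generated if $d(H)\leq 2$, where $d(H)$ is the minimal cardinality of a generating set of $H$. A Frobenius complement is a point stabilizer in a finite Frobenius group, i.e. in a transitive permutation group whose point stabilizers are nontrivial and in which only the identity fixes more than one point. *)

(* Defs.v *)
From mathcomp Require Import all_boot all_fingroup all_solvable.

Set Implicit Arguments.
Unset Strict Implicit.
Unset Printing Implicit Defensive.

(* Main.v *)
Require Import Defs.
From mathcomp Require Import all_boot all_fingroup all_solvable.
From mathcomp Require Import all_algebra all_character.
From mathcomp Require Import zify.

Set Implicit Arguments.
Unset Strict Implicit.
Unset Printing Implicit Defensive.

(* A Frobenius complement [G] acts without fixed points on an elementary abelian section of the
   kernel, which yields a representation [f] such that [f x - 1] is invertible for all [x != 1].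
   Hence abelian subgroups of [G] are cyclic and there is at most one involution [z], with
   [f z = -1].

   If [G] is solvable, the Fitting subgroup of [G / 'O_2^'(G)] is a cyclic or quaternion 2-group
   containing its centraliser, and two generators are found by inspection; they lift through a
   normal subgroup of odd order, one chief factor of prime order at a time.

   If [G] is not solvable, a transfer argument gives noncommuting elements of order 3. Two of
   them generate a group in which all the traces [f d + f d^-1] are central, so that centralisers
   of noncentral elements are abelian and Dickson's class count bounds the orders of elements.
   It follows that the elements of order 3 lie in the span of a quaternion basis [1, i, j, k]
   over scalars that commute with [i] and [j], and that the subgroup [L] generated by [z] and
   all elements of order 3 still has central traces. By the same count [#|L|] is 24, which
   contradicts nonsolvability, or 120. In the last case [G] is generated, modulo the largest odd
   normal subgroup of ['C(L)], by an element [c] of order 5 of [L] and any [g] that generates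
   [G / (L * 'C(L))] and does not normalise [<[c]>]. *)

(** The values of [f] lie in a matrix ring, where zero divisors abound. What replaces a field is
    that [f x - f y] is a unit as soon as [x != y], so that equations between group elements can
    still be solved by factoring. An element [x] of order 3 yields the square root [2 * f x + 1] of
    -3, and the anticommutator [tri] of two such roots behaves like an inner product. Two elements
    of order 3 always lie in a quaternion-like algebra; if they do not commute, they generate with
    [z] a group of order 24 or 120, and the product is 2, -2 or a square root of 20. The obstacle is
    that three elements need not lie in any such algebra: the roots of 20 attached to different
    pairs might not commute. Hence each [h] of order 3 is measured against the four elements of one
    class of a fixed binary tetrahedral group. The four products add up to 0, which forces [h] to
    commute with a conjugate of [gx] or to point at a vertex of a dodecahedron drawn with a single
    root [T]. Two such [h] in the same position coincide, so that one [T] serves for all of [L]. *)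

Import GRing.Theory.

(** * The class equation *)

(* The numerical data of a conjugacy class of centralisers of order [2 * al] in a group of
   order [n]: [e * m] is the index of the centraliser, [m] that of its normaliser. *)
Definition class_data n al e m u : Prop :=
  [/\ 2 <= al, e = 1 \/ e = 2, n = 2 * al * e * m, u = 2 * al.-1 * m & 3 <= e * m].

(** Taking [P = al * m] as an unknown makes the other constraints linear once [e] is known. *)
Lemma class_dataE n al e m u : class_data n al e m u -> exists P,
  [/\ n = 2 * e * P, u + 2 * m = 2 * P, P = al * m, 2 * m <= P & 2 <= al].
Proof.
case=> al2 _ -> -> _; exists (al * m); split=> //; first by lia.
  by case: al al2 => // al _ /=; lia.
by rewrite leq_mul2r al2 orbT.
Qed.

Lemma class_data1 n al e m u : class_data n al e m u -> u + 2 <> n.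
Proof.
move=> cd; have [P [nE uE _ le2 _]] := class_dataE cd; case: cd => _ [] ->; lia.
Qed.

(** Each small value of [al] makes [P = al * m] linear. The cut at 6 comes from
    [1/2 + 1/3 + 1/6 = 1], see [class_data3]. *)
Lemma small_al al m P : P = al * m -> 2 <= al ->
  al = 2 /\ P = 2 * m \/ al = 3 /\ P = 3 * m \/ al = 4 /\ P = 4 * m \/ al = 5 /\ P = 5 * m \/ 6 * m <= P.
Proof.
move=> -> al2.
have [->|[->|[->|[->|le6]]]]: al = 2 \/ al = 3 \/ al = 4 \/ al = 5 \/ 6 <= al by lia.
- by left.
- by right; left.
- by do 2!right; left.
- by do 3!right; left.
by do 4!right; rewrite leq_mul2r le6 orbT.
Qed.

(** A block fills about [(1 - 1/al) / e] of the group. Equal values of [e] leave no solution; for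
    [e1 = 1] and [e2 = 2] the equation reads [1/al1 + 1/(2 al2) = 1/2 + 2/n], and [3 <= e * m]
    discards [al1 = 2]. *)
Lemma class_data2 n al1 e1 m1 u1 al2 e2 m2 u2 :
    class_data n al1 e1 m1 u1 -> class_data n al2 e2 m2 u2 -> u1 + u2 + 2 = n ->
  n = 24 /\ (al1 = 2 \/ al1 = 3) /\ (al2 = 2 \/ al2 = 3).
Proof.
move=> cd1 cd2; have [P1 [nE1 uE1 PE1 le1 al1_2]] := class_dataE cd1.
have [P2 [nE2 uE2 PE2 le2 al2_2]] := class_dataE cd2.
case: cd1 => _ e1E _ _ em1; case: cd2 => _ e2E _ _ em2 sum_u.
case: e1E => e1E; case: e2E => e2E; subst e1 e2; try lia.
all: case: (small_al PE1 al1_2) => [[? ?]|[[? ?]|[[? ?]|[[? ?]|?]]]];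
     case: (small_al PE2 al2_2) => [[? ?]|[[? ?]|[[? ?]|[[? ?]|?]]]]; lia.
Qed.

(** Three blocks force every [e] to be 2, and the equation becomes that of spherical triangles,
    [1/al1 + 1/al2 + 1/al3 = 1 + 4/n]. The solutions (2,3,3), (2,3,4), (2,3,5) remain; the dihedral
    ones (2,2,k) have [e * m = 2] for the block with [al = k]. *)
Lemma class_data3 n al1 e1 m1 u1 al2 e2 m2 u2 al3 e3 m3 u3 :
    class_data n al1 e1 m1 u1 -> class_data n al2 e2 m2 u2 -> class_data n al3 e3 m3 u3 ->
    u1 + u2 + u3 + 2 = n ->
  let s := [:: al1; al2; al3] in
  [\/ n = 24 /\ all (mem [:: 2; 3]) s, n = 48 /\ (2 \in s) && (4 \in s)
    | n = 120 /\ all (mem [:: 2; 3; 5]) s].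
Proof.
move=> cd1 cd2 cd3; have [P1 [nE1 uE1 PE1 le1 al1_2]] := class_dataE cd1.
have [P2 [nE2 uE2 PE2 le2 al2_2]] := class_dataE cd2.
have [P3 [nE3 uE3 PE3 le3 al3_2]] := class_dataE cd3.
case: cd1 => _ e1E _ _ em1; case: cd2 => _ e2E _ _ em2; case: cd3 => _ e3E _ _ em3 sum_u /=.
have [e1_2 e2_2 e3_2]: [/\ e1 = 2, e2 = 2 & e3 = 2].
  by case: e1E e2E e3E => e1E [] e2E [] e3E; subst e1 e2 e3; split => //; lia.
subst e1 e2 e3.
case: (small_al PE1 al1_2) => [[a1 ?]|[[a1 ?]|[[a1 ?]|[[a1 ?]|?]]]];
case: (small_al PE2 al2_2) => [[a2 ?]|[[a2 ?]|[[a2 ?]|[[a2 ?]|?]]]]; try lia;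
case: (small_al PE3 al3_2) => [[a3 ?]|[[a3 ?]|[[a3 ?]|[[a3 ?]|?]]]]; try lia.
all: rewrite ?a1 ?a2 ?a3 /=.
all: try by [constructor 1; split; [lia|] | constructor 2; split; [lia|] | constructor 3; split; [lia|]].
Qed.

(** Each block fills at least a quarter of the group, because [al >= 2] and [e <= 2]. *)
Lemma class_data4 n al1 e1 m1 u1 al2 e2 m2 u2 al3 e3 m3 u3 al4 e4 m4 u4 :
    class_data n al1 e1 m1 u1 -> class_data n al2 e2 m2 u2 ->
    class_data n al3 e3 m3 u3 -> class_data n al4 e4 m4 u4 -> u1 + u2 + u3 + u4 + 2 <= n -> False.
Proof.
move=> cd1 cd2 cd3 cd4.
have quarter al e m u : class_data n al e m u -> n <= 4 * u.
  by move=> cd; have [P [nE uE PE le2 _]] := class_dataE cd; case: cd => _ [] eE; subst e; lia.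
have := (quarter _ _ _ _ cd1, quarter _ _ _ _ cd2, quarter _ _ _ _ cd3, quarter _ _ _ _ cd4); case=> [[[]]]; lia.
Qed.

Local Open Scope ring_scope.

(** * Rewriting in noncommutative rings *)

Inductive nc_expr :=
  | NcVar of nat | NcZero | NcOne | NcAdd of nc_expr & nc_expr
  | NcMul of nc_expr & nc_expr | NcOpp of nc_expr | NcNat of nc_expr & nat | NcExp of nc_expr & nat.

Definition nc_poly := seq (int * seq nat).

Fixpoint nc_insert (m : int * seq nat) (p : nc_poly) : nc_poly :=
  if p is n :: p' then
    if m.2 == n.2 then
      (if m.1 + n.1 == 0 then p' else (m.1 + n.1, n.2) :: p')
    else n :: nc_insert m p'
  else [:: m].

Definition nc_collect (p : nc_poly) : nc_poly := foldr nc_insert [::] p.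

Definition nc_pmul (p q : nc_poly) : nc_poly :=
  nc_collect (flatten [seq [seq (m.1 * n.1, m.2 ++ n.2) | n <- q] | m <- p]).

Definition nc_scale (c : int) (p : nc_poly) : nc_poly :=
  [seq (c * m.1, m.2) | m <- p].

Fixpoint nc_toP (e : nc_expr) : nc_poly :=
  match e with
  | NcVar n => [:: (1, [:: n])]
  | NcZero => [::]
  | NcOne => [:: (1, [::])]
  | NcAdd a b => nc_collect (nc_toP a ++ nc_toP b)
  | NcMul a b => nc_pmul (nc_toP a) (nc_toP b)
  | NcOpp a => nc_scale (-1) (nc_toP a)
  | NcNat a n => nc_scale n%:Z (nc_toP a)
  | NcExp a n => iter n (nc_pmul (nc_toP a)) [:: (1, [::])]
  end.

Fixpoint nc_match (l w : seq nat) : option (seq nat) :=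
  match l, w with
  | [::], _ => Some w
  | a :: l', b :: w' => if a == b then nc_match l' w' else None
  | _, _ => None
  end.

Fixpoint nc_head (rs : seq (seq nat * nc_poly)) (w : seq nat) : option nc_poly :=
  if rs is (l, p) :: rs' then
    if nc_match l w is Some w' then Some [seq (m.1, m.2 ++ w') | m <- p]
    else nc_head rs' w
  else None.

Fixpoint nc_step (rs : seq (seq nat * nc_poly)) (w : seq nat) : option nc_poly :=
  if nc_head rs w is Some p then Some p else
  if w is a :: w' then omap (map (fun m => (m.1, a :: m.2))) (nc_step rs w')
  else None.

Definition nc_reduce rs (p : nc_poly) : nc_poly :=
  nc_collect (flatten [seq if nc_step rs m.2 is Some q then nc_scale m.1 q
                          else [:: m] | m <- p]).

(** Neither termination nor confluence of the rules is asked for: a round of rewriting preserves the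
    value, so reaching the empty polynomial within [fuel] rounds is a proof, and failing to reach it
    means nothing. *)
Definition nc_check rs (fuel : nat) (e1 e2 : nc_expr) : bool :=
  nilp (iter fuel (nc_reduce rs) (nc_toP (NcAdd e1 (NcOpp e2)))).

Section Sound.
Variables (R : pzRingType) (env : seq R).

Fixpoint nc_eval (e : nc_expr) : R :=
  match e with
  | NcVar n => nth 0 env n
  | NcZero => 0
  | NcOne => 1
  | NcAdd a b => nc_eval a + nc_eval b
  | NcMul a b => nc_eval a * nc_eval b
  | NcOpp a => - nc_eval a
  | NcNat a n => nc_eval a *+ n
  | NcExp a n => nc_eval a ^+ n
  end.

Definition nc_word (w : seq nat) : R := \prod_(n <- w) nth 0 env n.
Definition nc_evp (p : nc_poly) : R := \sum_(m <- p) nc_word m.2 *~ m.1.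

Lemma nc_word_cat u v : nc_word (u ++ v) = nc_word u * nc_word v.
Proof. exact: big_cat. Qed.

Lemma nc_evp_cat p q : nc_evp (p ++ q) = nc_evp p + nc_evp q.
Proof. exact: big_cat. Qed.

Lemma nc_evp_insert m p : nc_evp (nc_insert m p) = nc_word m.2 *~ m.1 + nc_evp p.
Proof.
elim: p => [|n p IHp] /=; first by rewrite /nc_evp !big_cons.
case: eqP => [eq_mn | _].
  have eq_c: nc_word m.2 *~ m.1 + nc_word n.2 *~ n.1 = nc_word n.2 *~ (m.1 + n.1).
    by rewrite eq_mn mulrzDr.
  case: eqP => [c0 | _]; rewrite /nc_evp !big_cons addrA eq_c //.
  by rewrite c0 mulr0z add0r.
by rewrite {1}/nc_evp big_cons -/(nc_evp _) IHp [nc_evp (n :: p)]big_cons addrCA.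
Qed.

Lemma nc_evp_collect p : nc_evp (nc_collect p) = nc_evp p.
Proof.
elim: p => //= m p IHp.
by rewrite nc_evp_insert IHp [in RHS]/nc_evp big_cons.
Qed.

Lemma nc_evp_scale c p : nc_evp (nc_scale c p) = nc_evp p *~ c.
Proof.
rewrite /nc_evp big_map mulrz_suml; apply: eq_bigr => m _ /=.
by rewrite mulrC mulrzA.
Qed.

Lemma nc_evp_flatten (T : Type) (F : T -> nc_poly) (s : seq T) :
  nc_evp (flatten [seq F x | x <- s]) = \sum_(x <- s) nc_evp (F x).
Proof.
elim: s => [|x s IHs] /=; first by rewrite /nc_evp !big_nil.
by rewrite nc_evp_cat IHs big_cons.
Qed.

Lemma nc_evp_mul p q : nc_evp (nc_pmul p q) = nc_evp p * nc_evp q.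
Proof.
rewrite nc_evp_collect nc_evp_flatten mulr_suml; apply: eq_bigr => m _.
rewrite /nc_evp big_map mulr_sumr; apply: eq_bigr => n _ /=.
by rewrite nc_word_cat mulrzAl mulrzAr [LHS]mulrzA mulrzAC.
Qed.

Lemma nc_evp_toP e : nc_evp (nc_toP e) = nc_eval e.
Proof.
elim: e => /= [n||| a IHa b IHb|a IHa b IHb|a IHa|a IHa n|a IHa n].
- by rewrite /nc_evp /nc_word !big_seq1.
- by rewrite /nc_evp big_nil.
- by rewrite /nc_evp /nc_word !big_seq1 big_nil.
- by rewrite nc_evp_collect nc_evp_cat IHa IHb.
- by rewrite nc_evp_mul IHa IHb.
- by rewrite nc_evp_scale IHa mulrN1z.
- by rewrite nc_evp_scale IHa.
elim: n => [|n IHn] /=; last by rewrite nc_evp_mul IHa IHn exprS.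
by rewrite /nc_evp /nc_word !big_seq1 big_nil.
Qed.

Fixpoint nc_rules_ok (rs : seq (seq nat * nc_expr)) : Prop :=
  if rs is (l, e) :: rs' then nc_word l = nc_eval e /\ nc_rules_ok rs' else True.

Definition nc_comp (rs : seq (seq nat * nc_expr)) := [seq (r.1, nc_toP r.2) | r <- rs].

Lemma nc_matchP l w w' : nc_match l w = Some w' -> w = l ++ w'.
Proof.
elim: l w => [|a l IHl] [|b w] //=; try by case=> ->.
by case: eqP => // -> /IHl ->.
Qed.

Lemma nc_headP rs w q : nc_rules_ok rs -> nc_head (nc_comp rs) w = Some q ->
  nc_evp q = nc_word w.
Proof.
elim: rs => //= -[l e] rs IHrs [/= def_l okrs].
case def_w: (nc_match l w) => [w'|]; last exact: IHrs.
case=> <-; rewrite (nc_matchP def_w) nc_word_cat def_l -nc_evp_toP.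
rewrite /nc_evp big_map mulr_suml; apply: eq_bigr => m _ /=.
by rewrite nc_word_cat mulrzAl.
Qed.

Lemma nc_stepP rs w q : nc_rules_ok rs -> nc_step (nc_comp rs) w = Some q ->
  nc_evp q = nc_word w.
Proof.
move=> okrs; elim: w q => [|a w IHw] q /=.
  by case def_q: (nc_head _ _) => [p|] // [<-]; apply: nc_headP def_q.
case def_q: (nc_head _ _) => [p|]; first by case=> <-; apply: nc_headP def_q.
case: nc_step IHw => //= p IHw [<-]; have ->: nc_word (a :: w) = nth 0 env a * nc_word w by exact: big_cons.
rewrite -(IHw p) // /nc_evp big_map mulr_sumr; apply: eq_bigr => m _ /=.
by rewrite /nc_word big_cons mulrzAr.
Qed.

Lemma nc_evp_reduce rs p : nc_rules_ok rs -> nc_evp (nc_reduce (nc_comp rs) p) = nc_evp p.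
Proof.
move=> okrs; rewrite nc_evp_collect nc_evp_flatten; apply: eq_bigr => m _.
case def_q: (nc_step _ _) => [q|]; last by rewrite /nc_evp big_seq1.
by rewrite nc_evp_scale (nc_stepP okrs def_q).
Qed.

Lemma nc_checkP rs fuel e1 e2 : nc_rules_ok rs -> nc_check (nc_comp rs) fuel e1 e2 ->
  nc_eval e1 = nc_eval e2.
Proof.
move=> okrs /nilP; set p := nc_toP _ => p0; apply/eqP; rewrite -subr_eq0.
rewrite -[_ - _]/(nc_eval (NcAdd e1 (NcOpp e2))) -nc_evp_toP -/p.
have <-: nc_evp (iter fuel (nc_reduce (nc_comp rs)) p) = nc_evp p.
  by elim: fuel {p0} => //= n IHn; rewrite nc_evp_reduce.
by rewrite p0 /nc_evp big_nil.
Qed.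
End Sound.

(* Atoms are compared up to conversion, as canonical instances may differ syntactically. *)
Ltac nc_same x y := first [constr_eq x y | unify x y].
Ltac nc_idx x l :=
  match l with
  | ?y :: _ => let _ := match goal with _ => nc_same x y end in constr:(O)
  | _ :: ?t => let n := nc_idx x t in constr:(S n)
  end.
Ltac nc_mem x l :=
  match l with
  | ?y :: _ => let _ := match goal with _ => nc_same x y end in constr:(true)
  | _ :: ?t => nc_mem x t
  | _ => constr:(false)
  end.
Ltac nc_atoms t l :=
  lazymatch t with
  | 0 => l
  | 1 => l
  | ?a + ?b => let l := nc_atoms a l in nc_atoms b l
  | ?a * ?b => let l := nc_atoms a l in nc_atoms b l
  | - ?a => nc_atoms a l
  | ?a *+ ?n => nc_atoms a l
  | ?a ^+ ?n => nc_atoms a l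
  | _ => lazymatch nc_mem t l with true => l | false => constr:(t :: l) end
  end.
Ltac nc_reify t l :=
  lazymatch t with
  | 0 => constr:(NcZero)
  | 1 => constr:(NcOne)
  | ?a + ?b => let x := nc_reify a l in let y := nc_reify b l in constr:(NcAdd x y)
  | ?a * ?b => let x := nc_reify a l in let y := nc_reify b l in constr:(NcMul x y)
  | - ?a => let x := nc_reify a l in constr:(NcOpp x)
  | ?a *+ ?n => let x := nc_reify a l in constr:(NcNat x n)
  | ?a ^+ ?n => let x := nc_reify a l in constr:(NcExp x n)
  | _ => let n := nc_idx t l in constr:(NcVar n)
  end.
Ltac nc_wordify t l :=
  lazymatch t with
  | ?a * ?b => let x := nc_wordify a l in let y := nc_wordify b l in constr:(x ++ y)
  | _ => let n := nc_idx t l in constr:([:: n])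
  end.
Ltac nc_ratoms rs l :=
  lazymatch rs with
  | (?h, ?rs') =>
    lazymatch type of h with @eq _ ?a ?b =>
      let l := nc_atoms a l in let l := nc_atoms b l in nc_ratoms rs' l end
  | _ => l
  end.
Ltac nc_rreify rs l :=
  lazymatch rs with
  | (?h, ?rs') =>
    lazymatch type of h with @eq _ ?a ?b =>
      let x := nc_wordify a l in let y := nc_reify b l in
      let r := nc_rreify rs' l in constr:((x, y) :: r) end
  | _ => constr:(@nil (seq nat * nc_expr))
  end.
Ltac nc_solve_rules rs :=
  lazymatch rs with
  | (?h, ?rs') => split; [refine (eq_trans _ h); rewrite /nc_word ?big_cons big_nil mulr1 /= ?mulrA; reflexivity | nc_solve_rules rs']
  | _ => exact Logic.I
  end.
(* [ncr (h1, (h2, I))] proves an identity of noncommutative polynomials in atoms modulo the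
   equations [h1], [h2], used as rewrite rules from a word to a polynomial. *)
Ltac ncr rs :=
  lazymatch goal with |- @eq ?T ?a ?b =>
    let l := nc_atoms a (@nil T) in let l := nc_atoms b l in
    let l := nc_ratoms rs l in
    let x := nc_reify a l in let y := nc_reify b l in
    let r := nc_rreify rs l in
    let r := eval cbv [cat] in r in
    refine (@nc_checkP _ l r 60 x y _ _);
    [nc_solve_rules rs | vm_compute; reflexivity]
  end.
Ltac nc := ncr Logic.I.

(** * Square roots of -3 against a quaternion basis *)

Section Quaternions.

Variable R : unitRingType.
Hypothesis mul2I : forall a : R, a + a = 0 -> a = 0.
Hypothesis unit3 : (3%:R : R) \is a GRing.unit.
Implicit Types i j H : R.

Let add2I (a b : R) : a + a = b + b -> a = b.
Proof.
move=> e; apply/eqP; rewrite -subr_eq0; apply/eqP/mul2I.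
transitivity (a + a - (b + b)); [by nc | by rewrite e subrr].
Qed.

Definition quat i j := [/\ i * i = -1, j * j = -1 & j * i = - (i * j)].

Lemma quat_cycle i j : quat i j -> quat j (i * j) /\ j * (i * j) = i.
Proof. by case=> ii jj ji; do ![split]; ncr (ii,(jj,(ji,I))). Qed.

Lemma quat_sign i j : quat i j -> [/\ quat i (- j), quat (- i) j & quat (- i) (- j)].
Proof. by case=> ii jj ji; do ![split]; ncr (ii,(jj,(ji,I))). Qed.

(** With [k = i * j], the sum [X - i X i - j X j - k X k] is four times the component of [X] on 1.
    Multiplying [X] by [-i], [-j] or [-k] first brings the other coefficients there. *)
Lemma quat_indep i j c0 c1 c2 c3 : quat i j ->
    [/\ i * c0 = c0 * i, i * c1 = c1 * i, i * c2 = c2 * i & i * c3 = c3 * i] ->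
    [/\ j * c0 = c0 * j, j * c1 = c1 * j, j * c2 = c2 * j & j * c3 = c3 * j] ->
    c0 + c1 * i + c2 * j + c3 * (i * j) = 0 -> [/\ c0 = 0, c1 = 0, c2 = 0 & c3 = 0].
Proof.
case=> ii jj ji [i0 i1 i2 i3] [j0 j1 j2 j3]; set X := (X in X = 0) => X0.
have four (y : R) : 4 * y = 0 -> y = 0.
  by move=> y4; apply/mul2I/mul2I; rewrite -y4; nc.
have Q1 (y : R) (m : R) : y = X * m - i * (X * m) * i - j * (X * m) * j - i * j * (X * m) * (i * j) -> y = 0.
  by rewrite X0 !(mulr0, mul0r) !subr0.
split; apply: four; [apply: (@Q1 _ 1) | apply: (@Q1 _ (- i)) | apply: (@Q1 _ (- j)) | apply: (@Q1 _ (- (i * j)))];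
by rewrite /X; ncr (ii,(jj,(ji,(i0,(i1,(i2,(i3,(j0,(j1,(j2,(j3,I))))))))))).
Qed.

(* Twice the vertices [(0, +-1/phi, +-phi)] of the regular dodecahedron, for [phi = (T + 2) / 4]. *)
Definition normal_form i j v w H := exists T e1 e2 : R,
  [/\ T * T = 20, i * T = T * i /\ j * T = T * j, e1 = 1 \/ e1 = -1, e2 = 1 \/ e2 = -1
    & 4 * H = e1 * ((T + 2) * v + e2 * ((T - 2) * w))].

Section Golden.

Variables i j H : R.
Hypothesis Qij : quat i j.
Let k := i * j.
Let a := i * H + H * i.
Let b := j * H + H * j.
Let c := k * H + H * k.
Hypothesis HH : H * H = - 3.

(** The four sign patterns [i + j + k], [i - j - k], [- i + j - k], [- i - j + k] are the roots
    [2 * f x + 1] of -3 for a conjugacy class of elements [x] of order 3 in a binary tetrahedral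
    group. The anticommutators of [H] with them are [A1] to [A4]; their sum is 0. *)
Let A1 := a + b + c.
Let A2 := a - b - c.
Let A3 := - a + b - c.
Let A4 := - a - b + c.

(** Always [2 H = - (a i + b j + c k) - (j a - a j) k]: the commutator measures the scalar part of
    [H]. *)
Lemma quat_pure : j * a = a * j -> 2 * H = - (a * i + b * j + c * k).
Proof.
case: Qij => ii jj ji aj.
transitivity (- (a * i + b * j + c * k) - (j * a - a * j) * k); last by rewrite aj subrr mul0r subr0.
by rewrite /c /b /a /k; ncr (ii,(jj,(ji,I))).
Qed.

(** The square of [u = i + j + k] is the scalar -3, so [u H + H u] commutes with [u]. *)
Lemma comm_A1 : (i + j + k) * A1 = A1 * (i + j + k).
Proof. by case: Qij => ii jj ji; rewrite /A1 /c /b /a /k; ncr (ii,(jj,(ji,I))). Qed.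
Lemma comm_A2 : (i - j - k) * A2 = A2 * (i - j - k).
Proof. by case: Qij => ii jj ji; rewrite /A2 /c /b /a /k; ncr (ii,(jj,(ji,I))). Qed.

(** Here [A2 = - A1], so [A1] commutes with [i + j + k] and with [i - j - k], hence with [i] and
    [j], and up to sign it is the required [T]. The coefficients [b] and [c] are half the sum and
    half the difference of [A1] and [A3]. *)
Lemma quat_two_golden : a = 0 -> A1 * A1 = 20 -> A3 = 2 \/ A3 = -2 -> normal_form i j j k H.
Proof.
case: Qij => ii jj ji a0 A11 A3E.
have A12: A2 = - A1 by rewrite /A2 /A1 a0; nc.
have c1 := comm_A1; have c2 := comm_A2; rewrite A12 in c2.
have iA: i * A1 = A1 * i.
  apply: add2I; transitivity ((i + j + k) * A1 - (i - j - k) * - A1); first by nc.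
  by rewrite c1 c2; nc.
have kjA: (j + k) * A1 = A1 * (j + k).
  by transitivity ((i + j + k) * A1 - i * A1); [nc | rewrite c1 iA; nc].
have jA: j * A1 = A1 * j.
  apply: add2I; transitivity ((j + k) * A1 - i * (j + k) * A1).
    by rewrite /k; ncr (ii,(jj,(ji,I))).
  rewrite -mulrA kjA mulrA iA /k; ncr (ii,(jj,(ji,(iA,I)))).
have HE: 4 * H = - ((A1 + A3) * j + (A1 - A3) * k).
  transitivity (2 * (2 * H)); first by nc.
  by rewrite quat_pure ?a0 ?mulr0 ?mul0r // /A1 /A3 a0; nc.
case: A3E => A3E; [exists A1, (-1), 1 | exists (- A1), 1, 1].
  by split; [ | split | right | left | rewrite HE A3E; nc].
by split; [rewrite mulrNN | rewrite !mulrN !mulNr iA jA | left | left | rewrite HE A3E; nc].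
Qed.

(** Anticommuting with [j] and [k], [H] commutes with [i = j k]. Then [i H] is 1 or -1, and [H ^ 2]
    would be -1 instead of -3. *)
Lemma quat_no_golden1 : b = 0 -> c = 0 -> a = 2 \/ a = -2 -> False.
Proof.
case: Qij => ii jj ji b0 c0 aE.
have n10 : (1 : R) != 0 by apply: oner_neq0.
have jH: j * H = - (H * j) by apply/eqP; rewrite -addr_eq0 -/b b0.
have kH: k * H = - (H * k) by apply/eqP; rewrite -addr_eq0 -/c c0.
have iH: i * H = H * i.
  transitivity (j * (k * H)); first by rewrite /k; ncr (ii,(jj,(ji,I))).
  rewrite kH mulrN mulrA jH /k; ncr (ii,(jj,(ji,I))).
have iHE: i * H = 1 \/ i * H = -1.
  case: aE => aE; [left | right]; apply: add2I; rewrite {2}iH -/a aE; nc.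
have HHE: H * H = -1.
  transitivity (- (i * H) * (i * H)); first by rewrite {2}iH; ncr (ii,(iH,I)).
  by case: iHE => ->; nc.
case/eqP: n10; apply: mul2I; transitivity (H * H + 3); [by rewrite HHE; nc | by rewrite HH; nc].
Qed.

(** Three roots of 20 whose sum is the scalar [- A4] turn out to be equal, hence scalar. Then [H] is
    a scalar multiple of [i + j - k] and [H ^ 2 = - 3 * 20 / 4 = -15]. *)
Lemma quat_three_golden : A1 * A1 = 20 -> A2 * A2 = 20 -> A3 * A3 = 20 -> A4 = 2 \/ A4 = -2 -> False.
Proof.
case: Qij => ii jj ji A11 A22 A33 A4E.
have n10 : (1 : R) != 0 by apply: oner_neq0.
have sumA: A1 + A2 + A3 + A4 = 0 by rewrite /A1 /A2 /A3 /A4; nc.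
have [e [Ae ee eC]] : exists e, [/\ A4 = e, e * e = 4 & forall X, e * X = X * e].
  by case: A4E => ->; [exists 2 | exists (-2)]; split=> [|| X] //; nc.
rewrite Ae in sumA.
have aux X Y W : X * X = 20 -> Y * Y = 20 -> W * W = 20 -> X + Y + W + e = 0 ->
    X * Y + Y * X = 2 * (e * W) - 16.
  move=> XX YY WW s0; have YE: X + Y = - W - e.
    by apply/eqP; rewrite -subr_eq0 -s0; apply/eqP; nc.
  have eW := eC W.
  transitivity ((X + Y) * (X + Y) - 40); first by ncr (XX,(YY,I)).
  by rewrite YE; ncr (WW,(ee,(eW,I))).
(* By [aux], [2 e W] is [X Y + Y X + 16], which commutes with [X] because [X ^ 2 = 20]. *)
have comm X Y W : X * X = 20 -> Y * Y = 20 -> W * W = 20 -> X + Y + W + e = 0 -> X * W = W * X.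
  move=> XX YY WW s0; have XY := aux X Y W XX YY WW s0.
  have EW: 2 * (e * W) = X * Y + Y * X + 16 by rewrite XY; nc.
  have eX := eC X; have eW := eC W; have eY := eC Y.
  apply/eqP; rewrite -subr_eq0; apply/eqP; do 3!apply: mul2I.
  transitivity ((X * (2 * (e * W)) - 2 * (e * W) * X) * e); first by ncr (ee,(eX,(eW,I))).
  by rewrite EW; ncr (ee,(eX,(eY,(XX,I)))).
(* Evaluating [X Y W] as [X (e X - 8)] and as [(e W - 8) W] gives [8 X = 8 W]. *)
have eq8 X Y W : X * X = 20 -> Y * Y = 20 -> W * W = 20 -> X + Y + W + e = 0 -> X = W.
  move=> XX YY WW s0.
  have XW := comm _ _ _ XX YY WW s0.
  have YX: Y * X = X * Y by apply: (comm Y W X) => //; rewrite -s0; nc.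
  have YW: Y * W = W * Y by apply: (comm Y X W) => //; rewrite -s0; nc.
  have XYE: X * Y = e * W - 8.
    by apply: add2I; rewrite -{2}YX (aux X Y W) //; nc.
  have WYE: Y * W = e * X - 8.
    by apply: add2I; rewrite {2}YW (aux Y W X) //; [nc | rewrite -s0; nc].
  have eX := eC X; have eW := eC W.
  do 3!apply: add2I; transitivity (20 * e - X * (Y * W)); last first.
    by rewrite mulrA XYE; ncr (WW,(eW,I)).
  by rewrite WYE; ncr (XX,(eX,I)).
have A13 := eq8 _ _ _ A11 A22 A33 sumA.
have A23: A2 = A3 by apply: (eq8 A2 A1 A3); rewrite // -sumA; nc.
have A3e: 3 * A3 = - e.
  by apply/eqP; rewrite -addr_eq0 -sumA A13 A23; apply/eqP; nc.
have A3C X : A3 * X = X * A3.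
  apply: (mulrI unit3); transitivity (3 * A3 * X); [by nc|].
  by rewrite A3e; transitivity (X * (3 * A3)); [rewrite A3e; have eX := eC X; ncr (eX,I) | nc].
have aE: a = A3.
  by apply: add2I; transitivity (A1 + A2); [rewrite /A1 /A2; nc | rewrite A13 A23].
have bE: b = A3.
  by apply: add2I; transitivity (A1 + A3); [rewrite /A1 /A3; nc | rewrite A13].
have cE: c = - A3.
  apply: add2I; transitivity (A1 + A4); first by rewrite /A1 /A4; nc.
  rewrite A13 Ae -[e]opprK -A3e; nc.
have HE: 2 * H = - (A3 * (i + j - k)).
  by have := quat_pure; rewrite aE bE cE => ->; [nc | rewrite A3C].
case/eqP: n10; apply: (mulrI unit3); rewrite mulr0; do 4!apply: mul2I.
transitivity (2 * H * (2 * H) + 60); first by ncr (HH,I).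
have iA := esym (A3C i); have jA := esym (A3C j).
by rewrite HE /k; ncr (ii,(jj,(ji,(iA,(jA,(A33,I)))))).
Qed.

(** The four squares say that [a], [b], [c] anticommute pairwise and that [a^2 + b^2 + c^2 = 20].
    Rewritten with coefficients that commute with [i] and [j], these relations and [H ^ 2 = -3] can
    be split into components by [quat_indep]. *)
Lemma quat_four_golden : A1 * A1 = 20 -> A2 * A2 = 20 -> A3 * A3 = 20 -> A4 * A4 = 20 ->
  exists G0 G1 G2 G3 : R,
  [/\ [/\ i * G0 = G0 * i, i * G1 = G1 * i, i * G2 = G2 * i & i * G3 = G3 * i],
      [/\ j * G0 = G0 * j, j * G1 = G1 * j, j * G2 = G2 * j & j * G3 = G3 * j],
      4 * H = G0 + G1 * i + G2 * j + G3 * k,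
      [/\ G1 * G2 = 0, G1 * G3 = 0, G2 * G3 = 0, G3 * G2 = 0 & G1 * G0 = - (G0 * G1)]
    & G0 * G0 = - 16 /\ G1 * G1 + G2 * G2 + G3 * G3 = 32].
Proof.
case: (Qij) => ii jj ji A11 A22 A33 A44.
have sq: a * a + b * b + c * c = 20.
  do 2!apply: add2I.
  transitivity (A1 * A1 + A2 * A2 + A3 * A3 + A4 * A4); first by rewrite /A1 /A2 /A3 /A4; nc.
  by rewrite A11 A22 A33 A44; nc.
have ab: a * b + b * a = 0.
  do 2!apply: mul2I; transitivity ((A1 * A1 - A2 * A2) - (A3 * A3 - A4 * A4)).
    by rewrite /A1 /A2 /A3 /A4; nc.
  by rewrite A11 A22 A33 A44; nc.
have ac: a * c + c * a = 0.
  do 2!apply: mul2I; transitivity ((A1 * A1 - A2 * A2) + (A3 * A3 - A4 * A4)).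
    by rewrite /A1 /A2 /A3 /A4; nc.
  by rewrite A11 A22 A33 A44; nc.
have bc: b * c + c * b = 0.
  do 2!apply: mul2I; transitivity ((A1 * A1 - A3 * A3) - (A4 * A4 - A2 * A2)).
    by rewrite /A1 /A2 /A3 /A4; nc.
  by rewrite A11 A22 A33 A44; nc.
(* The projections in the proof of [quat_indep], applied to [H]. *)
pose G0 := H - i * H * i - j * H * j - k * H * k.
pose G1 := j * H * k - k * H * j - i * H - H * i.
pose G2 := k * H * i - i * H * k - j * H - H * j.
pose G3 := i * H * j - j * H * i - k * H - H * k.
have [i0 i1 i2 i3] : [/\ i * G0 = G0 * i, i * G1 = G1 * i, i * G2 = G2 * i & i * G3 = G3 * i].
  by rewrite /G0 /G1 /G2 /G3 /k; split; ncr (ii,(jj,(ji,I))).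
have [j0 j1 j2 j3] : [/\ j * G0 = G0 * j, j * G1 = G1 * j, j * G2 = G2 * j & j * G3 = G3 * j].
  by rewrite /G0 /G1 /G2 /G3 /k; split; ncr (ii,(jj,(ji,I))).
have HE: 4 * H = G0 + G1 * i + G2 * j + G3 * k.
  by rewrite /G0 /G1 /G2 /G3 /k; ncr (ii,(jj,(ji,I))).
have aE: 2 * a = G0 * i - G1 by rewrite /a /G0 /G1 /k; ncr (ii,(jj,(ji,I))).
have bE: 2 * b = G0 * j - G2 by rewrite /b /G0 /G2 /k; ncr (ii,(jj,(ji,I))).
have cE: 2 * c = G0 * k - G3 by rewrite /c /G0 /G3 /k; ncr (ii,(jj,(ji,I))).
move: G0 G1 G2 G3 i0 i1 i2 i3 j0 j1 j2 j3 HE aE bE cE => G0 G1 G2 G3 i0 i1 i2 i3 j0 j1 j2 j3 HE aE bE cE.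
have ind c0 c1 c2 c3 :
    [/\ i * c0 = c0 * i, i * c1 = c1 * i, i * c2 = c2 * i & i * c3 = c3 * i] ->
    [/\ j * c0 = c0 * j, j * c1 = c1 * j, j * c2 = c2 * j & j * c3 = c3 * j] ->
    c0 + c1 * i + c2 * j + c3 * (i * j) = 0 -> [/\ c0 = 0, c1 = 0, c2 = 0 & c3 = 0].
  exact: quat_indep.
have [] := ind (G1 * G2 + G2 * G1) (- (G0 * G2 + G2 * G0)) (- (G0 * G1 + G1 * G0)) 0.
- by split; ncr (ii,(jj,(ji,(i0,(i1,(i2,(i3,(j0,(j1,(j2,(j3,I))))))))))).
- by split; ncr (ii,(jj,(ji,(i0,(i1,(i2,(i3,(j0,(j1,(j2,(j3,I))))))))))).
- transitivity (2 * a * (2 * b) + 2 * b * (2 * a)).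
    by rewrite aE bE; ncr (ii,(jj,(ji,(i0,(i1,(i2,(i3,(j0,(j1,(j2,(j3,I))))))))))).
  by transitivity (4 * (a * b + b * a)); [nc | rewrite ab mulr0].
move=> g12 /eqP; rewrite oppr_eq0 => /eqP g02 /eqP; rewrite oppr_eq0 => /eqP g01 _.
have [] := ind (G1 * G3 + G3 * G1) (- (G0 * G3 + G3 * G0)) 0 (- (G0 * G1 + G1 * G0)).
- by split; ncr (ii,(jj,(ji,(i0,(i1,(i2,(i3,(j0,(j1,(j2,(j3,I))))))))))).
- by split; ncr (ii,(jj,(ji,(i0,(i1,(i2,(i3,(j0,(j1,(j2,(j3,I))))))))))).
- transitivity (2 * a * (2 * c) + 2 * c * (2 * a)).
    by rewrite aE cE /k; ncr (ii,(jj,(ji,(i0,(i1,(i2,(i3,(j0,(j1,(j2,(j3,I))))))))))).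
  by transitivity (4 * (a * c + c * a)); [nc | rewrite ac mulr0].
move=> g13 /eqP; rewrite oppr_eq0 => /eqP g03 _ _.
have [] := ind (G2 * G3 + G3 * G2) 0 (- (G0 * G3 + G3 * G0)) (- (G0 * G2 + G2 * G0)).
- by split; ncr (ii,(jj,(ji,(i0,(i1,(i2,(i3,(j0,(j1,(j2,(j3,I))))))))))).
- by split; ncr (ii,(jj,(ji,(i0,(i1,(i2,(i3,(j0,(j1,(j2,(j3,I))))))))))).
- transitivity (2 * b * (2 * c) + 2 * c * (2 * b)).
    by rewrite bE cE /k; ncr (ii,(jj,(ji,(i0,(i1,(i2,(i3,(j0,(j1,(j2,(j3,I))))))))))).
  by transitivity (4 * (b * c + c * b)); [nc | rewrite bc mulr0].
move=> g23 _ _ _.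
have [] := ind (G0 * G0 - G1 * G1 - G2 * G2 - G3 * G3 + 48)
  (G0 * G1 + G1 * G0 + G2 * G3 - G3 * G2) (G0 * G2 + G2 * G0 + G3 * G1 - G1 * G3)
  (G0 * G3 + G3 * G0 + G1 * G2 - G2 * G1).
- by split; ncr (ii,(jj,(ji,(i0,(i1,(i2,(i3,(j0,(j1,(j2,(j3,I))))))))))).
- by split; ncr (ii,(jj,(ji,(i0,(i1,(i2,(i3,(j0,(j1,(j2,(j3,I))))))))))).
- transitivity (4 * H * (4 * H) + 48); last by ncr (HH,I).
  by rewrite HE /k; ncr (ii,(jj,(ji,(i0,(i1,(i2,(i3,(j0,(j1,(j2,(j3,I))))))))))).
rewrite g01 g02 g03 !add0r => s0 c23 c31 c12.
have anti (X Y : R) : X * Y + Y * X = 0 -> X * Y - Y * X = 0 -> X * Y = 0 /\ Y * X = 0.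
  move=> p m; split; apply: mul2I.
    by transitivity ((X * Y + Y * X) + (X * Y - Y * X)); [nc | rewrite p m addr0].
  by transitivity ((X * Y + Y * X) - (X * Y - Y * X)); [nc | rewrite p m subr0].
have [z12 z21] := anti _ _ g12 c12; have [z23 z32] := anti _ _ g23 c23.
have [z31 z13] : G3 * G1 = 0 /\ G1 * G3 = 0 by apply: anti; rewrite // addrC.
have sG: - (3 * (G0 * G0)) + (G1 * G1 + G2 * G2 + G3 * G3) = 80.
  transitivity (4 * (a * a + b * b + c * c)); last by rewrite sq; nc.
  transitivity (2 * a * (2 * a) + 2 * b * (2 * b) + 2 * c * (2 * c)); last by nc.
  transitivity (- (3 * (G0 * G0)) + (G1 * G1 + G2 * G2 + G3 * G3)
     - (G0 * G1 + G1 * G0) * i - (G0 * G2 + G2 * G0) * j - (G0 * G3 + G3 * G0) * k).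
    by rewrite g01 g02 g03 !mul0r !subr0.
  by rewrite aE bE cE /k; ncr (ii,(jj,(ji,(i0,(i1,(i2,(i3,(j0,(j1,(j2,(j3,I))))))))))).
have G00: G0 * G0 = - 16.
  apply/eqP; rewrite -addr_eq0; apply/eqP; apply: mul2I.
  transitivity (80 - (- (3 * (G0 * G0)) + (G1 * G1 + G2 * G2 + G3 * G3)) - (G0 * G0 - G1 * G1 - G2 * G2 - G3 * G3 + 48)).
    by nc.
  by rewrite s0 sG subrr subr0.
exists G0, G1, G2, G3; split=> //.
  by split=> //; apply/eqP; rewrite -addr_eq0 addrC g01.
split=> //; apply/eqP; rewrite -subr_eq0; apply/eqP.
transitivity (G0 * G0 + 16 - (G0 * G0 - G1 * G1 - G2 * G2 - G3 * G3 + 48)); first by nc.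
by rewrite s0 G00 addNr subr0.
Qed.

(** Commuting with [i] kills the coefficients of [j] and [k], so [4 H = G0 + G1 i] with
    [G0 ^ 2 = -16] and [G1 ^ 2 = 32]. Conjugation by [j] changes the sign of [i], and the sum is
    [2 (-16 + 32) / 16]. *)
Lemma quat_four_comm : A1 * A1 = 20 -> A2 * A2 = 20 -> A3 * A3 = 20 -> A4 * A4 = 20 ->
  i * H = H * i -> H * (- (j * H * j)) + - (j * H * j) * H = 2.
Proof.
case: (Qij) => ii jj ji A11 A22 A33 A44 iH.
have [G0 [G1 [G2 [G3 [[i0 i1 i2 i3] [j0 j1 j2 j3] HE [g12 g13 g23 g32 g10] [G00 sG]]]]]] :=
  quat_four_golden A11 A22 A33 A44.
have [] := quat_indep (c0 := 0) (c1 := 0) (c2 := - (2 * G3)) (c3 := 2 * G2) Qij.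
- by split; ncr (i2,(i3,I)).
- by split; ncr (j2,(j3,I)).
- transitivity (i * (4 * H) - 4 * H * i); last by ncr (iH,I).
  by rewrite HE /k; ncr (ii,(jj,(ji,(i0,(i1,(i2,(i3,(j0,(j1,(j2,(j3,I))))))))))).
move=> _ _ G3_0 G2_0.
have {}G3_0: G3 = 0 by apply: mul2I; apply: oppr_inj; rewrite oppr0 -G3_0; nc.
have {}G2_0: G2 = 0 by apply: mul2I; rewrite -G2_0; nc.
have G11: G1 * G1 = 32 by rewrite -sG G2_0 G3_0 !mulr0 !addr0.
rewrite G2_0 G3_0 !mul0r !addr0 in HE.
do 4!apply: add2I.
transitivity (4 * H * (- (j * (4 * H) * j)) + - (j * (4 * H) * j) * (4 * H)); first by nc.
by rewrite HE; ncr (ii,(jj,(ji,(i0,(i1,(j0,(j1,(G00,(G11,(g10,I)))))))))).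
Qed.

End Golden.

End Quaternions.

(** * The four traces of a square root of -3 *)

Section Quaternions.

Variable R : unitRingType.
Hypothesis mul2I : forall a : R, a + a = 0 -> a = 0.
Hypothesis unit3 : (3%:R : R) \is a GRing.unit.
Implicit Types i j H : R.

Let add2I (a b : R) : a + a = b + b -> a = b.
Proof.
move=> e; apply/eqP; rewrite -subr_eq0; apply/eqP/mul2I.
transitivity (a + a - (b + b)); [by nc | by rewrite e subrr].
Qed.

Definition pm2 (A : R) := A = 2 \/ A = -2.

Let four0 : 4%:R = 0 :> R -> False.
Proof.
by move=> e; have /eqP[] := oner_neq0 R; do 2!apply: mul2I; rewrite -e; nc.
Qed.

Lemma normal_formN i j u v w H :
    (forall T, u * T = T * u -> v * T = T * v -> i * T = T * i /\ j * T = T * j) ->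
  normal_form u v v w H -> normal_form i j v w H.
Proof.
move=> cT [T [e1 [e2 [TT [uT vT] e1E e2E HE]]]].
by exists T, e1, e2; split=> //; apply: cT.
Qed.

Lemma normal_form_oppr i j u v H : normal_form i j u (- v) H -> normal_form i j u v H.
Proof.
move=> [T [e1 [e2 [TT cT e1E e2E HE]]]]; exists T, e1, (- e2); split=> //.
  by case: e2E => ->; [right | left; rewrite opprK].
by rewrite HE; nc.
Qed.

(** The cases are sorted by the number of golden traces, the sum being 0. None, one or three are
    impossible. With two, the other two are opposite, so one of [a], [b], [c] vanishes and
    [quat_two_golden] applies after a cyclic shift or a change of signs. *)
Lemma quat_traces i j H (k := i * j)
    (a := i * H + H * i) (b := j * H + H * j) (c := k * H + H * k)
    (A1 := a + b + c) (A2 := a - b - c) (A3 := - a + b - c) (A4 := - a - b + c)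
    (golden := fun A : R => A * A = 20) :
    quat i j -> H * H = - 3 ->
    pm2 A1 \/ golden A1 -> pm2 A2 \/ golden A2 -> pm2 A3 \/ golden A3 -> pm2 A4 \/ golden A4 ->
  [\/ normal_form i j j k H, normal_form i j k i H, normal_form i j i j H |
   [/\ golden A1, golden A2, golden A3 & golden A4]].
Proof.
move=> Qij HH g1 g2 g3 g4; have [ii jj ji] := Qij.
have [Qjk jk] := quat_cycle Qij; have [Qki ki] := quat_cycle Qjk; rewrite -/k in Qjk jk Qki ki.
rewrite jk in Qki ki.
have sum0: A1 + A2 + A3 + A4 = 0 by rewrite /A1 /A2 /A3 /A4; nc.
have three u v w x y t: quat u v -> u * v = w -> u * H + H * u = x -> v * H + H * v = y ->
    w * H + H * w = t -> golden (x + y + t) -> golden (x - y - t) -> golden (- x + y - t) ->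
    pm2 (- x - y + t) -> False.
  by move=> Q <- <- <- <-; apply: quat_three_golden.
have two u v w x y t: quat u v -> u * v = w -> u * H + H * u = x -> v * H + H * v = y ->
    w * H + H * w = t -> x = 0 -> golden (x + y + t) -> pm2 (- x + y - t) -> normal_form u v v w H.
  by move=> Q <- <- <- <-; apply: quat_two_golden.
have none u v w x y t: quat u v -> u * v = w -> u * H + H * u = x -> v * H + H * v = y ->
    w * H + H * w = t -> y = 0 -> t = 0 -> pm2 x -> False.
  by move=> Q <- <- <- <-; apply: quat_no_golden1.
have NH u : - u * H + H * - u = - (u * H + H * u) by nc.
(* [X] would be 2, -2, 6 or -6, whose squares 4 and 36 both differ from 20 by 16. *)
have one X (p q r : R) : golden X -> pm2 p -> pm2 q -> pm2 r -> X + p + q + r = 0 -> False.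
  move=> XX p2 q2 r2 s0; have XE: X = - p - q - r by apply/eqP; rewrite -subr_eq0 -s0; apply/eqP; nc.
  rewrite /golden XE in XX; apply: four0; do 2!apply: mul2I.
  by move: XX; case: p2 => ->; case: q2 => ->; case: r2 => -> XX;
    (transitivity (20 - 4 : R); [nc | rewrite -XX; nc]) ||
    (transitivity (36 - 20 : R); [nc | rewrite -XX; nc]).
(* If [p = q = 2 e] with [e] equal to 1 or -1, then [(Y + 4 e) ^ 2 = 20] gives [Y = - 2 e], whose
   square is 4. *)
have opp X Y (p q : R) : golden X -> golden Y -> pm2 p -> pm2 q -> X + Y + p + q = 0 -> p + q = 0.
  rewrite /golden => XX YY p2 q2 s0.
  have same e : e = 1 \/ e = -1 -> p = 2 * e -> q = 2 * e -> False.
    move=> e1 pE qE; have ee: e * e = 1 by case: e1 => ->; nc.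
    have eY: e * Y = Y * e by case: e1 => ->; nc.
    have XE: X = - Y - 4 * e by apply/eqP; rewrite -subr_eq0 -s0 pE qE; apply/eqP; nc.
    have YE: Y = - (2 * e).
      apply/eqP; rewrite -addr_eq0; apply/eqP.
      have: (Y + 2 * e) * e = 0.
        do 3!apply: mul2I; transitivity (X * X - 20); last by rewrite XX subrr.
        by rewrite XE; ncr (YY,(ee,(eY,I))).
      by move=> s1; transitivity ((Y + 2 * e) * e * e); [ncr (ee,I) | rewrite s1 mul0r].
    apply: four0; do 2!apply: mul2I; transitivity (20 - Y * Y); last by rewrite YY subrr.
    by rewrite YE; ncr (ee,I).
  case: p2 q2 => pE [] qE; try by rewrite pE qE; nc.
    by case: (same 1); rewrite ?pE ?qE ?mulr1 //; left.
  by case: (same (-1)); rewrite ?pE ?qE ?mulrN1 //; right.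
have a0 : A3 + A4 = 0 \/ A1 + A2 = 0 -> a = 0.
  by case=> s0; apply: mul2I; [apply: oppr_inj; rewrite oppr0|]; rewrite -s0 /A1 /A2 /A3 /A4; nc.
have b0 : A2 + A4 = 0 \/ A1 + A3 = 0 -> b = 0.
  by case=> s0; apply: mul2I; [apply: oppr_inj; rewrite oppr0|]; rewrite -s0 /A1 /A2 /A3 /A4; nc.
have c0 : A2 + A3 = 0 \/ A1 + A4 = 0 -> c = 0.
  by case=> s0; apply: mul2I; [apply: oppr_inj; rewrite oppr0|]; rewrite -s0 /A1 /A2 /A3 /A4; nc.
have [QiN QNj QNN] := quat_sign Qij; have [_ QNk _] := quat_sign Qjk.
have [_ QNki _] := quat_sign Qki.
have commij T : j * T = T * j -> k * T = T * k -> i * T = T * i /\ j * T = T * j.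
  by move=> jT kT; split=> //; rewrite -jk; ncr (jT,(kT,I)).
have commki T : k * T = T * k -> i * T = T * i -> i * T = T * i /\ j * T = T * j.
  by move=> kT iT; split=> //; rewrite -ki; ncr (iT,(kT,I)).
have cast (P : R -> Prop) x y : x = y -> P x -> P y by move->.
have A1b : b + c + a = A1 by rewrite /A1; nc.
have A1c : c + a + b = A1 by rewrite /A1; nc.
have kE : - i * j = - k by rewrite mulNr.
have iE : - j * k = - i by rewrite mulNr jk.
have jE : - k * i = - j by rewrite mulNr ki.
case: g1 => g1; case: g2 => g2; case: g3 => g3; case: g4 => g4.
- have: (A1 + A3 = 0 /\ A1 + A4 = 0) \/ (A1 + A2 = 0 /\ A1 + A4 = 0) \/ (A1 + A2 = 0 /\ A1 + A3 = 0).
    move: sum0; case: g1 => ->; case: g2 => ->; case: g3 => ->; case: g4 => -> sum0;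
    first [ by left; split; nc | by right; left; split; nc | by right; right; split; nc
      | by case: four0; apply: mul2I; rewrite -[in RHS]sum0; nc
      | by case: four0; rewrite -[in RHS]sum0; nc
      | by case: four0; apply: oppr_inj; rewrite oppr0 -[in RHS]sum0; nc
      | by case: four0; apply: mul2I; apply: oppr_inj; rewrite oppr0 -[in RHS]sum0; nc ].
  case=> [[s13 s14] | [[s12 s14] | [s12 s13]]].
  + have [b_0 c_0] := (b0 (or_intror s13), c0 (or_intror s14)).
    case: (none i j k a b c) => //; apply: cast g1; by rewrite /A1 b_0 c_0 !addr0.
  + have [a_0 c_0] := (a0 (or_intror s12), c0 (or_intror s14)).
    case: (none j k i b c a) => //; apply: cast g1; by rewrite /A1 a_0 c_0 addr0 add0r.
  have [a_0 b_0] := (a0 (or_intror s12), b0 (or_intror s13)).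
  case: (none k i j c a b) => //; apply: cast g1; by rewrite /A1 a_0 b_0 !add0r.
- by case: (one A4 A1 A2 A3) => //; rewrite -sum0; nc.
- by case: (one A3 A1 A2 A4) => //; rewrite -sum0; nc.
- have a_0: a = 0 by apply: a0; right; apply: (opp A3 A4) => //; rewrite -sum0; nc.
  constructor 1; apply: normal_form_oppr; apply: normal_formN _ _.
    2: apply: (two (- i) j (- k) (- a) b (- c)) => //.
  + by move=> T; rewrite mulNr mulrN => /oppr_inj.
  + by rewrite a_0 oppr0.
  + by apply: cast g1; rewrite /A1; nc.
- by case: (one A2 A1 A3 A4) => //; rewrite -sum0; nc.
- have b_0: b = 0 by apply: b0; right; apply: (opp A2 A4) => //; rewrite -sum0; nc.
  constructor 2; apply: normal_form_oppr; apply: normal_formN _ _.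
    2: apply: (two (- j) k (- i) (- b) c (- a)) => //.
  + by move=> T; rewrite mulNr mulrN => /oppr_inj; apply: commij.
  + by rewrite b_0 oppr0.
  + by apply: cast g4; rewrite /A4; nc.
  + by apply: cast g1; rewrite /A1; nc.
- have c_0: c = 0 by apply: c0; right; apply: (opp A2 A3) => //; rewrite -sum0; nc.
  constructor 3; apply: normal_form_oppr; apply: normal_formN _ _.
    2: apply: (two (- k) i (- j) (- c) a (- b)) => //.
  + by move=> T; rewrite mulNr mulrN => /oppr_inj; apply: commki.
  + by rewrite c_0 oppr0.
  + by apply: cast g2; rewrite /A2; nc.
  + by apply: cast g1; rewrite /A1; nc.
- case: (three (- i) (- j) k (- a) (- b) c) => //.
  + by rewrite mulrNN.
  + by apply: cast g3; rewrite /A3; nc.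
  + by apply: cast g2; rewrite /A2; nc.
  + by apply: cast g1; rewrite /A1; nc.
- by case: (one A1 A2 A3 A4) => //; rewrite -sum0; nc.
- have c_0: c = 0 by apply: c0; left; apply: (opp A1 A4) => //; rewrite -sum0; nc.
  constructor 3; apply: normal_formN commki _.
  apply: (two k i j c a b) => //; first by rewrite A1c.
  by apply: cast g2; rewrite /A2; nc.
- have b_0: b = 0 by apply: b0; left; apply: (opp A1 A3) => //; rewrite -sum0; nc.
  constructor 2; apply: normal_formN commij _.
  apply: (two j k i b c a) => //; first by rewrite A1b.
  by apply: cast g4; rewrite /A4; nc.
- case: (three j k i b c a) => //; first by rewrite A1b.
  + by apply: cast g3; rewrite /A3; nc.
  + by apply: cast g4; rewrite /A4; nc.
  + by apply: cast g2; rewrite /A2; nc.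
- have a_0: a = 0 by apply: a0; left; apply: (opp A1 A2) => //; rewrite -sum0; nc.
  by constructor 1; apply: (two i j k a b c).
- case: (three k i j c a b) => //; first by rewrite A1c.
  + by apply: cast g4; rewrite /A4; nc.
  + by apply: cast g2; rewrite /A2; nc.
  + by apply: cast g3; rewrite /A3; nc.
- by case: (three i j k a b c).
by constructor 4.
Qed.
End Quaternions.

(** * Uniqueness of the normal form *)

Section Unique.

Variable R : unitRingType.
Hypothesis mul2I : forall a : R, a + a = 0 -> a = 0.
Hypothesis unit3 : (3%:R : R) \is a GRing.unit.
Hypothesis unit5 : (5%:R : R) \is a GRing.unit.

(** The possible values of [tri] on two elements of order 3: 6 or -6 if they commute, and 2, -2 or a
    square root of 20 otherwise. *)
Definition trace_value (t : R) :=
  (exists2 n, t = 2 * n & [\/ n = 1, n = -1, n = 3 | n = -3]) \/ t * t = 20.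

(** [K1] and [K2] are to be conjugates of [K] under the binary tetrahedral group. The first trace
    yields [(M - 40) (M + 24) = 0], the second [C = 0]. Once [T] and [U] commute,
    [M ^ 2 = 4 * 20 * 20] leaves [M = 40], that is [T U = 20 = T T]. *)
Lemma normal_form_unique i j T U (H K K1 K2 : R) (k := i * j) :
    quat i j -> T * T = 20 -> U * U = 20 ->
    i * T = T * i -> j * T = T * j -> i * U = U * i -> j * U = U * j ->
    4 * H = (T + 2) * i + (T - 2) * j -> 4 * K = (U + 2) * i + (U - 2) * j ->
    4 * K1 = (U + 2) * i - (U - 2) * j -> 4 * K2 = (U + 2) * j + (U - 2) * k ->
    trace_value (H * K1 + K1 * H) -> trace_value (H * K2 + K2 * H) ->
  K = H.
Proof.
move=> Qij TT UU iT jT iU jU HE KE K1E K2E tv1 tv2; have [ii jj ji] := Qij.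
have n10 : (1 : R) != 0 by apply: oner_neq0.
pose M := T * U + U * T; pose C := T * U - U * T.
have ind c0 c1 c2 c3 :
    [/\ i * c0 = c0 * i, i * c1 = c1 * i, i * c2 = c2 * i & i * c3 = c3 * i] ->
    [/\ j * c0 = c0 * j, j * c1 = c1 * j, j * c2 = c2 * j & j * c3 = c3 * j] ->
    c0 + c1 * i + c2 * j + c3 * (i * j) = 0 -> [/\ c0 = 0, c1 = 0, c2 = 0 & c3 = 0].
  exact: quat_indep.
have t1E: 8 * (H * K1 + K1 * H) = - (4 * (T + U)) - C * k.
  apply/eqP; rewrite -subr_eq0; apply/eqP; apply: mul2I.
  transitivity (4 * H * (4 * K1) + 4 * K1 * (4 * H) + 2 * (4 * (T + U)) + 2 * (C * k)); first by nc.
  by rewrite HE K1E /C /k; ncr (ii,(jj,(ji,(iT,(jT,(iU,(jU,I))))))).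
have t2E: 16 * (H * K2 + K2 * H) = - (M + 4 * T - 4 * U - 8) + C * (i - j + k).
  transitivity (4 * H * (4 * K2) + 4 * K2 * (4 * H)); first by nc.
  by rewrite HE K2E /M /C /k; ncr (ii,(jj,(ji,(iT,(jT,(iU,(jU,I))))))).
have eq1: M * M = 16 * M + 960.
  (* A value [2 n] would give [U = - T - 4 n], hence [T = - 2 n], whose square is 4 or 36 instead of
     20. In the golden case the scalar part of the squared trace is the equation, because
     [C ^ 2 = M ^ 2 - 1600]. *)
  case: tv1 => [[n nE nC] | t20].
    have [] := ind (- (4 * (T + U)) - 16 * n) 0 0 (- C).
    - by rewrite /C; split; case: nC => ?; subst n; ncr (iT,(iU,I)).
    - by rewrite /C; split; case: nC => ?; subst n; ncr (jT,(jU,I)).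
    - rewrite -/k; transitivity (8 * (H * K1 + K1 * H) - 16 * n); first by rewrite t1E; nc.
      by rewrite nE; nc.
    move=> s0 _ _ _; have UE: U = - T - 4 * n.
      apply/eqP; rewrite -subr_eq0; apply/eqP; do 2!apply: mul2I; apply: oppr_inj.
      by rewrite oppr0 -s0; nc.
    have nT: n * T = T * n by case: nC => ->; nc.
    have nTn: n * (T + 2 * n) = 0.
      do 3!apply: mul2I; transitivity (U * U - 20); last by rewrite UU subrr.
      by rewrite UE; ncr (TT,(nT,I)).
    have un: n \is a GRing.unit.
      by case: nC => ->; rewrite ?unitrN ?unitr1 ?unit3.
    have TE: T = - (2 * n).
      by apply/eqP; rewrite -addr_eq0; apply/eqP; apply: (mulrI un); rewrite nTn mulr0.
    have four: 16%:R = 0 :> R.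
      case: nC => nE'; move: TT; rewrite TE nE' => e.
      - by transitivity (20 - 2 * 1 * (2 * 1) : R); [nc | rewrite -e; nc].
      - by transitivity (20 - 2 * 1 * (2 * 1) : R); [nc | rewrite -e; nc].
      - by transitivity (2 * 3 * (2 * 3) - 20 : R); [nc | rewrite -e; nc].
      - by transitivity (2 * 3 * (2 * 3) - 20 : R); [nc | rewrite -e; nc].
    by case/eqP: n10; do 4!apply: mul2I; rewrite -four; nc.
  have [] := ind (16 * (40 + M) - C * C - 1280) 0 0 (4 * ((T + U) * C + C * (T + U))).
  - by rewrite /C /M; split; ncr (iT,(iU,I)).
  - by rewrite /C /M; split; ncr (jT,(jU,I)).
  - transitivity (8 * (H * K1 + K1 * H) * (8 * (H * K1 + K1 * H)) - 1280).
      by rewrite t1E /C /M /k; ncr (ii,(jj,(ji,(iT,(jT,(iU,(jU,(TT,(UU,I))))))))).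
    transitivity (64 * ((H * K1 + K1 * H) * (H * K1 + K1 * H)) - 1280); first by nc.
    by rewrite t20; nc.
  move=> e _ _ _; apply/eqP; rewrite -subr_eq0 -oppr_eq0; apply/eqP.
  by rewrite -e /C /M; ncr (TT,(UU,I)).
have C0: C = 0.
  case: tv2 => [[n nE nC] | t20].
    have [] := ind (- (M + 4 * T - 4 * U - 8) - 32 * n) C (- C) C.
    - by rewrite /C /M; split; case: nC => ?; subst n; ncr (iT,(iU,I)).
    - by rewrite /C /M; split; case: nC => ?; subst n; ncr (jT,(jU,I)).
    - rewrite -/k; transitivity (16 * (H * K2 + K2 * H) - 32 * n); first by rewrite t2E; nc.
      by rewrite nE; nc.
    by move=> _ ->.
  pose P := - (M + 4 * T - 4 * U - 8).
  have [] := ind (P * P - 3 * (C * C) - 5120) (P * C + C * P) (- (P * C + C * P)) (P * C + C * P).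
  - by rewrite /P /C /M; split; ncr (iT,(iU,I)).
  - by rewrite /P /C /M; split; ncr (jT,(jU,I)).
  - transitivity (16 * (H * K2 + K2 * H) * (16 * (H * K2 + K2 * H)) - 5120).
      by rewrite t2E /P /C /M /k; ncr (ii,(jj,(ji,(iT,(jT,(iU,(jU,(TT,(UU,I))))))))).
    transitivity (256 * ((H * K2 + K2 * H) * (H * K2 + K2 * H)) - 5120); first by nc.
    by rewrite t20; nc.
  move=> _ PC _ _; have MC: (M - 8) * C = 0.
    apply: mul2I; apply: oppr_inj; rewrite oppr0 -PC /P /C /M; ncr (TT,(UU,I)).
  (* [(M - 8) ^ 2 = 1024 = 2 ^ 10] by [eq1], so [(M - 8) C = 0] kills [C]. *)
  do 10!apply: mul2I; transitivity ((M - 8) * ((M - 8) * C)); last by rewrite MC mulr0.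
  by ncr (eq1,I).
have cTU: U * T = T * U by apply/eqP; rewrite eq_sym -subr_eq0 -/C C0.
have M40: M = 40.
  apply/eqP; rewrite -subr_eq0; apply/eqP; do 4!apply: mul2I; apply: oppr_inj; rewrite oppr0.
  transitivity (M * M - 16 * M - 960); last by rewrite eq1; nc.
  by rewrite /M; ncr (cTU,(TT,(UU,I))).
have UT: U = T.
  apply/eqP; rewrite -subr_eq0; apply/eqP; apply: (mulrI unit5); rewrite mulr0.
  do 3!apply: mul2I; transitivity (T * (M - 40)); last by rewrite M40 subrr mulr0.
  by rewrite /M; ncr (cTU,(TT,I)).
apply/eqP; rewrite -subr_eq0; apply/eqP; do 2!apply: mul2I.
transitivity (4 * K - 4 * H); first by nc.
by rewrite KE HE UT subrr.
Qed.

End Unique.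

Local Close Scope ring_scope.
Local Open Scope group_scope.

(** * Transfer *)

(** A computable form of the transfer: [X] represents the orbits of [<[g]>] on the right cosets of
    [H], and [n x] is the length of the orbit of the coset of [x]. *)
Lemma transfer_abelian (gT : finGroupType) (G H : {group gT}) :
    H \subset G -> abelian H ->
  exists V : {morphism G >-> gT}, V @* G \subset H /\
    {in G, forall g, exists X : {set gT}, exists n : gT -> nat,
      [/\ X \subset G, forall x, n x = #|<[g]> : <[g]> :&: H :^ x|, (\sum_(x in X) n x)%N = #|G : H|,
          {in X, forall x, (g ^+ n x) ^ x^-1 \in H}
        & V g = \prod_(x in X) (g ^+ n x) ^ x^-1]}.
Proof.
move=> sHG abH; have abH': abelian (idm H @* H) by rewrite morphim_idm.
pose V g := val (transfer G abH' g).
have VM: {in G &, {morph V : x y / x * y}}.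
  by move=> x y Gx Gy; rewrite /V transferM // FiniteModule.fmvalA.
exists (Morphism VM); split.
  have /subsetP sHH: idm H @* H \subset H by rewrite morphim_idm.
  by apply/subsetP=> _ /morphimP[x _ Gx ->]; apply/sHH/FiniteModule.fmodP.
move=> g Gg; pose HG := rcosets H G.
have partHg := rcosets_cycle_partition sHG Gg.
have [X trX] : exists X, is_transversal X (HG :* <[g]>) G.
  by exists (transversal (HG :* <[g]>) G); apply: transversalP.
have nE x: #|<[g]> : <[g]> :&: H :^ x| = #|<[g]> : H :* x|.
  transitivity #|orbit 'Rs <[g]> (rcoset H x)|; last by rewrite orbitRs rcosetE.
  by rewrite card_orbit astab1_act astab1Rs.
pose n x := #|<[g]> : H :* x|; exists X, n.
have sXG: X \subset G by apply: transversal_sub trX.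
have HX: {in X, forall x, (g ^+ n x) ^ x^-1 \in H}.
  move=> x Xx; have := mulg_exp_card_rcosets H g x; rewrite mem_rcoset.
  by rewrite conjgE invgK mulgA.
split=> //; first by rewrite -(sum_index_rcosets_cycle sHG Gg trX).
rewrite /= /V (transfer_cycle_expansion sHG abH' Gg trX).
rewrite (big_morph _ (@FiniteModule.fmvalA _ _ abH') (erefl _)).
apply: eq_bigr => x Xx; rewrite /= /restrm /= FiniteModule.fmodK //.
have /subsetP sHH: H \subset idm H @* H by rewrite morphim_idm.
exact/sHH/HX.
Qed.

(* Burnside: the transfer into [S] is [x |-> x ^ #|G : S|] on [S], as fusion in the abelian
   group [S] is controlled by ['N_G(S)]. *)
Lemma Burnside_transfer (gT : finGroupType) p (G S : {group gT}) :
    p.-Sylow(G) S -> abelian S -> 'N_G(S) \subset 'C(S) ->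
  exists V : {morphism G >-> gT}, V @* G \subset S /\ {in S, forall x, V x = x ^+ #|G : S|}.
Proof.
move=> sylS abS cSN; have sSG := pHall_sub sylS.
have [V [sVS VE]] := transfer_abelian sSG abS; exists V; split=> // g Sg.
have Gg := subsetP sSG g Sg; have [X [n [sXG _ sumn HX ->]]] := VE g Gg.
(* [S] and [S :^ y] are Sylow subgroups of the centraliser of [u ^ y]. An element [c] of that
   centraliser corrects [y] so that [y * c] normalises [S], hence centralises it. *)
have fix_u x: x \in X -> (g ^+ n x) ^ x^-1 = g ^+ n x.
  move=> Xx; set u := g ^+ n x; set y := x^-1; have Gy: y \in G by rewrite groupV (subsetP sXG).
  have Su: u \in S by rewrite groupX.
  have Suy: u ^ y \in S := HX x Xx.
  have cS v: v \in S -> S \subset 'C_G[v].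
    by move=> Sv; rewrite subsetI sSG sub_cent1 (subsetP abS).
  have sylC (P : {group gT}) : P \subset 'C_G[u ^ y] -> p.-Sylow(G) P -> p.-Sylow('C_G[u ^ y]) P.
    by move=> sPC; apply: pHall_subl; rewrite ?subsetIl.
  have sylSy: p.-Sylow('C_G[u ^ y]) (S :^ y).
    apply: sylC; last by rewrite pHallJ.
    by rewrite -[X in X :&: _](conjGid Gy) cent1J -conjIg conjSg cS.
  have [c /setIP[Gc cuc] eqS] := Sylow_trans sylSy (sylC S (cS _ Suy) sylS).
  have /centP/(_ u Su) cyc: y * c \in 'C(S).
    by apply: (subsetP cSN); rewrite inE groupM //=; apply/normP; rewrite conjsgM -eqS.
  have: u ^ (y * c) = u by rewrite conjgE -cyc mulKg.
  by rewrite conjgM [_ ^ c]conjgE -(cent1P cuc) mulKg.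
rewrite -sumn (eq_bigr (fun x => g ^+ n x)) //.
by elim/big_rec2: _ => [|x m _ Xx ->]; rewrite ?expg0 // expgD.
Qed.

(** The complement is the kernel of the transfer, which on [S] is a power map with exponent coprime
    to [#|S|]. *)
Lemma Burnside_complement (gT : finGroupType) p (G S : {group gT}) :
    p.-Sylow(G) S -> abelian S -> 'N_G(S) \subset 'C(S) ->
  exists K : {group gT}, [/\ K <| G, K :&: S = 1 & K * S = G].
Proof.
move=> sylS abS cSN; have [V [sVS VS]] := Burnside_transfer sylS abS cSN.
have sSG := pHall_sub sylS.
have VS_inj: 'ker V :&: S = 1.
  apply/trivgP/subsetP=> x /setIP[Kx Sx]; have := VS x Sx; rewrite (mker Kx) => /esym xn1.
  rewrite inE -order_eq1 -dvdn1 -(eqP (_ : coprime #|S| #|G : S|)).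
    by rewrite dvdn_gcd order_dvdG //= order_dvdn xn1.
  by have /andP[_ ] := sylS; have /pHall_Hall/andP[_] := sylS.
exists ('ker V)%G; split=> //; first exact: ker_normal.
apply/eqP; rewrite eqEcard mul_subG ?subsetIl //= TI_cardMg //.
have := card_morphim V G; rewrite setIid => iK.
by rewrite -(Lagrange (normal_sub (ker_normal V))) -iK leq_mul2l subset_leq_card ?orbT.
Qed.

(* Every [<[u]>]-orbit on the cosets of [A] has length 2, so [V u = z ^+ m]. *)
Lemma transfer_involution (gT : finGroupType) (G A : {group gT}) u z m :
    A \subset G -> abelian A -> z \in A -> z \in 'Z(G) -> #[z] = 2 ->
    u \in G -> u ^+ 2 = z -> {in G, forall x, u ^ x \notin A} ->
    #|G : A| = (2 * m)%N -> odd m ->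
  exists V : {morphism G >-> gT}, [/\ V @* G \subset A, V u = z & V z = 1].
Proof.
move=> sAG abA Az /setIP[Gz cGz] oz Gu u2 uA iA odd_m.
have [V [sVA VE]] := transfer_abelian sAG abA.
have zJ x : x \in G -> z ^ x = z by move=> Gx; apply/conjg_fixP/commgP; apply: (centP cGz).
have zm : z ^+ m = z by rewrite -[m]odd_double_half odd_m expgD -muln2 mulnC expgM -oz expg_order expg1n mulg1.
have ou: #[u] = 4.
  have u4: u ^+ 4 = 1 by rewrite (expgM u 2 2) u2 -oz expg_order.
  have: #[u] %| 2 ^ 2 by rewrite order_dvdn u4.
  case/(dvdn_pfactor _ _ (isT : prime 2)) => -[|[|[|k]]] // _ ouE.
    by move/eqP: ouE; rewrite order_eq1 => /eqP u1; move: oz; rewrite -u2 u1 expg1n order1.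
  suff /eqP u21: u ^+ 2 == 1 by move: oz; rewrite -u2 u21 order1.
  by rewrite -order_dvdn ouE.
have Az' x : x \in G -> z \in A :^ x by move=> Gx; rewrite -(zJ x Gx) memJ_conjg.
exists V; split=> //.
  have [X [n [/subsetP sXG nE sumn HX ->]]] := VE u Gu.
  have n2 x: x \in X -> n x = 2.
    move=> /sXG Gx; rewrite nE -divgS ?subsetIl // -orderE ou.
    have: #|<[u]> :&: A :^ x| %| 2 ^ 2 by rewrite -[(2 ^ 2)%N]ou cardSg ?subsetIl.
    case/(dvdn_pfactor _ _ (isT : prime 2)) => -[|[|[|k]]] // _ oI; first 1 last.
    - by rewrite oI.
    - have /eqP/setIidPl: <[u]> :&: A :^ x == <[u]> by rewrite eqEcard subsetIl oI -orderE ou.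
      by rewrite cycle_subG mem_conjg (negPf (uA _ _)) ?groupV.
      have: z \in (1 : {set gT}) by rewrite -(card1_trivg oI) inE -{1}u2 mem_cycle Az'.
      by move/set1gP=> z1; move: oz; rewrite z1 order1.
  rewrite (eq_bigr (fun=> z)); last by move=> x Xx; rewrite n2 // u2 zJ ?groupV ?sXG.
  rewrite prodg_const; suff ->: #|X| = m by [].
  apply/eqP; rewrite -(eqn_pmul2l (isT : 0 < 2)) -iA -sumn mulnC -sum_nat_const.
  by apply/eqP; apply: eq_bigr => x Xx; rewrite n2.
have [X [n [/subsetP sXG nE sumn HX ->]]] := VE z Gz.
have n1 x: x \in X -> n x = 1%N.
  move=> /sXG Gx; rewrite nE; apply/eqP; rewrite indexg_eq1 subsetI subxx /=.
  by rewrite cycle_subG Az'.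
rewrite (eq_bigr (fun=> z)); last by move=> x Xx; rewrite n1 // zJ ?groupV ?sXG.
rewrite prodg_const; suff ->: #|X| = (2 * m)%N by rewrite expgM -oz expg_order expg1n.
by rewrite -iA -sumn -sum1_card; apply: eq_bigr => x Xx; rewrite n1.
Qed.

(** * Fixed-point-free representations *)

(** In a matrix ring, invertibility of [f x - 1] says that [x] fixes no nonzero vector. *)
Definition fpf_repr (gT : finGroupType) (R : unitRingType) (f : gT -> R) :=
  [/\ f 1 = 1%R, {morph f : x y / x * y >-> (x * y)%R}
    & forall x, x != 1 -> (f x - 1)%R \is a GRing.unit].

Section Fpf.

Variables (gT : finGroupType) (R : unitRingType) (f : gT -> R).
Hypothesis fpf : fpf_repr f.
Implicit Types (x y z : gT) (G H D : {group gT}).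

Let f1 : f 1 = 1%R. Proof. by case: fpf. Qed.
Let fM : {morph f : x y / x * y >-> (x * y)%R}. Proof. by case: fpf. Qed.
Let fU x : x != 1 -> (f x - 1)%R \is a GRing.unit. Proof. by case: fpf => _ _; apply. Qed.

Lemma fpfVr x : (f x * f x^-1 = 1)%R. Proof. by rewrite -fM mulgV. Qed.
Lemma fpfVl x : (f x^-1 * f x = 1)%R. Proof. by rewrite -fM mulVg. Qed.

Lemma fpf_unit x : f x \is a GRing.unit.
Proof. by apply/unitrP; exists (f x^-1); rewrite fpfVr fpfVl. Qed.

Lemma fpf_subr_unit x y : x != y -> (f x - f y)%R \is a GRing.unit.
Proof.
move=> neq_xy; have ->: (f x - f y = (f (x * y^-1) - 1) * f y)%R.
  by rewrite mulrBl mul1r -fM mulgKV.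
by rewrite unitrMl ?fpf_unit ?fU // -eq_mulgV1.
Qed.

Lemma fpf_inj : injective f.
Proof.
move=> x y eq_f; apply/eqP; apply/idPn=> /fpf_subr_unit.
by rewrite eq_f subrr unitr0.
Qed.

Lemma fpfX x n : f (x ^+ n) = (f x ^+ n)%R.
Proof. by elim: n => [|n IHn]; rewrite ?expg0 // expgS fM IHn exprS. Qed.

(** This stands in for the absence of zero divisors: a quadratic polynomial with two commuting roots
    [f y], [f z] in the image of [f] has no other root there that commutes with them. *)
Lemma fpf_eq_or x y z : ((f x - f y) * (f x - f z) = 0)%R -> x = y \/ x = z.
Proof.
move=> xyz0; have [->|ne_xy] := eqVneq x y; [by left | right].
have := mulrI (fpf_subr_unit ne_xy); move/(_ (f x - f z)%R 0%R).
by rewrite mulr0 => /(_ xyz0)/eqP; rewrite subr_eq0 => /eqP/fpf_inj.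
Qed.

Lemma fpf_abelian_cyclic G : abelian G -> cyclic G.
Proof.
apply: (@div_ring_mul_group_cyclic _ _ _ f f1) => [x y _ _|x /setD1P[x1 _]]; first exact: fM.
exact: fU.
Qed.

Lemma fpf_order3 x : #[x] = 3 -> (f x * f x = - f x - 1)%R.
Proof.
move=> ox; have x1: x != 1 by rewrite -order_eq1 ox.
apply: (mulrI (fU x1)); have: (f x * (f x * f x) = 1)%R by rewrite -!fM -[_ * (_ * _)]/(x ^+ 3) -ox expg_order.
by move=> x3; ncr (x3,I).
Qed.

Lemma fpf_order3V x : #[x] = 3 -> (f x^-1 = - 1 - f x)%R.
Proof.
move=> ox; apply: (mulrI (fpf_unit x)); rewrite fpfVr.
have xx := fpf_order3 ox; by ncr (xx,I).
Qed.

Lemma fpf_unit3 x : #[x] = 3 -> (3%:R : R)%R \is a GRing.unit.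
Proof.
move=> ox; have x1: x != 1 by rewrite -order_eq1 ox.
have ->: (3%:R = (f x - 1) * (f x^-1 - 1) :> R)%R.
  by have xx := fpf_order3 ox; rewrite (fpf_order3V ox); ncr (xx,I).
by rewrite unitrMl !fU // eq_invg1.
Qed.

Section Even.
Variable z : gT.
Hypothesis oz : #[z] = 2.

Lemma fpf_invol : (f z = -1)%R.
Proof.
have z1: z != 1 by rewrite -order_eq1 oz.
have zz: (f z * f z = 1)%R by rewrite -fM -[_ * _]/(z ^+ 2) -oz expg_order.
by apply: (mulrI (fU z1)); ncr (zz,I).
Qed.

Lemma fpf_unit2 : (2%:R : R)%R \is a GRing.unit.
Proof.
have z1: z != 1 by rewrite -order_eq1 oz.
by have := fU z1; rewrite fpf_invol -unitrN; congr (_ \is a _); nc.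
Qed.

Lemma fpf_mul2I (a : R) : (a + a = 0 -> a = 0)%R.
Proof. by move=> a0; apply: (mulrI fpf_unit2); rewrite mulr0 mulr_natl mulr2n. Qed.

Lemma fpf_invol_eq x : f x = (-1)%R -> x = z.
Proof. by rewrite -fpf_invol; apply: fpf_inj. Qed.

Lemma fpf_sqr1 x : x ^+ 2 = 1 -> x = 1 \/ x = z.
Proof.
move=> x2; have xx: (f x * f x = 1)%R by rewrite -fM -f1 -x2.
by apply: fpf_eq_or; rewrite f1 fpf_invol; ncr (xx,I).
Qed.

Lemma fpf_invol_uniq x : #[x] = 2 -> x = z.
Proof.
move=> ox; have: x ^+ 2 = 1 by rewrite -ox expg_order.
by case/fpf_sqr1=> // x1; move: ox; rewrite x1 order1.
Qed.

Lemma fpf_invol_comm x : commute z x.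
Proof. by apply: fpf_inj; rewrite !fM fpf_invol mulN1r mulrN1. Qed.

Lemma fpf_order4 x : (#[x] == 4) = (f x * f x == -1)%R.
Proof.
apply/eqP/eqP=> [ox | xx].
  have ox2: #[x ^+ 2] = 2 by rewrite orderXdiv ox.
  by rewrite -fM -[x * x]/(x ^+ 2) (fpf_invol_uniq ox2) fpf_invol.
have x2: x ^+ 2 = z by apply: fpf_invol_eq; rewrite fM.
have: #[x] %| 2 ^ 2 by rewrite order_dvdn (expgM x 2 2) x2 -oz expg_order.
case/(dvdn_pfactor _ _ (isT : prime 2)) => -[|[|[|k]]] // _ ox.
  by move/eqP: ox; rewrite order_eq1 => /eqP x1; move: oz; rewrite -x2 x1 expg1n order1.
suff /eqP x21: x ^+ 2 == 1 by move: oz; rewrite -x2 x21 order1.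
by rewrite -order_dvdn ox.
Qed.

Lemma fpf_order4V x : #[x] = 4 -> (f x^-1 = - f x)%R.
Proof.
move/eqP; rewrite fpf_order4 => /eqP xx.
by apply: (mulrI (fpf_unit x)); rewrite fpfVr mulrN xx opprK.
Qed.

Lemma fpf_order4_comm x y : #[x] = 4 -> #[y] = 4 -> commute x y -> y = x \/ y = x^-1.
Proof.
move=> ox oy cxy; have fc: (f y * f x = f x * f y)%R by rewrite -!fM cxy.
have /eqP/[!fpf_order4]/eqP xx := ox; have /eqP/[!fpf_order4]/eqP yy := oy.
by apply: fpf_eq_or; rewrite (fpf_order4V ox); ncr (xx,(yy,(fc,I))).
Qed.

End Even.

Lemma fpf_order3_comm x y : #[x] = 3 -> #[y] = 3 -> commute x y -> y = x \/ y = x^-1.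
Proof.
move=> ox oy cxy; have fc: (f y * f x = f x * f y)%R by rewrite -!fM cxy.
have xx := fpf_order3 ox; have yy := fpf_order3 oy.
by apply: fpf_eq_or; rewrite (fpf_order3V ox); ncr (xx,(yy,(fc,I))).
Qed.

(** In a quaternion algebra whose conjugation extends inversion, [f d + f d^-1] is the reduced trace
    [t], and [f d] is a root of [X ^ 2 - t X + 1]. *)
Definition traces_central (D : {set gT}) :=
  {in D &, forall d e, GRing.comm (f d + f d^-1)%R (f e)}.

Section TC.
Variable z : gT.
Hypothesis oz : #[z] = 2.
Variable D : {group gT}.
Hypothesis tcD : traces_central D.

(** For [a] and [b] commuting with [g], the product [(a - a^-1) (g - g^-1)] is a difference of
    traces, so it commutes with [b]. So does the unit [g - g^-1], hence [a - a^-1], hence [2 a]. *)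
Lemma tc_cent_abelian g : g \in D -> g ^+ 2 != 1 -> abelian 'C_D[g].
Proof.
move=> Dg g2; apply/centsP=> a /setIP[Da cga] b /setIP[Db cgb].
have ug: (f g - f g^-1)%R \is a GRing.unit.
  by apply: fpf_subr_unit; rewrite eq_sym eq_invg_mul.
have cab: commute g a by apply/commute_sym/cent1P.
have cV: (f (a * g)^-1 = f a^-1 * f g^-1)%R by rewrite -cab invMg fM.
have cV': (f (a * g^-1)^-1 = f a^-1 * f g)%R.
  by rewrite invMg invgK -fM (commuteV cab).
have cb: ((f g - f g^-1) * f b = f b * (f g - f g^-1))%R.
  by rewrite mulrBl mulrBr -!fM (cent1P cgb) (commuteV (cent1P cgb)).
have ab: ((f a - f a^-1) * f b = f b * (f a - f a^-1))%R.
  apply: (mulIr ug); rewrite -[LHS]mulrA -cb mulrA -[RHS]mulrA.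
  have ->: ((f a - f a^-1) * (f g - f g^-1) = (f (a * g) + f (a * g)^-1) - (f (a * g^-1) + f (a * g^-1)^-1))%R.
    by rewrite cV cV' !fM; nc.
  by rewrite mulrBl mulrBr (tcD (groupM Da Dg) Db) (tcD (groupM Da (groupVr Dg)) Db).
apply: fpf_inj; apply/eqP; rewrite !fM -subr_eq0; apply/eqP/(fpf_mul2I oz).
have t := tcD Da Db; rewrite /GRing.comm in t.
transitivity (((f a - f a^-1) * f b - f b * (f a - f a^-1)) +
  ((f a + f a^-1) * f b - f b * (f a + f a^-1)))%R; first by nc.
by rewrite ab t !subrr addr0.
Qed.

(** [g ^ n] commutes with [g] and has the same trace, so it satisfies the quadratic equation with
    roots [g] and [g^-1]. *)
Lemma tc_norm_cent g n : g \in D -> n \in 'N_D('C_D[g]) -> g ^ n = g \/ g ^ n = g^-1.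
Proof.
move=> Dg /setIP[Dn nn]; have Cg: g \in 'C_D[g] by rewrite inE Dg cent1id.
have /setIP[_ /cent1P cgn]: g ^ n \in 'C_D[g] by rewrite memJ_norm.
have fc: (f (g ^ n) * f g = f g * f (g ^ n))%R by rewrite -!fM cgn.
have tr: (f (g ^ n) + f (g ^ n)^-1 = f g + f g^-1)%R.
  apply: (mulrI (fpf_unit n)); rewrite -(tcD Dg Dn) mulrDr mulrDl -!fM.
  by rewrite -conjVg !conjgE !mulKVg.
have v := fpfVr (g ^ n); have v1 := fpfVr g.
have c1: (f (g ^ n) * f g^-1 = f g^-1 * f (g ^ n))%R by rewrite -!fM (commuteV cgn).
apply: fpf_eq_or; transitivity (f (g ^ n) * ((f (g ^ n) + f (g ^ n)^-1) - (f g + f g^-1)))%R.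
  by rewrite mulrBl !mulrBr !mulrDr fc v v1 c1; nc.
by rewrite tr subrr mulr0.
Qed.

End TC.
End Fpf.

(** * Groups with central traces *)

Section Dickson.

Variables (gT : finGroupType) (R : unitRingType) (f : gT -> R).
Hypothesis fpf : fpf_repr f.
Variable z : gT.
Hypothesis oz : #[z] = 2.
Variable D : {group gT}.
Hypotheses (Dz : z \in D) (tcD : traces_central f D).

Let zz : z ^+ 2 = 1. Proof. by rewrite -oz expg_order. Qed.

Lemma mem_cycle_invol g : (g \in <[z]>) = (g ^+ 2 == 1).
Proof.
apply/idP/eqP=> [|/(fpf_sqr1 fpf oz)[] ->]; rewrite ?group1 ?cycle_id //.
by case/cycleP=> i ->; rewrite expgAC zz expg1n.
Qed.

Lemma tc_cent_eq g a : g \in D -> g ^+ 2 != 1 -> a \in 'C_D[g] -> a ^+ 2 != 1 ->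
  'C_D[a] = 'C_D[g].
Proof.
move=> Dg g2 /[dup] Ca /setIP[Da cga] a2; apply/eqP; rewrite eqEsubset.
have abg := tc_cent_abelian fpf oz tcD Dg g2.
have aba := tc_cent_abelian fpf oz tcD Da a2.
rewrite !subsetI !subsetIl /= !sub_cent1 (subsetP aba) ?(subsetP abg) //.
by rewrite inE Dg cent1C.
Qed.

(* By [tc_cent_eq] the sets [U g] partition the noncentral elements of [D], and the relative
   sizes of the possible blocks leave few solutions to the resulting class equation. *)
Let U g := class_support ('C_D[g] :\: <[z]>) D.

Let mem_U g y : g \in D -> g ^+ 2 != 1 -> reflect
  [/\ y \in D, y ^+ 2 != 1 & exists2 d, d \in D & 'C_D[y] = 'C_D[g] :^ d] (y \in U g).
Proof.
move=> Dg g2; apply: (iffP idP) => [|[Dy y2 [d Dd Cy]]].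
  case/imset2P=> a d /setDP[Ca]; rewrite mem_cycle_invol => a2 Dd ->.
  have /setIP[Da _] := Ca; rewrite groupJ // -conjXg conjg_eq1 a2; split=> //.
  by exists d => //; rewrite -(tc_cent_eq Dg g2 Ca a2) cent1J conjIg conjGid.
apply/imset2P; exists (y ^ d^-1) d => //; last by rewrite conjgKV.
rewrite inE mem_cycle_invol -conjXg conjg_eq1 y2 /= -mem_conjg -Cy.
by rewrite inE Dy cent1id.
Qed.

Lemma tc_normedTI g : g \in D -> g ^+ 2 != 1 ->
  normedTI ('C_D[g] :\: <[z]>) D 'N_D('C_D[g]).
Proof.
move=> Dg g2; apply/normedTI_memJ_P; rewrite subsetIl; split=> //.
  by apply/set0Pn; exists g; rewrite inE mem_cycle_invol g2 inE Dg cent1id.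
move=> a x /setDP[Ca]; rewrite !mem_cycle_invol => a2 Dx.
have /setIP[Da _] := Ca.
have ->: (x \in 'N_D('C_D[g])) = (x \in 'N('C_D[g])) by rewrite inE Dx.
rewrite in_setD mem_cycle_invol -conjXg conjg_eq1 a2 /=.
apply/idP/idP=> [cga | nx]; last by rewrite memJ_norm.
have := @tc_cent_eq g (a ^ x) Dg g2 cga; rewrite -conjXg conjg_eq1 => /(_ a2) eqC.
by apply/normP; rewrite -[in LHS](tc_cent_eq Dg g2 Ca a2) conjIg -cent1J conjGid.
Qed.

(** [e] is the number of conjugates of [g] under the normaliser of its centraliser, all among [g]
    and [g^-1]. The size of [U g] is read off from [tc_normedTI]. *)
Lemma tc_class_card g : g \in D -> g ^+ 2 != 1 -> exists al e m : nat,
  [/\ 2 <= al, e = 1%N \/ e = 2, #|'C_D[g]| = (2 * al)%N, #|D| = (2 * al * e * m)%N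
    & #|U g| = (2 * al.-1 * m)%N].
Proof.
move=> Dg g2; pose A := ('C_D[g])%G; pose N := ('N_D(A))%G.
have Az: z \in A by rewrite inE Dz; apply/cent1P/(fpf_invol_comm fpf oz).
have sZA: <[z]> \subset A by rewrite cycle_subG.
have [al oA] : exists al, #|A| = (2 * al)%N.
  by have := cardSg sZA; rewrite -orderE oz => /dvdnP[al ->]; exists al; rewrite mulnC.
have Ag: g \in A by rewrite inE Dg cent1id.
have al_gt1: 1 < al.
  have: 2 < #|A| by rewrite -oz orderE proper_card // properE sZA; apply/subsetPn; exists g; rewrite ?mem_cycle_invol.
  by rewrite oA; lia.
have sAN: A \subset N by rewrite subsetI subsetIl normG.
have eN: #|N : A| = 1%N \/ #|N : A| = 2.
  have defA: A :=: 'C_N[g].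
    apply/eqP; rewrite eqEsubset; apply/andP; split; last by rewrite setSI ?subsetIl.
    by apply/subsetP=> a Aa; rewrite inE (subsetP sAN a Aa); case/setIP: Aa.
  have: #|N : A| <= 2.
    rewrite defA index_cent1; apply: leq_trans (_ : #|[set g; g^-1]| <= 2).
      apply/subset_leq_card/subsetP=> _ /imsetP[n Nn ->]; rewrite !inE.
      by case: (tc_norm_cent fpf tcD Dg Nn) => ->; rewrite eqxx ?orbT.
    by rewrite cards2; case: (_ != _).
  by have := indexg_gt0 N A; lia.
exists al, #|N : A|, #|D : N|; split=> //.
  by rewrite -oA Lagrange // Lagrange ?subsetIl.
rewrite (card_support_normedTI (tc_normedTI Dg g2)) cardsD (setIidPr sZA) -orderE oz oA.
by congr (_ * _)%N; lia.
Qed.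

Lemma tc_class_disjoint g h : g \in D -> g ^+ 2 != 1 -> h \in D -> h ^+ 2 != 1 ->
  h \notin U g -> [disjoint U g & U h].
Proof.
move=> Dg g2 Dh h2 Ugh; apply/pred0P=> y; apply: contraNF Ugh => /andP[].
case/(mem_U _ Dg g2)=> Dy y2 [d Dd Cy] /(mem_U _ Dh h2)[_ _ [e De Cy']].
apply/(mem_U _ Dg g2); split=> //; exists (d * e^-1); first by rewrite groupM ?groupV.
by rewrite conjsgM -Cy Cy' conjsgK.
Qed.

Hypothesis nabD : ~~ abelian D.
Variable A0 : {set gT}.
Hypotheses (genD : D :=: <<z |: A0>>) (oddA : {in A0, forall x, odd #[x]}).

(** Elements of odd order vanish in a quotient of order 2, and together with [z] they generate
    [D]. *)
Lemma tc_index2 (M : {group gT}) : M \subset D -> z \in M -> #|D : M| != 2.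
Proof.
move=> sMD Mz; apply/eqP=> iM; have /andP[_ nMD] := index2_normal sMD iM.
suff sDM: D \subset M by move: iM; rewrite (eqP (_ : M == D :> {set gT})) ?indexgg // eqEsubset sMD.
rewrite genD gen_subG subUset sub1set Mz; apply/subsetP=> x Ax.
have Dx: x \in D by rewrite genD mem_gen // inE Ax orbT.
have Nx := subsetP nMD x Dx; apply/idP; rewrite coset_idr //; apply/eqP.
rewrite -order_eq1 -dvdn1 -(eqP (_ : coprime 2 #[x])) ?coprime2n ?oddA //.
rewrite dvdn_gcd -{1}iM -card_quotient // order_dvdG ?mem_quotient //=.
exact: morph_order.
Qed.

Lemma tc_class_data g : g \in D -> g ^+ 2 != 1 -> exists al e m,
  class_data #|D| al e m #|U g| /\ #|'C_D[g]| = (2 * al)%N.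
Proof.
move=> Dg g2; have [al [e [m [al2 eE oC oD oU]]]] := tc_class_card Dg g2.
exists al, e, m; split=> //; split=> //.
have iC: #|D : 'C_D[g]| = (e * m)%N by rewrite -divgS ?subsetIl // oD oC -mulnA mulKn //; lia.
have ne1: #|D : 'C_D[g]| != 1%N.
  rewrite indexg_eq1; apply: contra nabD => sDC.
  exact: abelianS sDC (tc_cent_abelian fpf oz tcD Dg g2).
have ne2: #|D : 'C_D[g]| != 2.
  apply: tc_index2; first exact: subsetIl.
  by rewrite inE Dz; apply/cent1P/(fpf_invol_comm fpf oz).
by have := indexg_gt0 D 'C_D[g]; lia.
Qed.

(** The transfer into the centraliser of [h] sends [g] to [z]. But it kills [z], and the other
    generators of [D] have odd order, so its image has odd order. *)
Lemma tc_not_48 g h : g \in D -> g ^+ 2 != 1 -> h \in D -> h ^+ 2 != 1 ->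
  #|'C_D[g]| = 4 -> #|'C_D[h]| = 8 -> #|D| = 48 -> False.
Proof.
move=> Dg g2 Dh h2 oCg oCh oD; pose A := ('C_D[h])%G.
have abA: abelian A := tc_cent_abelian fpf oz tcD Dh h2.
have Az: z \in A by rewrite inE Dz; apply/cent1P/(fpf_invol_comm fpf oz).
have g2z: g ^+ 2 = z.
  have: #[g] %| 4 by rewrite -oCg order_dvdG // inE Dg cent1id.
  rewrite order_dvdn (expgM g 2 2) => /eqP/(fpf_sqr1 fpf oz)[] // g21.
  by rewrite g21 eqxx in g2.
have ZDz: z \in 'Z(D).
  by rewrite inE Dz; apply/centP=> x _; apply: (fpf_invol_comm fpf oz).
have nA: {in D, forall x, g ^ x \notin A}.
  move=> x Dx; apply/negP=> Agx.
  have gx2: (g ^ x) ^+ 2 != 1 by rewrite -conjXg conjg_eq1.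
  have := tc_cent_eq Dh h2 Agx gx2; rewrite cent1J -{1}(conjGid Dx) -conjIg.
  by move/(congr1 (fun B : {set gT} => #|B|)); rewrite cardJg oCg oCh.
have iA: #|D : A| = (2 * 3)%N by rewrite -divgS ?subsetIl // oD oCh.
have [V [sVA Vg Vz]] := transfer_involution (subsetIl _ _) abA Az ZDz oz Dg g2z nA iA isT.
have sVO: V @* D \subset 'O_2^'(A).
  have sGD: z |: A0 \subset D by rewrite genD subset_gen.
  have ->: V @* D = <<V @* (z |: A0)>> by rewrite -morphim_gen // -genD.
  rewrite gen_subG.
  apply/subsetP=> _ /morphimP[x Dx /setU1P[-> -> | A0x ->]]; rewrite ?Vz ?group1 //.
  rewrite (mem_normal_Hall (nilpotent_pcore_Hall _ (abelian_nil abA)) (pcore_normal _ _)).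
    have := oddA A0x; rewrite odd_2'nat => /(pnat_dvd _) odd_x.
    by apply: odd_x; apply: morph_order.
  by rewrite (subsetP sVA) ?mem_morphim.
have: z \in 'O_2^'(A) by rewrite -Vg (subsetP sVO) ?mem_morphim.
by move/(mem_p_elt (pcore_pgroup _ _)); rewrite /p_elt oz.
Qed.

Lemma tc_card :
  #|D| = 24 /\ {in D, forall g, g ^+ 2 != 1 -> #|'C_D[g]| \in [:: 4; 6]} \/
  #|D| = 120 /\ {in D, forall g, g ^+ 2 != 1 -> #|'C_D[g]| \in [:: 4; 6; 10]}.
Proof.
(* Blocks [U g] are peeled off [W] until it is exhausted, which happens after two or three of
   them. *)
pose W := D :\: <[z]>.
have WP y: reflect (y \in D /\ y ^+ 2 != 1) (y \in W).
  by rewrite inE mem_cycle_invol andbC; apply: andP.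
have oW: #|W| + 2 = #|D|.
  by rewrite -[2]oz orderE -(cardsID <[z]> D) addnC (setIidPr _) // cycle_subG.
have sUW g: g \in W -> U g \subset W.
  by case/WP=> Dg g2; apply/subsetP=> y /(mem_U _ Dg g2)[Dy y2 _]; apply/WP.
have disU g h: g \in W -> h \in W -> h \notin U g -> [disjoint U g & U h].
  by move=> /WP[Dg g2] /WP[Dh h2]; apply: tc_class_disjoint.
have cardU2 (A B : {set gT}) : [disjoint A & B] -> #|A :|: B| = #|A| + #|B|.
  by move=> dis; rewrite cardsU disjoint_setI0 // cards0 subn0.
have oCU g h: g \in W -> h \in U g -> #|'C_D[h]| = #|'C_D[g]|.
  by case/WP=> Dg g2 /(mem_U _ Dg g2)[_ _ [d _ ->]]; rewrite cardJg.
have dataW g: g \in W -> exists al e m,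
  class_data #|D| al e m #|U g| /\ #|'C_D[g]| = (2 * al)%N.
  by case/WP=> Dg g2; apply: tc_class_data.
have [g1 W1]: exists g, g \in W.
  apply/set0Pn; apply: contra nabD; rewrite setD_eq0 => sDZ.
  exact: abelianS sDZ (cycle_abelian z).
have [al1 [e1 [m1 [cd1 oC1]]]] := dataW g1 W1; have sU1 := sUW _ W1.
have [sWU|/subsetPn[g2 W2 U1'g2]] := boolP (W \subset U g1).
  have eqW: W = U g1 by apply/eqP; rewrite eqEsubset sWU.
  by case: (class_data1 cd1); rewrite -eqW.
have [al2 [e2 [m2 [cd2 oC2]]]] := dataW g2 W2; have sU2 := sUW _ W2.
have dis12 := disU _ _ W1 W2 U1'g2; have sU12: U g1 :|: U g2 \subset W by rewrite subUset sU1.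
have [sWU|/subsetPn[g3 W3]] := boolP (W \subset U g1 :|: U g2).
  have eqW: W = U g1 :|: U g2 by apply/eqP; rewrite eqEsubset sWU.
  have eq_n: #|U g1| + #|U g2| + 2 = #|D| by rewrite -cardU2 // -eqW.
  have [-> [al1E al2E]] := class_data2 cd1 cd2 eq_n.
  left; split=> // g Dg g_2; have: g \in W by apply/WP.
  rewrite eqW => /setUP[] /oCU-> //; rewrite ?oC1 ?oC2.
    by case: al1E => ->.
  by case: al2E => ->.
rewrite in_setU => /norP[U1'g3 U2'g3].
have [al3 [e3 [m3 [cd3 oC3]]]] := dataW g3 W3; have sU3 := sUW _ W3.
have dis13 := disU _ _ W1 W3 U1'g3; have dis23 := disU _ _ W2 W3 U2'g3.
have dis3: [disjoint U g1 :|: U g2 & U g3].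
  by rewrite -setI_eq0 setIUl !disjoint_setI0 // setU0.
have oU3: #|U g1 :|: U g2 :|: U g3| = #|U g1| + #|U g2| + #|U g3| by rewrite !cardU2.
have sU123: U g1 :|: U g2 :|: U g3 \subset W by rewrite subUset sU12.
have [sWU|/subsetPn[g4 W4]] := boolP (W \subset U g1 :|: U g2 :|: U g3).
  have eqW: W = U g1 :|: U g2 :|: U g3 by apply/eqP; rewrite eqEsubset sWU.
  have inU g: g \in D -> g ^+ 2 != 1 -> exists2 al, al \in [:: al1; al2; al3] & #|'C_D[g]| = (2 * al)%N.
    move=> Dg g_2; have: g \in W by apply/WP.
    rewrite eqW => /setUP[/setUP[]|] /oCU-> //.
    - by exists al1; rewrite // inE eqxx.
    - by exists al2; rewrite // !inE eqxx orbT.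
    by exists al3; rewrite // !inE eqxx !orbT.
  have inA al: al \in [:: al1; al2; al3] -> exists2 g, g \in W & #|'C_D[g]| = (2 * al)%N.
    by rewrite !inE => /or3P[] /eqP->; [exists g1 | exists g2 | exists g3].
  have eq_n: #|U g1| + #|U g2| + #|U g3| + 2 = #|D| by rewrite -oU3 -eqW.
  have [[oD /allP al_s] | [oD /andP[/inA[g /WP[Dg g_2] oCg] /inA[h /WP[Dh h_2] oCh]]] | [oD /allP al_s]] := class_data3 cd1 cd2 cd3 eq_n.
  - left; split=> // g Dg g_2; have [al /al_s/=] := inU g Dg g_2.
    by rewrite !inE => /orP[] /eqP-> ->.
  - by case: (tc_not_48 Dg g_2 Dh h_2 oCg oCh oD).
  right; split=> // g Dg g_2; have [al /al_s/=] := inU g Dg g_2.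
  by rewrite !inE => /or3P[] /eqP-> ->.
rewrite !in_setU => /norP[/norP[U1'g4 U2'g4] U3'g4].
have [al4 [e4 [m4 [cd4 oC4]]]] := dataW g4 W4; have sU4 := sUW _ W4.
have dis14 := disU _ _ W1 W4 U1'g4; have dis24 := disU _ _ W2 W4 U2'g4.
have dis34 := disU _ _ W3 W4 U3'g4.
have dis4: [disjoint U g1 :|: U g2 :|: U g3 & U g4].
  by rewrite -setI_eq0 !setIUl !disjoint_setI0 // !setU0.
case: (class_data4 cd1 cd2 cd3 cd4).
rewrite -oU3 -cardU2 // -oW leq_add2r subset_leq_card // subUset sU123.
exact: sU4.
Qed.

End Dickson.

(** * Pairs of elements of order 3 *)

Lemma gen_ind_r (gT : finGroupType) (A : {set gT}) (P : gT -> Prop) :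
  P 1 -> (forall d a, P d -> a \in A -> P (d * a)) -> {in <<A>>, forall x, P x}.
Proof.
move=> P1 PM x /gen_prodgP[n [c Ac ->]]; elim: n c Ac => [|n IHn] c Ac.
  by rewrite big_ord0.
by rewrite big_ord_recr /=; apply: PM => //; apply: IHn.
Qed.

Section Pair.

Variables (gT : finGroupType) (R : unitRingType) (f : gT -> R).
Hypothesis fpf : fpf_repr f.
Variable z : gT.
Hypothesis oz : #[z] = 2.

Let f1 : f 1 = 1%R. Proof. by case: fpf. Qed.
Let fM : {morph f : x y / x * y >-> (x * y)%R}. Proof. by case: fpf. Qed.

Lemma comm_gen (A : {set gT}) a : {in A, forall x, GRing.comm a (f x)} ->
  {in <<A>>, forall x, GRing.comm a (f x)}.
Proof.
move=> cA; apply: gen_ind_r => [|d x cd /cA cx]; first by rewrite f1; apply: commr1.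
by rewrite fM; apply: commrM.
Qed.

(** The span of [1, X, Y, X Y] over the elements commuting with [X] and [Y] is stable under right
    multiplication by the generators, and inversion acts on it as the anti-involution with
    [X |-> - 1 - X], [Y |-> - 1 - Y]. The trace is [2 c0 - c1 - c2 + c3 t]. *)
Lemma tc_pair x y : #[x] = 3 -> #[y] = 3 -> traces_central f <<z |: [set x; y]>>.
Proof.
move=> ox oy; have xx := fpf_order3 fpf ox; have yy := fpf_order3 fpf oy.
have xV := fpf_order3V fpf ox; have yV := fpf_order3V fpf oy.
have fz := fpf_invol fpf oz; have fzV: (f z^-1 = -1)%R.
  by rewrite invg_expg oz expg1.
set X := f x in xx xV; set Y := f y in yy yV.
(* [t] lets [Y X] be rewritten as [t - X Y - X - Y - 1]. *)
pose t := (X * Y + Y * X + X + Y + 1)%R.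
have tX: (t * X = X * t)%R by rewrite /t; ncr (xx,(yy,I)).
have tY: (t * Y = Y * t)%R by rewrite /t; ncr (xx,(yy,I)).
pose C c := (X * c = c * X)%R /\ (Y * c = c * Y)%R.
pose P d := exists c : R * R * R * R, let: (c0, c1, c2, c3) := c in
  [/\ C c0, C c1, C c2, C c3 & (f d = c0 + c1 * X + c2 * Y + c3 * (X * Y))%R /\
   (f d^-1 = c0 - c1 * (1 + X) - c2 * (1 + Y) + c3 * ((1 + Y) * (1 + X)))%R].
have PD: {in <<z |: [set x; y]>>, forall d, P d}.
  apply: gen_ind_r => [|d a [[[[c0 c1] c2] c3] [[x0 y0] [x1 y1] [x2 y2] [x3 y3] [fd fdV]]]].
    exists (1, 0, 0, 0)%R; rewrite invg1 f1 /C; split; try by split; nc.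
  rewrite !inE => /or3P[] /eqP->.
  - exists (- c0, - c1, - c2, - c3)%R; rewrite /C; split.
    + by split; [ncr (x0,I) | ncr (y0,I)].
    + by split; [ncr (x1,I) | ncr (y1,I)].
    + by split; [ncr (x2,I) | ncr (y2,I)].
    + by split; [ncr (x3,I) | ncr (y3,I)].
    by rewrite invMg !fM fd fdV fz fzV; split; nc.
  - exists (c2 * (t - 1) - c1 + c3, c0 - c1 - c2 + c3 * t, c3 - c2, - c2)%R; rewrite /C /t; split.
    + by split; ncr (x1,(x2,(x3,(y1,(y2,(y3,(xx,(yy,I)))))))).
    + by split; ncr (x1,(x2,(x3,(y1,(y2,(y3,(xx,(yy,(x0,(y0,I)))))))))).
    + by split; ncr (x1,(x2,(x3,(y1,(y2,(y3,(xx,(yy,I)))))))).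
    + by split; ncr (x1,(x2,(x3,(y1,(y2,(y3,(xx,(yy,I)))))))).
    rewrite invMg !fM fd fdV xV -/X.
    by split; ncr (x1,(x2,(x3,(y1,(y2,(y3,(xx,(yy,(x0,(y0,I)))))))))).
  exists (- c2, - c3, c0 - c2, c1 - c3)%R; rewrite /C; split.
  + by split; ncr (x1,(x2,(x3,(y1,(y2,(y3,(xx,(yy,I)))))))).
  + by split; ncr (x1,(x2,(x3,(y1,(y2,(y3,(xx,(yy,(x0,(y0,I)))))))))).
  + by split; ncr (x1,(x2,(x3,(y1,(y2,(y3,(xx,(yy,(x0,(y0,I)))))))))).
  + by split; ncr (x1,(x2,(x3,(y1,(y2,(y3,(xx,(yy,I)))))))).
  rewrite invMg !fM fd fdV yV -/Y.
  by split; ncr (x1,(x2,(x3,(y1,(y2,(y3,(xx,(yy,(x0,(y0,I)))))))))).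
move=> d e /PD[[[[c0 c1] c2] c3] [[x0 y0] [x1 y1] [x2 y2] [x3 y3] [fd fdV]]] De.
apply: comm_gen De => a; rewrite !inE fd fdV /GRing.comm => /or3P[] /eqP->.
- by rewrite fz; nc.
- by rewrite -/X; ncr (x1,(x2,(x3,(y1,(y2,(y3,(xx,(yy,(x0,(y0,I)))))))))).
by rewrite -/Y; ncr (x1,(x2,(x3,(y1,(y2,(y3,(xx,(yy,(x0,(y0,I)))))))))).
Qed.

Lemma trace4 w : w ^+ 4 = 1 -> w ^+ 2 != 1 -> (f w + f w^-1 = 0)%R.
Proof.
rewrite (expgM w 2 2) => /(fpf_sqr1 fpf oz)[-> /eqP // | w2 _].
have ww: (f w * f w = -1)%R by rewrite -fM -[_ * _]/(w ^+ 2) w2 (fpf_invol fpf oz).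
by rewrite (fpf_order4V fpf oz) ?subrr //; apply/eqP; rewrite (fpf_order4 fpf oz) ww.
Qed.

Lemma traceMz w : (f (w * z) + f (w * z)^-1 = - (f w + f w^-1))%R.
Proof.
rewrite invMg !fM [z^-1]invg_expg oz expg1 (fpf_invol fpf oz); set b := f w^-1; nc.
Qed.

Lemma trace3 w : w ^+ 3 = 1 -> w != 1 -> (f w + f w^-1 = -1)%R.
Proof.
move=> w3 w1; have ow: #[w] = 3 by apply: nt_prime_order.
by rewrite (fpf_order3V fpf ow); nc.
Qed.

Lemma fpf_unit5 (w : gT) : #[w] = 5 -> (5%:R : R)%R \is a GRing.unit.
Proof.
case: fpf => _ _ fU ow; have w1: w != 1 by rewrite -order_eq1 ow.
have wn1 n: n \in [:: 1; 2; 3; 4]%N -> w ^+ n != 1.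
  by move=> n4; rewrite -order_dvdn ow; move: n4; rewrite !inE => /or4P[] /eqP->.
have ww: (f w * (f w * (f w * (f w * f w))) = 1)%R.
  by rewrite -!fM -[_ * (_ * _)]/(w ^+ 5) -ow expg_order.
have s0: (f w * (f w * (f w * f w)) = - 1 - f w - f w * f w - f w * (f w * f w))%R.
  by apply: (mulrI (fU w w1)); ncr (ww,I).
have ->: (5%:R = (f (w ^+ 1) - 1) * (f (w ^+ 2) - 1) * (f (w ^+ 3) - 1) * (f (w ^+ 4) - 1) :> R)%R.
  by rewrite !(fpfX fpf); ncr (s0,I).
by rewrite !unitrMl ?fU ?wn1.
Qed.

Lemma trace5 w (t := (f w + f w^-1)%R) : w ^+ 5 = 1 -> w != 1 -> (t * t = 1 - t)%R.
Proof.
case: fpf => _ _ fU w5 /fU uw; rewrite /t; have wV: w^-1 = w ^+ 4.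
  by apply/eqP; rewrite eq_invg_mul -expgS w5.
have ww: (f w * (f w * (f w * (f w * f w))) = 1)%R.
  by rewrite -!fM -[_ * (_ * _)]/(w ^+ 5) w5.
rewrite wV (fpfX fpf).
have s0: (1 + f w + f w ^+ 2 + f w ^+ 3 + f w ^+ 4 = 0)%R.
  by apply: (mulrI uw); rewrite mulr0; ncr (ww,I).
apply/eqP; rewrite -subr_eq0 -s0; apply/eqP; ncr (ww,I).
Qed.

Lemma trace_eq2 w : (f w + f w^-1 = 2)%R -> w = 1.
Proof.
move=> t2; have w0: ((f w - f 1) * (f w - f 1) = 0)%R.
  have v := fpfVr fpf w; rewrite f1.
  transitivity (f w * (f w + f w^-1 - 2))%R; last by rewrite t2 subrr mulr0.
  by set w' := f w^-1 in v *; ncr (v,I).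
by case: (fpf_eq_or fpf w0).
Qed.

(** Multiplying by [z] changes the sign of the trace, which reduces the orders 6 and 10 to 3 and
    5. *)
Lemma trace_cases w (t := (f w + f w^-1)%R) :
    (w ^+ 4 == 1) || (w ^+ 6 == 1) || (w ^+ 10 == 1) -> w ^+ 2 != 1 ->
  (t = 0 \/ t = 1 \/ t = -1 \/ t * t = 1 - t \/ (t * t = 1 + t /\ 5%:R \is a @GRing.unit R))%R.
Proof.
have zz: z ^+ 2 = 1 by rewrite -oz expg_order.
have trz v: v ^+ 2 != 1 -> commute v z -> (v * z) ^+ 2 != 1.
  by move=> v2 cvz; rewrite expgMn // zz mulg1.
have cz v: commute v z by apply/commute_sym/(fpf_invol_comm fpf oz).
move=> wE w2; have w1: w != 1 by apply: contraNneq w2 => ->; rewrite expg1n.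
have wz1: w * z != 1 by apply: contraNneq (trz w w2 (cz w)) => ->; rewrite expg1n.
case/orP: wE => [/orP[] /eqP wE | /eqP wE]; first by left; apply: trace4.
  have: (w ^+ 3) ^+ 2 = 1 by rewrite -expgM.
  case/(fpf_sqr1 fpf oz)=> w3; first by do 2!right; left; apply: trace3.
  right; left; rewrite /t -[LHS]opprK -traceMz trace3 ?opprK //.
  by rewrite expgMn // w3 -expgS (expgD z 2 2) zz mulg1.
have: (w ^+ 5) ^+ 2 = 1 by rewrite -expgM.
case/(fpf_sqr1 fpf oz)=> w5; do 3!right; first by left; apply: trace5.
have wz5: (w * z) ^+ 5 = 1 by rewrite expgMn // w5 -expgS (expgM z 2 3) zz expg1n.
have t5: (- t * - t = 1 - - t)%R.
  by rewrite /t -traceMz; apply: trace5.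
right; rewrite mulrNN opprK in t5; split=> //; apply: (@fpf_unit5 (w * z)).
exact: nt_prime_order.
Qed.

(** For [a], [b] the images of elements of order 3, this is the anticommutator of two square roots
    of -3, that is -2 times the inner product of pure quaternions of norm 3. *)
Definition tri (a b : R) : R := ((2 * a + 1) * (2 * b + 1) + (2 * b + 1) * (2 * a + 1))%R.

(** If [t] is the trace of [x * y], then [tri = 4 t - 2] and [x * y^-1] has trace [1 - t]. Both
    traces are on the list of [trace_cases] and neither is 2, which leaves [t = 0], [t = 1] or
    [t ^ 2 = 1 + t]. *)
Lemma pair_order3 x y : #[x] = 3 -> #[y] = 3 -> ~ commute x y ->
  (tri (f x) (f y) = 2 \/ tri (f x) (f y) = -2 \/
    tri (f x) (f y) * tri (f x) (f y) = 20 /\ 5%:R \is a @GRing.unit R)%R.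
Proof.
move=> ox oy ncxy; pose D := <<z |: [set x; y]>>%G.
have tcD: traces_central f D := tc_pair ox oy.
have [Dz Dx Dy]: [/\ z \in D, x \in D & y \in D].
  by split; apply: mem_gen; rewrite !inE eqxx ?orbT.
have nabD: ~~ abelian D by apply/negP=> /centsP/(_ x Dx y Dy).
have odd_xy: {in [set x; y], forall a, odd #[a]}.
  by move=> a /set2P[]->; rewrite ?ox ?oy.
have exD w: w \in D -> w ^+ 2 != 1 -> (w ^+ 4 == 1) || (w ^+ 6 == 1) || (w ^+ 10 == 1).
  move=> Dw w2; have wdvd: #[w] %| #|'C_D[w]| by rewrite order_dvdG // inE Dw cent1id.
  have [[_ /(_ w Dw w2)]|[_ /(_ w Dw w2)]] := tc_card fpf oz Dz tcD nabD (erefl _) odd_xy;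
   rewrite !inE -!order_dvdn.
    by case/orP=> /eqP oC; rewrite oC in wdvd; rewrite wdvd ?orbT.
  by case/or3P=> /eqP oC; rewrite oC in wdvd; rewrite wdvd ?orbT.
have w2: (x * y) ^+ 2 != 1.
  apply: contra_notN ncxy => /eqP/(fpf_sqr1 fpf oz) xyE.
  have ->: y = x^-1 * (x * y) by rewrite mulKg.
  apply: commuteM; first exact: commuteV.
  by case: xyE => ->; [apply: commute1 | apply/commute_sym/(fpf_invol_comm fpf oz)].
have v2: (x * y^-1) ^+ 2 != 1.
  apply: contra_notN ncxy => /eqP/(fpf_sqr1 fpf oz) xyE.
  have ->: y = (x * y^-1)^-1 * x by rewrite invMg invgK mulgKV.
  apply: commuteM => //; apply: commuteV.
  by case: xyE => ->; [apply: commute1 | apply/commute_sym/(fpf_invol_comm fpf oz)].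
have xx := fpf_order3 fpf ox; have yy := fpf_order3 fpf oy.
have xV := fpf_order3V fpf ox; have yV := fpf_order3V fpf oy.
have := trace_cases (exD _ (groupM Dx Dy) w2) w2.
have := trace_cases (exD _ (groupM Dx (groupVr Dy)) v2) v2.
set t' := (_ + _)%R => t'E; set t := (_ + _)%R => tE.
have tt': (t' = 1 - t)%R by rewrite /t' /t !invMg invgK !fM xV yV; ncr (xx,(yy,I)).
have triE: (tri (f x) (f y) = 4 * t - 2)%R.
  by rewrite /tri /t !invMg !fM xV yV; ncr (xx,(yy,I)).
have t_2: t <> 2%R.
  by move/trace_eq2=> xy1; rewrite xy1 expg1n eqxx in w2.
have t'_2: t' <> 2%R.
  by move/trace_eq2=> xy1; rewrite xy1 expg1n eqxx in v2.
rewrite triE; case: tE => [t0 | [t1 | [tN | [tt | [tt u5]]]]].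
- by right; left; rewrite t0; nc.
- by left; rewrite t1; nc.
- by case: t'_2; rewrite tt' tN; nc.
- have n10 : (1 : R)%R != 0%R by apply: oner_neq0.
  case/eqP: n10; rewrite tt' in t'E; clear triE tt' t'_2.
  case: t'E => [e | [e | [e | [e | [e _]]]]].
  + have te: t = 1%R by rewrite -[t](subKr 1) e subr0.
    by move: tt; rewrite te subrr mulr1.
  + have te: t = 0%R by rewrite -[t](subKr 1) e subrr.
    by move: tt; rewrite te subr0 mulr0 => <-.
  + by case: t_2; rewrite -[t](subKr 1) e opprK.
  + have te: (2 * t = 1)%R.
      apply/eqP; rewrite -subr_eq0; apply/eqP/(fpf_mul2I fpf oz).
      transitivity ((1 - (1 - t)) - (1 - t) * (1 - t))%R; last by rewrite e subrr.
      by ncr (tt,I).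
    have e1: (2 * t * (2 * t) = 1)%R by rewrite te mulr1.
    apply: oppr_inj; rewrite oppr0.
    transitivity (2 * t * (2 * t) + 2 * (2 * t) - 4)%R; last by ncr (tt,I).
    by rewrite e1 te; nc.
  have te: t = 0%R.
    apply: (fpf_mul2I fpf oz).
    transitivity (1 + (1 - t) - (1 - t) * (1 - t))%R; last by rewrite e subrr.
    by ncr (tt,I).
  by move: tt; rewrite te subr0 mulr0 => <-.
by do 2!right; split=> //; ncr (tt,I).
Qed.

End Pair.

(** * The subgroup generated by the elements of order 3 *)

Section Order3.

Variables (gT : finGroupType) (R : unitRingType) (f : gT -> R).
Hypothesis fpf : fpf_repr f.
Variable z : gT.
Hypothesis oz : #[z] = 2.
Implicit Types h x y : gT.

Let f1 : f 1 = 1%R. Proof. by case: fpf. Qed.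
Let fM : {morph f : x y / x * y >-> (x * y)%R}. Proof. by case: fpf. Qed.
Let mul2I := fpf_mul2I fpf oz.

Let add2I (a b : R) : (a + a = b + b -> a = b)%R.
Proof.
move=> e; apply/eqP; rewrite -subr_eq0; apply/eqP/mul2I.
by transitivity (a + a - (b + b))%R; [nc | rewrite e subrr].
Qed.

Let n10 : (1 != 0 :> R)%R. Proof. exact: oner_neq0. Qed.

Lemma triVr x y : #[y] = 3 -> tri (f x) (f y^-1) = (- tri (f x) (f y))%R.
Proof. by move=> oy; rewrite /tri (fpf_order3V fpf oy); nc. Qed.

Lemma exists_tri_m2 x y : #[x] = 3 -> #[y] = 3 -> ~ commute x y ->
  exists u v, [/\ #[u] = 3, #[v] = 3 & tri (f u) (f v) = (-2)%R].
Proof.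
move=> ox oy ncxy.
case: (pair_order3 fpf oz ox oy ncxy) => [t2 | [t2 | [t20 _]]].
- by exists x, y^-1; rewrite orderV triVr ?t2.
- by exists x, y.
(* Conjugation by [x] turns the pure part of [y] by 120 degrees about that of [x], so the new value
   is [3 - tri ^ 2 / 4 = 3 - 5]. *)
exists y, (y ^ x^-1); rewrite orderJ; split=> //.
have xx := fpf_order3 fpf ox; have yy := fpf_order3 fpf oy.
have [t [yx xt yt]]: exists t, [/\ f y * f x = t - f x * f y - f x - f y - 1, f x * t = t * f x & f y * t = t * f y]%R.
  exists (f x * f y + f y * f x + f x + f y + 1)%R.
  by split; [nc | ncr (xx,(yy,I)) | ncr (xx,(yy,I))].
apply/eqP; rewrite -subr_eq0; apply/eqP; do 2!apply: mul2I.
transitivity (20 - tri (f x) (f y) * tri (f x) (f y))%R; last by rewrite t20 subrr.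
rewrite conjgE invgK !fM (fpf_order3V fpf ox) /tri.
by ncr (xx,(yy,(yx,(xt,(yt,I))))).
Qed.

(** Generators of a binary tetrahedral group: conjugation by [gx] permutes [i], [j], [k]
    cyclically. *)
Definition quat_triple (gi gj gx : gT) :=
  [/\ quat (f gi) (f gj), #[gx] = 3 & (2 * f gx + 1 = f gi + f gj + f gi * f gj)%R].

Lemma exists_quat_triple x y : #[x] = 3 -> #[y] = 3 -> ~ commute x y ->
  exists gi gj gx, quat_triple gi gj gx.
Proof.
move=> ox oy /(exists_tri_m2 ox oy)[{ox oy}u [v [ou ov tuv]]].
have uu := fpf_order3 fpf ou; have vv := fpf_order3 fpf ov.
have uV := fpf_order3V fpf ou; have vV := fpf_order3V fpf ov.
have vu: (f v * f u = - (f u * f v) - f u - f v - 1)%R.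
  apply/eqP; rewrite -subr_eq0; apply/eqP; do 2!apply: mul2I.
  by transitivity (tri (f u) (f v) + 2)%R; [rewrite /tri; nc | rewrite tuv addNr].
(* The value -2 of [tri] means that [u * v] has trace 0, so its image squares to -1; conjugation by
   [u] supplies [j]. *)
exists (u * v)^-1, ((u * v)^-1 ^ u), u.
split=> //; rewrite ?conjgE ?invMg !fM uV vV; first split; by ncr (uu,(vv,(vu,I))).
Qed.

(** * Elements of order 3 seen from a binary tetrahedral subgroup *)

Section Triple.

Variables gi gj gx : gT.
Hypothesis trip : quat_triple gi gj gx.
Let i := f gi.
Let j := f gj.
Let k := (i * j)%R.
Let S := <<[set gi; gj; gx]>>.

Let Qij : quat i j. Proof. by case: trip. Qed.
Let ox : #[gx] = 3. Proof. by case: trip. Qed.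
Let xE : (2 * f gx = i + j + k - 1)%R.
Proof. by case: trip => _ _ <-; nc. Qed.
Let xVE : (2 * f gx^-1 = - 1 - i - j - k)%R.
Proof.
rewrite (fpf_order3V fpf ox); transitivity (- 2 - 2 * f gx)%R; first by nc.
by rewrite xE; nc.
Qed.

Let Si : gi \in S. Proof. by rewrite mem_gen // !inE eqxx. Qed.
Let Sj : gj \in S. Proof. by rewrite mem_gen // !inE eqxx orbT. Qed.
Let Sx : gx \in S. Proof. by rewrite mem_gen // !inE eqxx !orbT. Qed.

Let order4 u : (f u * f u = -1)%R -> #[u] = 4.
Proof. by move=> uu; apply/eqP; rewrite (fpf_order4 fpf oz) uu. Qed.

Let fV4 u : (f u * f u = -1)%R -> (f u^-1 = - f u)%R.
Proof. by move=> uu; exact (fpf_order4V fpf oz (order4 uu)). Qed.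

Let unit3 : (3%:R : R)%R \is a GRing.unit. Proof. exact: (fpf_unit3 fpf ox). Qed.

Let fJ4 u h : (f u * f u = -1)%R -> (2 * f (h ^ u) + 1 = - (f u * (2 * f h + 1) * f u))%R.
Proof. by move=> uu; rewrite conjgE !fM (fV4 uu); ncr (uu,I). Qed.

Lemma fJx (r : R) : (4 * (f gx^-1 * r * f gx) = (- 1 - i - j - k) * r * (i + j + k - 1))%R.
Proof. by rewrite -xE -xVE; nc. Qed.

(** With [h' = h ^ gv], the trace condition makes [h * h'^-1] an element of order 4. It commutes
    with [gu], so it is [gu] or its inverse and commutes with [h]. Then [h'] commutes with [h], and
    [h * h'^-1] cannot have order 4. *)
Lemma no_four_golden gu gv h (H := (2 * f h + 1)%R) : quat (f gu) (f gv) -> #[h] = 3 ->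
  (f gu * H = H * f gu)%R -> (H * (- (f gv * H * f gv)) + - (f gv * H * f gv) * H = 2)%R -> False.
Proof.
case=> uu vv vu oh uH tH; have cuh: commute gu h.
  apply: (fpf_inj fpf); apply/eqP; rewrite !fM -subr_eq0; apply/eqP; apply: mul2I.
  by transitivity (f gu * H - H * f gu)%R; [rewrite /H; nc | rewrite uH subrr].
pose h' := h ^ gv; have oh' : #[h'] = 3 by rewrite orderJ.
have t2 : tri (f h) (f h'^-1) = (-2)%R.
  by rewrite triVr // /tri fJ4 // -[(2 * f h + 1)%R]/H tH.
pose g := h * h'^-1; have g4: (f g * f g = -1)%R.
  have hh := fpf_order3 fpf oh; have hh' := fpf_order3 fpf oh'.
  have hhr: (f h' * f h = - (f h * f h') - f h - f h')%R.
    apply/eqP; rewrite -subr_eq0; apply/eqP; do 2!apply: mul2I.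
    transitivity (- 2 - tri (f h) (f h'^-1))%R; last by rewrite t2 subrr.
    by rewrite /tri (fpf_order3V fpf oh'); nc.
  by rewrite /g fM (fpf_order3V fpf oh'); ncr (hh,(hh',(hhr,I))).
have cuh' : commute gu h'.
  have hu: (f h * f gu = f gu * f h)%R by rewrite -!fM cuh.
  by apply: (fpf_inj fpf); rewrite /h' conjgE !fM (fV4 vv); ncr (uu,(vv,(vu,(hu,I)))).
have cug : commute gu g by apply: commuteM => //; apply: commuteV.
have [ou og] := (order4 uu, order4 g4).
have cgh : commute g h.
  case: (fpf_order4_comm fpf oz ou og cug) => -> //.
  exact/commute_sym/commuteV/commute_sym.
have chh' : commute h h'.
  have -> : h' = g^-1 * h by rewrite /g invMg invgK mulgKV.
  by apply: commuteM => //; apply/commuteV/commute_sym.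
case: (fpf_order3_comm fpf oh oh' chh') => h'E; move: og; rewrite /g h'E ?mulgV ?order1 // invgK.
by rewrite -[h * h]/(h ^+ 2) orderXgcd oh.
Qed.

(** One normal form for each [T]: conjugation by [gi] and [gj] adjusts the signs and conjugation by
    [gx] the cyclic order, so every normal form is brought here within [S]. *)
Definition nf_std h := exists T : R,
  [/\ T * T = 20, i * T = T * i, j * T = T * j & 4 * (2 * f h + 1) = (T + 2) * i + (T - 2) * j]%R.

Lemma nf_std_signs h : normal_form i j i j (2 * f h + 1)%R -> exists2 d, d \in S & nf_std (h ^ d).
Proof.
case: Qij => ii jj ji [T [e1 [e2 [TT [iT jT] e1E e2E HE]]]].
case: e1E HE => ->; case: e2E => -> HE.
- by exists 1; rewrite ?group1 // conjg1; exists T; split=> //; rewrite HE; nc.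
- exists gi => //; exists T; split=> //; rewrite fJ4 //.
  transitivity (- (i * (4 * (2 * f h + 1)) * i))%R; first by nc.
  by rewrite HE; ncr (ii,(jj,(ji,(iT,(jT,I))))).
- exists (gi * gj); rewrite ?groupM // conjgM; exists T; split=> //; rewrite !fJ4 //.
  transitivity (j * (i * (4 * (2 * f h + 1)) * i) * j)%R; first by nc.
  by rewrite HE; ncr (ii,(jj,(ji,(iT,(jT,I))))).
exists gj => //; exists T; split=> //; rewrite fJ4 //.
transitivity (- (j * (4 * (2 * f h + 1)) * j))%R; first by nc.
by rewrite HE; ncr (ii,(jj,(ji,(iT,(jT,I))))).
Qed.

Let fxJ h : (4 * (2 * f (h ^ gx) + 1) = (- 1 - i - j - k) * (2 * f h + 1) * (i + j + k - 1))%R.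
Proof.
have := fpfVl fpf gx; rewrite -fJx conjgE !fM => v.
by transitivity (4 * (2 * (f gx^-1 * (f h * f gx)) + 1 * (f gx^-1 * f gx)))%R; [rewrite v; nc | nc].
Qed.

Let fxVJ h : (4 * (2 * f (h ^ gx^-1) + 1) = (i + j + k - 1) * (2 * f h + 1) * (- 1 - i - j - k))%R.
Proof.
have := fpfVr fpf gx; rewrite -xE -xVE conjgE !fM invgK => v.
by transitivity (4 * (2 * (f gx * (f h * f gx^-1)) + 1 * (f gx * f gx^-1)))%R; [rewrite v; nc | nc].
Qed.

Lemma normal_form_cycle h : normal_form i j j k (2 * f h + 1)%R -> exists2 d, d \in S & nf_std (h ^ d).
Proof.
case: Qij => ii jj ji [T [e1 [e2 [TT [iT jT] e1E e2E HE]]]].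
suff /nf_std_signs[d Sd nf]: normal_form i j i j (2 * f (h ^ gx^-1) + 1)%R.
  by exists (gx^-1 * d); rewrite ?groupM ?groupV // conjgM.
exists T, e1, e2; split=> //; do 2!apply: add2I.
transitivity ((i + j + k - 1) * (4 * (2 * f h + 1)) * (- 1 - i - j - k))%R.
  by transitivity (4 * (4 * (2 * f (h ^ gx^-1) + 1)))%R; [nc | rewrite fxVJ; nc].
by rewrite HE /k; case: e1E => ->; case: e2E => ->; ncr (ii,(jj,(ji,(iT,(jT,I))))).
Qed.

Lemma normal_form_cycle2 h : normal_form i j k i (2 * f h + 1)%R -> exists2 d, d \in S & nf_std (h ^ d).
Proof.
case: Qij => ii jj ji [T [e1 [e2 [TT [iT jT] e1E e2E HE]]]].
suff /nf_std_signs[d Sd nf]: normal_form i j i j (2 * f (h ^ gx) + 1)%R.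
  by exists (gx * d); rewrite ?groupM // conjgM.
exists T, e1, e2; split=> //; do 2!apply: add2I.
transitivity ((- 1 - i - j - k) * (4 * (2 * f h + 1)) * (i + j + k - 1))%R.
  by transitivity (4 * (4 * (2 * f (h ^ gx) + 1)))%R; [nc | rewrite fxJ; nc].
by rewrite HE /k; case: e1E => ->; case: e2E => ->; ncr (ii,(jj,(ji,(iT,(jT,I))))).
Qed.

Let comm_or_unit u h : (f u * (2 * f h + 1) = (2 * f h + 1) * f u)%R \/
  (f u * (2 * f h + 1) - (2 * f h + 1) * f u)%R \is a GRing.unit.
Proof.
have [cuh | ncuh] := eqVneq (u * h) (h * u); [left | right].
  by transitivity (2 * f (u * h) + f u)%R; [rewrite fM; nc | rewrite cuh fM; nc].
have ->: (f u * (2 * f h + 1) - (2 * f h + 1) * f u = 2 * (f (u * h) - f (h * u)))%R.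
  by rewrite !fM; nc.
by rewrite unitrMl ?(fpf_unit2 fpf oz) // fpf_subr_unit.
Qed.

Lemma order3_cases h : #[h] = 3 ->
  (exists2 d, d \in S & commute (gx ^ d) h) \/ (exists2 d, d \in S & nf_std (h ^ d)).
Proof.
move=> oh; have [ii jj ji] := Qij; set H := (2 * f h + 1)%R.
have hh := fpf_order3 fpf oh.
have HH: (H * H = - 3)%R by rewrite /H; ncr (hh,I).
pose a := (i * H + H * i)%R; pose b := (j * H + H * j)%R; pose c := (k * H + H * k)%R.
have x1E: (2 * f gx + 1 = i + j + k)%R by rewrite xE; nc.
have triE d e : d \in S -> (2 * f (gx ^ d) + 1 = e)%R ->
    (exists2 d, d \in S & commute (gx ^ d) h) \/ pm2 (e * H + H * e)%R \/ ((e * H + H * e) * (e * H + H * e) = 20)%R.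
  move=> Sd eE; have [cxh | /eqP ncxh] := eqVneq (gx ^ d * h) (h * gx ^ d); [left; by exists d | right].
  have oxd : #[gx ^ d] = 3 by rewrite orderJ.
  have := pair_order3 fpf oz oxd oh ncxh; rewrite /tri eE -/H.
  by case=> [t | [t | [t _]]]; [left; left | left; right | right].
have e1 : (2 * f (gx ^ 1) + 1 = i + j + k)%R by rewrite conjg1 x1E.
have e2 : (2 * f (gx ^ gi) + 1 = i - j - k)%R.
  by rewrite fJ4 // x1E /k; ncr (ii,(jj,(ji,I))).
have e3 : (2 * f (gx ^ gj) + 1 = - i + j - k)%R.
  by rewrite fJ4 // x1E /k; ncr (ii,(jj,(ji,I))).
have e4 : (2 * f (gx ^ (gi * gj)) + 1 = - i - j + k)%R.
  by rewrite conjgM !fJ4 // x1E /k; ncr (ii,(jj,(ji,I))).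
case: (triE _ _ (group1 _) e1) => [|t1]; first by left.
case: (triE _ _ Si e2) => [|t2]; first by left.
case: (triE _ _ Sj e3) => [|t3]; first by left.
case: (triE _ _ (groupM Si Sj) e4) => [|t4]; first by left.
right.
have A1E: ((i + j + k) * H + H * (i + j + k) = a + b + c)%R by rewrite /a /b /c; nc.
have A2E: ((i - j - k) * H + H * (i - j - k) = a - b - c)%R by rewrite /a /b /c; nc.
have A3E: ((- i + j - k) * H + H * (- i + j - k) = - a + b - c)%R by rewrite /a /b /c; nc.
have A4E: ((- i - j + k) * H + H * (- i - j + k) = - a - b + c)%R by rewrite /a /b /c; nc.
rewrite A1E in t1; rewrite A2E in t2; rewrite A3E in t3; rewrite A4E in t4.
case: (quat_traces mul2I unit3 Qij HH t1 t2 t3 t4) => [nf|nf|nf|[g1 g2 g3 g4]].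
- exact: normal_form_cycle.
- exact: normal_form_cycle2.
- exact: nf_std_signs.
(* All four traces are golden. The products of distinct [G1], [G2], [G3] that occur vanish, so each
   is annihilated by a commutator of [H] with [i], [j] or [k]. These commutators are units, since
   [no_four_golden] forbids [H] to commute with a basis element; but [G1], [G2], [G3] have squares
   adding up to 32. *)
exfalso.
have [G0 [G1 [G2 [G3 [[i0 i1 i2 i3] [j0 j1 j2 j3] HE [g12 g13 g23 g32 g10] [G00 sG]]]]]] :=
  quat_four_golden mul2I Qij HH g1 g2 g3 g4.
have Hi: ((i * H - H * i) * 4 = 2 * (G2 * k) - 2 * (G3 * j))%R.
  transitivity (i * (4 * H) - 4 * H * i)%R; first by nc.
  by rewrite HE /k; ncr (ii,(jj,(ji,(i0,(i1,(i2,(i3,(j0,(j1,(j2,(j3,I))))))))))).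
have Hj: ((j * H - H * j) * 4 = 2 * (G3 * i) - 2 * (G1 * k))%R.
  transitivity (j * (4 * H) - 4 * H * j)%R; first by nc.
  by rewrite HE /k; ncr (ii,(jj,(ji,(i0,(i1,(i2,(i3,(j0,(j1,(j2,(j3,I))))))))))).
have Hk: ((k * H - H * k) * 4 = 2 * (G1 * j) - 2 * (G2 * i))%R.
  transitivity (k * (4 * H) - 4 * H * k)%R; first by nc.
  by rewrite HE /k; ncr (ii,(jj,(ji,(i0,(i1,(i2,(i3,(j0,(j1,(j2,(j3,I))))))))))).
have fk : f (gi * gj) = k by rewrite fM.
have [Qjk jk] := quat_cycle Qij; have [Qki ki] := quat_cycle Qjk; rewrite -/k in Qjk jk Qki ki;
  rewrite jk in Qki ki.
have z4 (X : R) : (X * 4 = 0 -> X = 0)%R by move=> X4; do 2!apply: mul2I; rewrite -X4; nc.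
case: (comm_or_unit gi h) => [ciH | ui].
  by apply: (no_four_golden Qij oh ciH); exact: (quat_four_comm mul2I Qij HH g1 g2 g3 g4 ciH).
case: (comm_or_unit gj h) => [cjH | uj].
  have Q' : quat (f gj) (f (gi * gj)) by rewrite fk.
  apply: (no_four_golden Q' oh cjH); apply: (quat_four_comm mul2I Q' HH _ _ _ _ cjH).
  - by rewrite fk -/i -/j jk; move: g1; rewrite -/a -/b -/c => <-; nc.
  - by rewrite fk -/i -/j jk; move: g3; rewrite -/a -/b -/c => <-; nc.
  - by rewrite fk -/i -/j jk; move: g4; rewrite -/a -/b -/c => <-; nc.
  by rewrite fk -/i -/j jk; move: g2; rewrite -/a -/b -/c => <-; nc.
case: (comm_or_unit (gi * gj) h) => [ckH | uk].
  have Q' : quat (f (gi * gj)) (f gi) by rewrite fk.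
  apply: (no_four_golden Q' oh ckH); apply: (quat_four_comm mul2I Q' HH _ _ _ _ ckH).
  - by rewrite fk -/i -/j ki; move: g1; rewrite -/a -/b -/c => <-; nc.
  - by rewrite fk -/i -/j ki; move: g4; rewrite -/a -/b -/c => <-; nc.
  - by rewrite fk -/i -/j ki; move: g2; rewrite -/a -/b -/c => <-; nc.
  by rewrite fk -/i -/j ki; move: g3; rewrite -/a -/b -/c => <-; nc.
rewrite -/H fk in ui uj uk; rewrite -/i in ui; rewrite -/j in uj.
have G1_0 : G1 = 0%R.
  apply: (mulIr ui); rewrite mul0r; apply: z4; rewrite -mulrA Hi.
  by transitivity (2 * (G1 * G2 * k) - 2 * (G1 * G3 * j))%R; [nc | rewrite g12 g13; nc].
have G2_0 : G2 = 0%R.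
  apply: (mulrI uj); rewrite mulr0; apply: z4.
  transitivity ((j * H - H * j) * 4 * G2)%R; first by nc.
  transitivity (2 * (G3 * G2 * i) - 2 * (G1 * G2 * k))%R; last by rewrite g12 g32; nc.
  by rewrite Hj /k; ncr (ii,(jj,(ji,(i2,(j2,I))))).
have G3_0 : G3 = 0%R.
  apply: (mulrI uk); rewrite mulr0; apply: z4.
  transitivity ((k * H - H * k) * 4 * G3)%R; first by nc.
  transitivity (2 * (G1 * G3 * j) - 2 * (G2 * G3 * i))%R; last by rewrite g13 g23; nc.
  by rewrite Hk /k; ncr (ii,(jj,(ji,(i3,(j3,I))))).
case/eqP: n10; do 5!apply: mul2I; transitivity (32%:R : R)%R; first by nc.
by rewrite -sG G1_0 G2_0 G3_0 !mulr0 !addr0.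
Qed.

Lemma tri_trace_value x y : #[x] = 3 -> #[y] = 3 -> trace_value (tri (f x) (f y)).
Proof.
move=> oX oy; have xx := fpf_order3 fpf oX.
have [cxy | /eqP ncxy] := eqVneq (x * y) (y * x).
  left; case: (fpf_order3_comm fpf oX oy cxy) => ->.
    by exists (-3)%R; [rewrite /tri; ncr (xx,I) | constructor 4].
  by exists 3%R; [rewrite triVr // /tri; ncr (xx,I) | constructor 3].
case: (pair_order3 fpf oz oX oy ncxy) => [t | [t | [t _]]]; last by right.
  by left; exists 1%R; [rewrite t mulr1 | constructor 1].
by left; exists (-1)%R; [rewrite t; nc | constructor 2].
Qed.

Let sixteen0 : (16%:R = 0 :> R)%R -> False.
Proof. by move=> e; case/eqP: n10; do 4!apply: mul2I; rewrite -[in RHS]e; nc. Qed.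

(** [tri (f gx) (f h) = - T] is a square root of 20, and that is the case of [pair_order3] in which
    5 is invertible. *)
Lemma nf_std_unit5 h : #[h] = 3 -> nf_std h -> (5%:R : R)%R \is a GRing.unit.
Proof.
case: Qij => ii jj ji oh [T [TT iT jT HE]].
have tE: (tri (f gx) (f h) = - T)%R.
  do 2!apply: add2I; rewrite /tri xE.
  transitivity ((i + j + k) * (4 * (2 * f h + 1)) + 4 * (2 * f h + 1) * (i + j + k))%R; first by nc.
  by rewrite HE /k; ncr (ii,(jj,(ji,(iT,(jT,I))))).
have t20: (tri (f gx) (f h) * tri (f gx) (f h) = 20)%R by rewrite tE mulrNN.
have [cxh | /eqP ncxh] := eqVneq (gx * h) (h * gx).
  have xx := fpf_order3 fpf ox.
  case: sixteen0; transitivity (36 - tri (f gx) (f h) * tri (f gx) (f h))%R; first by rewrite t20; nc.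
  case: (fpf_order3_comm fpf ox oh cxh) => ->; rewrite ?triVr // /tri; ncr (xx,I).
case: (pair_order3 fpf oz ox oh ncxh) => [t | [t | []//]]; rewrite t in t20; case: sixteen0.
  by transitivity (20 - 2 * 2 : R)%R; [nc | rewrite t20 subrr].
by transitivity (20 - - 2 * - 2 : R)%R; [nc | rewrite t20 subrr].
Qed.

Lemma nf_std_unique h1 h2 : #[h1] = 3 -> #[h2] = 3 -> nf_std h1 -> nf_std h2 -> h2 = h1.
Proof.
case: Qij => ii jj ji o1 o2 nf1; have u5 := nf_std_unit5 o1 nf1.
case: nf1 => T [TT iT jT HE] [U [UU iU jU KE]].
have: (2 * f h2 + 1 = 2 * f h1 + 1)%R.
  apply: (normal_form_unique mul2I unit3 u5 Qij TT UU iT jT iU jU HE KE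
     (K1 := (2 * f (h2 ^ gi) + 1)%R) (K2 := (2 * f (h2 ^ gx) + 1)%R)).
  - rewrite fJ4 //; transitivity (- (i * (4 * (2 * f h2 + 1)) * i))%R; first by nc.
    by rewrite KE; ncr (ii,(jj,(ji,(iU,(jU,I))))).
  - do 2!apply: add2I; transitivity (4 * (4 * (2 * f (h2 ^ gx) + 1)))%R; first by nc.
    rewrite fxJ; transitivity ((- 1 - i - j - k) * (4 * (2 * f h2 + 1)) * (i + j + k - 1))%R; first by nc.
    by rewrite KE /k; ncr (ii,(jj,(ji,(iU,(jU,I))))).
  - by apply: tri_trace_value; rewrite ?orderJ.
  by apply: tri_trace_value; rewrite ?orderJ.
move=> e; apply: (fpf_inj fpf); apply: add2I.
by transitivity (2 * f h2 + 1 - 1)%R; [nc | rewrite e; nc].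
Qed.

(** An [h] of order 3 commuting with a conjugate of [gx] is that conjugate or its inverse; by
    [nf_std_unique] all the others are conjugate under [S] to a single [h0]. So one commutative ring
    of coefficients containing the [T] of [h0] serves for all generators, and traces have the form
    [2 c0]. *)
Lemma tc_order3 : traces_central f <<z |: [set h | #[h] == 3]>>.
Proof.
have [ii jj ji] := Qij.
have [T [h0 [iT jT Ph0 nfE]]] : exists T h0, [/\ i * T = T * i, j * T = T * j,
    h0 = 1%g \/ 4 * (2 * f h0 + 1) = (T + 2) * i + (T - 2) * j /\ #[h0] = 3%N
    & forall h, #[h] = 3%N -> (exists2 d, d \in S & commute (gx ^ d)%g h) \/ (exists2 d, d \in S & (h ^ d)%g = h0)]%R.
  pose inT h := [exists d, (d \in S) && (gx ^ d * h == h * gx ^ d)].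
  have inTP h : reflect (exists2 d, d \in S & commute (gx ^ d) h) (inT h).
    by apply: (iffP existsP) => [[d /andP[Sd /eqP cdh]] | [d Sd cdh]]; exists d => //; rewrite Sd cdh /=.
  case: (pickP (fun h => (#[h] == 3) && ~~ inT h)) => [h /andP[/eqP oh not_inT] | all_inT].
    case: (order3_cases oh) => [/inTP inTh | [d Sd nfh]]; first by rewrite inTh in not_inT.
    have [T [TT iT jT HE]] := nfh; exists T, (h ^ d); split=> //; first by right; rewrite orderJ.
    move=> h' oh'; case: (order3_cases oh') => [? | [d' Sd' nfh']]; [by left | right].
    by exists d' => //; apply: nf_std_unique; rewrite ?orderJ.
  (* No element needs a normal form: [T = 1] and [h0 = 1] are placeholders. *)
  exists 1%R, 1; split; try by nc.
    by left.
  by move=> h oh; left; apply/inTP; move: (all_inT h); rewrite oh /= => /negbFE.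
pose cT (c : R) := [/\ i * c = c * i, j * c = c * j & T * c = c * T]%R.
(* The centre of the commutant of [i], [j], [T]: it is commutative and contains [T] and 1/2. *)
pose C (c : R) := cT c /\ forall r : R, cT r -> (c * r = r * c)%R.
have CM (c d : R) : C c -> C d -> C (c * d)%R.
  case=> [[c1 c2 c3] c4] [[d1 d2 d3] d4]; split; first by split; ncr (c1,(c2,(c3,(d1,(d2,(d3,I)))))).
  by move=> r cr; rewrite -mulrA d4 // mulrA c4 // mulrA.
have CD (c d : R) : C c -> C d -> C (c + d)%R.
  case=> [[c1 c2 c3] c4] [[d1 d2 d3] d4]; split; first by split; ncr (c1,(c2,(c3,(d1,(d2,(d3,I)))))).
  by move=> r cr; rewrite mulrDl mulrDr c4 ?d4.
have CN (c : R) : C c -> C (- c)%R.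
  case=> [[c1 c2 c3] c4]; split; first by split; ncr (c1,(c2,(c3,I))).
  by move=> r cr; rewrite mulNr mulrN c4.
have C1 : C 1%R by split; [split; nc | move=> r _; nc].
have C0 : C 0%R by split; [split; nc | move=> r _; nc].
have CT : C T by split; [split | move=> r []].
pose hf : R := (2%:R^-1)%R.
have hf2 : (2 * hf = 1)%R by rewrite mulrV ?(fpf_unit2 fpf oz).
have hfC r : (hf * r = r * hf)%R by apply/esym/commrV; rewrite /GRing.comm; nc.
have Ch : C hf by split; [by split; apply: esym | by move=> r _; apply: hfC].
pose P d := exists c0 c1 c2 c3, [/\ C c0, C c1, C c2, C c3 &
  f d = c0 + c1 * i + c2 * j + c3 * k /\ f d^-1 = c0 - c1 * i - c2 * j - c3 * k]%R.
have PM d e : P d -> P e -> P (d * e).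
  move=> [c0 [c1 [c2 [c3 [K0 K1 K2 K3 [fd fdV]]]]]] [d0 [d1 [d2 [d3 [D0 D1 D2 D3 [fe feV]]]]]].
  exists (c0 * d0 - c1 * d1 - c2 * d2 - c3 * d3)%R, (c0 * d1 + c1 * d0 + c2 * d3 - c3 * d2)%R,
    (c0 * d2 + c2 * d0 + c3 * d1 - c1 * d3)%R, (c0 * d3 + c3 * d0 + c1 * d2 - c2 * d1)%R.
  split; [by do ![apply: (CD) | apply: (CN) | apply: (CM)] | by do ![apply: (CD) | apply: (CN) | apply: (CM)]
    | by do ![apply: (CD) | apply: (CN) | apply: (CM)] | by do ![apply: (CD) | apply: (CN) | apply: (CM)] |].
  have cc (c' d' : R) : C c' -> C d' -> (d' * c' = c' * d')%R by case=> [cc' _] [_ ->].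
  have [[i0 j0 _] _] := D0; have [[i1 j1 _] _] := D1; have [[i2 j2 _] _] := D2; have [[i3 j3 _] _] := D3.
  have [[ic0 jc0 _] _] := K0; have [[ic1 jc1 _] _] := K1; have [[ic2 jc2 _] _] := K2; have [[ic3 jc3 _] _] := K3.
  rewrite invMg !fM fd fdV fe feV /k; split; first by ncr (ii,(jj,(ji,(i0,(i1,(i2,(i3,(j0,(j1,(j2,(j3,I))))))))))).
  have c00 := cc _ _ K0 D0; have c01 := cc _ _ K0 D1; have c02 := cc _ _ K0 D2; have c03 := cc _ _ K0 D3.
  have c10 := cc _ _ K1 D0; have c11 := cc _ _ K1 D1; have c12 := cc _ _ K1 D2; have c13 := cc _ _ K1 D3.
  have c20 := cc _ _ K2 D0; have c21 := cc _ _ K2 D1; have c22 := cc _ _ K2 D2; have c23 := cc _ _ K2 D3.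
  have c30 := cc _ _ K3 D0; have c31 := cc _ _ K3 D1; have c32 := cc _ _ K3 D2; have c33 := cc _ _ K3 D3.
  by ncr (ii,(jj,(ji,(i0,(i1,(i2,(i3,(j0,(j1,(j2,(j3,(ic0,(ic1,(ic2,(ic3,(jc0,(jc1,(jc2,(jc3,
    (c00,(c01,(c02,(c03,(c10,(c11,(c12,(c13,(c20,(c21,(c22,(c23,(c30,(c31,(c32,(c33,I))))))))))))))))))))))))))))))))))).
have PV d : P d -> P d^-1.
  move=> [c0 [c1 [c2 [c3 [K0 K1 K2 K3 [fd fdV]]]]]]; exists c0, (- c1)%R, (- c2)%R, (- c3)%R.
  by rewrite invgK fd fdV; split; first [exact: K0 | apply: (CN) | split; nc].
have P1 : P 1 by exists 1%R, 0%R, 0%R, 0%R; rewrite invg1 f1; split; first [exact C0 | exact C1 | split; nc].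
have Pi : P gi by exists 0%R, 1%R, 0%R, 0%R; rewrite fV4 // -/i; split; first [exact C0 | exact C1 | split; nc].
have Pj : P gj by exists 0%R, 0%R, 1%R, 0%R; rewrite fV4 // -/j; split; first [exact C0 | exact C1 | split; nc].
have Px : P gx.
  exists (- hf)%R, hf, hf, hf; split; [exact: (CN _ Ch) | exact: Ch | exact: Ch | exact: Ch | split; apply: add2I].
    transitivity (2 * f gx)%R; first by nc.
    by transitivity (2 * hf * (i + j + k - 1))%R; [rewrite hf2 mul1r xE | nc].
  transitivity (2 * f gx^-1)%R; first by nc.
  by transitivity (2 * hf * (- 1 - i - j - k))%R; [rewrite hf2 mul1r xVE | nc].
have PS d : d \in S -> P d.
  by apply: gen_ind_r => // {}d a Pd; rewrite !inE => /orP[/orP[]|] /eqP->; apply: PM.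
have PJ d e : P d -> P e -> P (d ^ e) by move=> Pd Pe; rewrite conjgE; do ?apply: (PM) => //; apply: (PV).
have Pz : P z.
  exists (-1)%R, 0%R, 0%R, 0%R; split; [exact: (CN _ C1) | exact: C0 | exact: C0 | exact: C0 |].
  have -> : z^-1 = z by apply/eqP; rewrite eq_invg_mul -[z * z]/(z ^+ 2) -oz expg_order.
  by rewrite (fpf_invol fpf oz); split; nc.
have Ph : P h0.
  case: Ph0 => [-> | [hE oh]]; first exact: P1.
  exists (- hf)%R, (hf * (hf * (hf * (T + 2))))%R, (hf * (hf * (hf * (T - 2))))%R, 0%R.
  split; [exact: (CN _ Ch) | | | exact: C0 |].
  - by do !apply: (CM) => //; apply: (CD) => //; apply: (CD).
  - by do !apply: (CM) => //; apply: (CD) => //; apply: (CN); apply: (CD).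
  have fhE: (f h0 = - hf + hf * (hf * (hf * (T + 2))) * i + hf * (hf * (hf * (T - 2))) * j + 0 * k)%R.
    do 3!apply: add2I; transitivity (4 * (2 * f h0 + 1) - 4)%R; first by nc.
    rewrite hE; transitivity (2 * hf * (2 * hf) * (2 * hf) * ((T + 2) * i + (T - 2) * j) - 4 * (2 * hf))%R.
      by rewrite hf2; nc.
    have hT := hfC T; have hi := hfC i; have hj := hfC j.
    by symmetry; nc.
  split=> //; rewrite (fpf_order3V fpf oh) fhE; apply: add2I.
  set X := (hf * _ * i)%R; set Y := (hf * _ * j)%R.
  transitivity (- 2 + 2 * hf - 2 * (X + Y))%R; first by nc.
  by transitivity (- (2 * hf) - 2 * (X + Y))%R; [rewrite hf2; nc | nc].
have PL d : d \in <<z |: [set h | #[h] == 3]>> -> P d.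
  apply: gen_ind_r => // {}d h Pd; rewrite !inE => /orP[/eqP-> | /eqP oh]; first exact: PM.
  apply: (PM) => //; case: (nfE h oh) => [[e Se cxh] | [e Se hE]].
    have oxe : #[gx ^ e] = 3 by rewrite orderJ.
    have Pxe : P (gx ^ e) by apply: (PJ) => //; apply: (PS).
    by case: (fpf_order3_comm fpf oxe oh cxh) => ->; [|apply: (PV)].
  by rewrite -[h](conjgK e) hE; apply: (PJ) => //; apply: (PV); apply: (PS).
move=> d e /PL[c0 [c1 [c2 [c3 [K0 K1 K2 K3 [fd fdV]]]]]] /PL[d0 [d1 [d2 [d3 [D0 D1 D2 D3 [fe feV]]]]]].
have [[ic0 jc0 _] _] := K0.
have cc (d' : R) : C d' -> (d' * c0 = c0 * d')%R by case: K0 => [cc' _] [_ ->].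
rewrite /GRing.comm fd fdV fe; have [q0 q1 q2 q3] := And4 (cc _ D0) (cc _ D1) (cc _ D2) (cc _ D3).
by transitivity (2 * c0 * (d0 + d1 * i + d2 * j + d3 * k))%R; [nc | rewrite /k; ncr (ic0,(jc0,(q0,(q1,(q2,(q3,I))))))].
Qed.

End Triple.
End Order3.

(** * Perfect groups and coprime action *)

Lemma grank_le2P (gT : finGroupType) (G : {group gT}) :
  reflect (exists x y, G :=: <<[set x; y]>>) ('m(G) <= 2).
Proof.
apply: (iffP idP) => [|[x [y ->]]]; last first.
  by rewrite (leq_trans (grank_min _)) // cards2; case: eqP.
have [B defG <-] := grank_witness G; rewrite -defG leq_eqVlt => /orP[/cards2P[x [y [_ ->]]]|].
  by exists x, y.
rewrite ltnS leq_eqVlt => /orP[/cards1P[x ->]|]; first by exists x, x; rewrite setUid.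
by rewrite ltnS leqn0 cards_eq0 => /eqP->; exists 1, 1; rewrite setUid gen0; apply/esym/cycle1.
Qed.

(** A noncyclic 2-group with a single involution is generalised quaternion; [r] generates a cyclic
    subgroup of index 2. *)
Lemma invol_2group (gT : finGroupType) (S : {group gT}) z :
    2.-group S -> {in S, forall x, #[x] = 2 -> x = z} ->
  cyclic S \/ exists r s, [/\ r \in S, s \in S :\: <[r]>, #|S : <[r]>| = 2 /\ 4 %| #[r],
    {in S :\: <[r]>, forall t, #[t] = 4}
    & {in <[r]> & S :\: <[r]>, forall x t, x ^ t = x^-1}].
Proof.
move=> pS invS; have [-> | ntS] := eqVneq (S : {set gT}) 1; first by left; apply: cyclic1.
have [_ /(Cauchy (isT : prime 2))[x Sx ox] _] := pgroup_pdiv pS ntS.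
have zS := invS x Sx ox; rewrite {}zS in Sx ox.
have: #|'Ohm_1(S)| = 2.
  rewrite -{1}ox orderE (OhmE _ pS) expn1; congr #|pred_of_set _|.
  apply/eqP; rewrite eqEsubset !gen_subG sub1set mem_gen ?andbT; last first.
    by rewrite !inE Sx -{1}ox expg_order eqxx.
  apply/subsetP=> y; rewrite !inE => /andP[Sy /eqP y2].
  have [-> | nty] := eqVneq y 1; first exact: group1.
  by rewrite (invS y Sy (nt_prime_order _ y2 nty)) ?cycle_id.
case/(prime_Ohm1P pS ntS)/orP=> [|/eqP]; first by left.
case/quaternion_classP=> n n_gt2 isoS; right.
have [[r s] genS _] := generators_quaternion n_gt2 isoS.
have [[_ o4 inv] _ _ _ _] := quaternion_structure n_gt2 genS isoS.
case: (genS) => oS Sr or S's; exists r, s; split=> //; split.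
  by rewrite -divgS ?cycle_subG // -orderE or oS -expnB // ?leq_pred //; case: (n) n_gt2 => // m _; rewrite subSnn.
by rewrite or (dvdn_exp2l 2 (_ : 2 <= n.-1)) //; case: (n) n_gt2.
Qed.

Lemma Sylow_sub_cent (gT : finGroupType) p (G S : {group gT}) :
    p.-Sylow(G) S -> abelian S ->
    {in 'N_G(S), forall n, p^'.-elt n -> n \in 'C(S)} ->
  'N_G(S) \subset 'C(S).
Proof.
move=> sylS abS cS; apply/subsetP=> n Nn; rewrite -(consttC p n).
have Nnp pi : n.`_pi \in 'N_G(S) by rewrite groupX.
apply: groupM; last by apply: cS; rewrite ?p_elt_constt.
have sSN : p.-Sylow('N_G(S)) S by rewrite (pHall_subl _ (subsetIl _ _) sylS) // subsetI (pHall_sub sylS) normG.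
have nSN : S <| 'N_G(S) by rewrite /normal (pHall_sub sSN) subsetIr.
by apply: (subsetP abS); rewrite (mem_normal_Hall sSN nSN) ?p_elt_constt.
Qed.

(** [#|Aut S|] is a power of [p] times [p - 1], so [a] induces an automorphism of order dividing
    [p - 1]. For [p = 2] this says that [a] itself centralises [S]. *)
Lemma cyclic_pgroup_cent (gT : finGroupType) p (S : {group gT}) a :
    prime p -> p.-group S -> cyclic S -> a \in 'N(S) -> p^'.-elt a ->
  a ^+ p.-1 \in 'C(S).
Proof.
move=> p_pr pS cycS Na p'a; rewrite -ker_conj_aut.
have Aa : conj_aut S a \in Aut S by rewrite (subsetP (Aut_conj_aut _ 'N(S))) // mem_morphim.
apply/kerP; rewrite ?groupX // morphX //; apply/eqP; rewrite -order_dvdn.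
have [n oS] := p_natP pS.
have := order_dvdG Aa; rewrite card_Aut_cyclic // oS.
case: n {oS} => [|n] oA; first exact: dvdn_trans oA (dvd1n _).
move: oA; rewrite totient_pfactor // Gauss_dvdl // coprime_sym coprimeXl //.
by rewrite (pnat_coprime _ (pnat_dvd (morph_order _ Na) p'a)) // pnat_id.
Qed.

(** [s ^ (a ^+ n) = s * [~ s, a] ^+ n], so the order of the commutator divides both [#[a]] and
    [#|H|]. *)
Lemma coprime_cent_factor (gT : finGroupType) (H : {group gT}) a s :
  a \in 'C(H) -> coprime #|H| #[a] -> [~ s, a] \in H -> commute s a.
Proof.
move=> cHa coHa Hc; have caX n : s ^ (a ^+ n) = s * [~ s, a] ^+ n.
  elim: n => [|n IHn]; first by rewrite conjg1 mulg1.
  rewrite expgSr conjgM IHn conjMg conjXg (conjgE [~ s, a]) -((centP cHa) _ Hc) mulKg.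
  by rewrite [s ^ a]conjg_mulR -mulgA -expgS.
have: [~ s, a] ^+ #[a] = 1 by apply/(mulgI s); rewrite -caX expg_order conjg1 mulg1.
move/eqP; rewrite -order_dvdn => d1; apply/commgP; rewrite -order_eq1 -dvdn1.
by rewrite -(eqP coHa) dvdn_gcd d1 order_dvdG.
Qed.

Section Perfect.
Variables (gT : finGroupType) (P : {group gT}).
Hypothesis perfP : P \subset P^`(1).

Lemma perfect_quo (K : {group gT}) : P \subset 'N(K) -> solvable (P / K) -> P \subset K.
Proof.
move=> nKP /forall_inP /(_ (P / K)%G) /=; rewrite subsetI subxx -derg1 -quotient_der // quotientS //.
by move=> /(_ isT)/eqP PK1; rewrite -quotient_sub1 // PK1.
Qed.

Lemma perfect_hom (rT : finGroupType) (f : {morphism P >-> rT}) : abelian (f @* P) -> {in P, forall x, f x = 1}.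
Proof.
move=> abf x Px; have: x \in P^`(1) by apply: (subsetP perfP).
move/(mem_morphim f Px); rewrite morphim_der // (derG1P abf) => /set1P.
done.
Qed.

Lemma perfect_norm_abelian_aut (A : {group gT}) : P \subset 'N(A) -> abelian (Aut A) -> P \subset 'C(A).
Proof.
move=> nAP abA; apply: (subset_trans perfP); rewrite derg1 -(setIidPr nAP) gen_subG.
apply/subsetP=> _ /imset2P[x y /setIP[Nx _] /setIP[Ny _] ->].
suff: [~ x, y] \in 'ker (conj_aut A) by rewrite ker_conj_aut.
apply/kerP; rewrite ?groupR // morphR //; apply/eqP/commgP.
by apply: (centsP abA); rewrite (subsetP (Aut_conj_aut _ 'N(A))) // mem_morphim.
Qed.

Lemma perfect_Sylow p (S : {group gT}) : p.-Sylow(P) S -> abelian S -> 'N_P(S) \subset 'C(S) -> S :=: 1.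
Proof.
move=> sylS abS cS; have [V [imV VS]] := Burnside_transfer sylS abS cS.
apply/trivgP/subsetP=> x Sx; have Px := subsetP (pHall_sub sylS) x Sx; rewrite inE -order_eq1 -dvdn1.
have := VS x Sx; rewrite perfect_hom ?(abelianS imV) // => /esym/eqP; rewrite -order_dvdn => d1.
have /eqP <- : coprime #|S| #|P : S| by case/and3P: sylS => _; apply: pnat_coprime.
by rewrite dvdn_gcd d1 order_dvdG.
Qed.

End Perfect.

Lemma index_astab_dvd_fact (gT : finGroupType) (rT : finType) (to : {action gT &-> rT})
    (G : {group gT}) (S : {set rT}) :
  [acts G, on S | to] -> #|G : 'C_G(S | to)| %| #|S|`!.
Proof.
move=> actS; rewrite -perm.card_Sym.
have nG: actperm to @* G \subset 'N(S | 'P).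
  apply/subsetP=> _ /morphimP[a _ Ga ->]; apply/astabsP=> x /=.
  by rewrite /aperm actpermE (actsP actS).
have sGD : G \subset actperm to @*^-1 'N(S | 'P) by rewrite -sub_morphim_pre ?subsetT.
have kerE : G :&: 'ker (restr_perm_morphism S \o actperm_morphism to) = 'C_G(S | to).
  rewrite ker_comp ker_restr_perm; apply/setP=> a; rewrite !in_setI; apply: andb_id2l => Ga.
  rewrite !inE /=; apply: eq_subset_r => x.
  by rewrite !inE /= /aperm actpermE.
rewrite -kerE indexgI -[in X in X %| _](setIidPr sGD) -card_morphim cardSg //.
apply/subsetP=> _ /morphimP[p _ _ ->].
by rewrite inE restr_perm_on.
Qed.

Lemma solvable_dvd24 (gT : finGroupType) (G : {group gT}) : #|G| %| 24 -> solvable G.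
Proof.
move=> dG; apply: Burnside_p_a_q_b.
rewrite (@uniq_leq_size _ _ [:: 2; 3]) ?primes_uniq // => p.
rewrite mem_primes => /and3P[p_pr _ /dvdn_trans/(_ dG)].
by rewrite -[24]/(2 ^ 3 * 3)%N Euclid_dvdM // Euclid_dvdX // !dvdn_prime2 // !inE andbT.
Qed.

(** Permutation groups on at most four points are solvable, their order dividing 24. *)
Lemma perfect_act_small (gT : finGroupType) (rT : finType) (to : {action gT &-> rT})
    (P : {group gT}) (S : {set rT}) :
  P \subset P^`(1) -> [acts P, on S | to] -> #|S| <= 4 -> P \subset 'C(S | to).
Proof.
move=> perfP actS S4; have nC : 'C_P(S | to) <| P.
  exact: normalGI actS (astab_normal to S).
suff: P \subset 'C_P(S | to) by case/subsetIP.
apply: (perfect_quo perfP); first exact: normal_norm.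
apply: solvable_dvd24; rewrite card_quotient ?normal_norm //.
apply: dvdn_trans (index_astab_dvd_fact actS) _.
by case: #|S| S4 => [|[|[|[|[|]]]]].
Qed.

(** * Lifting two generators *)

Section LiftPrime.

Variables (gT : finGroupType) (G Q : {group gT}).
Hypotheses (nsQG : Q <| G) (prQ : prime #|Q|).
Hypothesis cycS : forall S : {group gT}, #|Q|.-Sylow(G) S -> cyclic S.

Lemma quotient_gens_mul (x y : gT) : x \in G -> y \in G ->
  G / Q = <<[set coset Q x; coset Q y]>> -> Q * <<[set x; y]>> = G.
Proof.
move=> Gx Gy defGQ; have nQG := normal_norm nsQG.
have sTG : [set x; y] \subset G by rewrite subUset !sub1set Gx.
have sTN := subset_trans sTG nQG.
rewrite -(quotientGK nsQG) defGQ -quotientK ?gen_subG // quotient_gen //.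
by rewrite /quotient (morphimU _ [set x]) !morphim_set1 ?(subsetP nQG).
Qed.

(** A subgroup of [T] of order [#|Q|] would share a cyclic Sylow subgroup with [Q], hence be [Q]. *)
Lemma prime_complement (T : {group gT}) : Q * T = G -> T :!=: G ->
  Q :&: T = 1 /\ coprime #|Q| #|T|.
Proof.
move=> QT neTG; have sTG : T \subset G by rewrite -QT mulG_subr.
have tiQT : Q :&: T = 1.
  by apply: prime_TIg => //; apply: contra neTG => /mulSGid <-; rewrite QT.
split=> //; rewrite prime_coprime //; apply/negP=> /(Cauchy prQ)[t Tt ot].
have qQ : #|Q|.-group Q by rewrite /pgroup pnat_id.
have qt : #|Q|.-group <[t]> by rewrite /pgroup -orderE ot pnat_id.
have stG : <[t]> \subset G by rewrite cycle_subG (subsetP sTG).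
have [S sylS stS] := Sylow_superset stG qt.
have sQS : Q \subset S.
  by rewrite (subset_trans _ (pcore_sub_Hall sylS)) // pcore_max.
have : <[t]> :==: Q by rewrite (eq_subG_cyclic (cycS sylS)) // -orderE ot.
move=> /eqP tQ; have : t \in Q :&: T by rewrite -tQ inE cycle_id.
by rewrite tiQT => /set1P t1; move: prQ; rewrite -ot t1 order1.
Qed.

(* If [(x, y)], [(x * a, y)] and [(x, y * a)] all generate proper subgroups, these are conjugate
   complements of [Q]; the conjugating elements show that [Q] centralises [y], then [x]. *)
Lemma grank2_lift_prime : 'm(G / Q) <= 2 -> 'm(G) <= 2.
Proof.
have nQG := normal_norm nsQG.
case/grank_le2P=> _x [_y defGQ].
have /morphimP[x Nx Gx def_x] : _x \in G / Q by rewrite defGQ mem_gen ?set21.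
have /morphimP[y Ny Gy def_y] : _y \in G / Q by rewrite defGQ mem_gen ?set22.
rewrite {_x}def_x {_y}def_y /= in defGQ.
have [a Qa nta] : exists2 a, a \in Q & a != 1.
  by apply/trivgPn; rewrite -cardG_gt1 prime_gt1.
have Na := subsetP (normG Q) a Qa.
have sQG := normal_sub nsQG; have Ga := subsetP sQG a Qa.
have cos x' : x' \in 'N(Q) -> coset Q (x' * a) = coset Q x' by move=> N; rewrite morphM //= (coset_id Qa) mulg1.
have [G1 | ne0] := eqVneq <<[set x; y]>> G; first by apply/grank_le2P; exists x, y.
have [G1 | ne1] := eqVneq <<[set x * a; y]>> G; first by apply/grank_le2P; exists (x * a), y.
have [G1 | ne2] := eqVneq <<[set x; y * a]>> G; first by apply/grank_le2P; exists x, (y * a).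
have QT := quotient_gens_mul Gx Gy defGQ.
have QT1 : Q * <<[set x * a; y]>> = G by apply: quotient_gens_mul; rewrite ?groupM ?cos.
have QT2 : Q * <<[set x; y * a]>> = G by apply: quotient_gens_mul; rewrite ?groupM ?cos.
have [ti0 co0] := prime_complement QT ne0.
have conjT (T1 : {group gT}) : Q * T1 = G -> T1 :!=: G ->
    Q :&: T1 = 1 /\ exists2 b, b \in Q & T1 :=: <<[set x; y]>> :^ b.
  move=> QT' ne'; have [ti1 co1] := prime_complement QT' ne'; split=> //.
  apply: SchurZassenhaus_trans_sol => //; first by rewrite abelian_sol ?cyclic_abelian ?prime_cyclic.
  - by rewrite (subset_trans _ nQG) // -QT mulG_subr.
  - by rewrite QT -QT' mulG_subr.
  apply/eqP; rewrite -(eqn_pmul2l (cardG_gt0 Q)) -!TI_cardMg //; by rewrite QT QT'.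
have inj (T1 : {group gT}) u v : Q * T1 = G -> Q :&: T1 = 1 -> u \in T1 -> v \in T1 ->
    coset Q u = coset Q v -> u = v.
  move=> QT' ti1 T1u T1v; have sT1 : T1 \subset 'N(Q) by rewrite (subset_trans _ nQG) // -QT' mulG_subr.
  case/kercoset_rcoset; rewrite ?(subsetP sT1) // => c Qc def_u.
  have: c \in Q :&: T1 by rewrite inE Qc -(mulgK v c) -def_u groupM ?groupV.
  by rewrite ti1 def_u => /set1P->; rewrite mul1g.
have cosJ u b : u \in 'N(Q) -> b \in Q -> coset Q (u ^ b) = coset Q u.
  by move=> Nu Qb; rewrite morphJ //= ?(coset_id Qb) ?conjg1 // (subsetP (normG Q)).
have cQ u b : b \in Q -> b != 1 -> u ^ b = u -> u \in 'C(Q).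
  move=> Qb ntb ub; rewrite (nt_gen_prime prQ (_ : b \in Q^#)) ?inE ?ntb //=.
  by rewrite cent_cycle; apply/cent1P/commgP/conjg_fixP.
have mem0 u : u \in [set x; y] -> forall b, u ^ b \in <<[set x; y]>> :^ b.
  by move=> xy_u b; rewrite memJ_conjg mem_gen.
have [ti1 [b Qb T1b]] := conjT _ QT1 ne1; have [ti2 [c Qc T2c]] := conjT _ QT2 ne2.
have xab : x * a = x ^ b.
  apply: (inj _ _ _ QT1 ti1); [by rewrite mem_gen ?set21 | by rewrite /= T1b mem0 ?set21 | by rewrite ?cos ?cosJ].
have yb : y ^ b = y.
  apply/esym/(inj _ _ _ QT1 ti1); [by rewrite mem_gen ?set22 | by rewrite /= T1b mem0 ?set22 | by rewrite ?cos ?cosJ].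
have yac : y * a = y ^ c.
  apply: (inj _ _ _ QT2 ti2); [by rewrite mem_gen ?set22 | by rewrite /= T2c mem0 ?set22 | by rewrite ?cos ?cosJ].
have xc : x ^ c = x.
  apply/esym/(inj _ _ _ QT2 ti2); [by rewrite mem_gen ?set21 | by rewrite /= T2c mem0 ?set21 | by rewrite ?cos ?cosJ].
have nt u d : u * a = u ^ d -> d != 1.
  by move=> ud; apply: contra_neq nta => d1; apply: (mulgI u); rewrite ud d1 conjg1 mulg1.
have cxQ := cQ x c Qc (nt _ _ yac) xc.
by case/negP: nta; apply/eqP/(mulgI x); rewrite xab mulg1 conjgE ((centP cxQ) b Qb) mulKg.
Qed.

End LiftPrime.

Definition odd_cyclic_Sylow (gT : finGroupType) (G : {group gT}) :=
  forall p (S : {group gT}), odd p -> p.-Sylow(G) S -> cyclic S.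

Lemma odd_cyclic_quo (gT : finGroupType) (G N : {group gT}) :
  N <| G -> odd_cyclic_Sylow G -> odd_cyclic_Sylow (G / N)%G.
Proof.
move=> nsNG cycG p S p_odd sylS; have [T sylT] := Sylow_exists p G.
have nTN : T \subset 'N(N) by rewrite (subset_trans (pHall_sub sylT)) ?normal_norm.
have [x _ ->] := Sylow_trans (quotient_pHall nTN sylT) sylS.
by rewrite cyclicJ quotient_cyclic // (cycG p).
Qed.

(** For the smallest prime divisor [p], element orders in [P] are coprime to [p - 1], so a cyclic
    Sylow subgroup would be centralised by its normaliser and the transfer would make it trivial. *)
Lemma perfect_pdiv_Sylow (gT : finGroupType) (P S : {group gT}) :
  P \subset P^`(1) -> P :!=: 1 -> (pdiv #|P|).-Sylow(P) S -> ~~ cyclic S.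
Proof.
move=> perfP ntP sylS; apply/negP=> cycS.
pose p := pdiv #|P|; have p_pr : prime p by rewrite pdiv_prime // cardG_gt1.
have nc : 'N_P(S) \subset 'C(S).
  apply: (Sylow_sub_cent sylS (cyclic_abelian cycS)) => n /setIP[Pn Nn] p'n.
  have := cyclic_pgroup_cent p_pr (pHall_pgroup sylS) cycS Nn p'n.
  suff co : coprime #[n] p.-1.
    move=> cn; have [k kE] : exists k, n = (n ^+ p.-1) ^+ k.
      by apply/cycleP; rewrite -(generator_coprime n p.-1) in co; rewrite -(eqP co) cycle_id.
    by rewrite kE groupX.
  have p1_gt0 : 0 < p.-1 by case: (p) (prime_gt1 p_pr) => [|[]].
  rewrite /coprime eqn_leq gcdn_gt0 order_gt0 andbT leqNgt; apply/negP=> d1.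
  have := pdiv_min_dvd d1 (dvdn_trans (dvdn_gcdl _ _) (order_dvdG Pn)).
  apply/negP; rewrite -ltnNge -/p (leq_ltn_trans (dvdn_leq p1_gt0 (dvdn_gcdr _ _))) //.
  by rewrite ltn_predL prime_gt0.
have S1 := perfect_Sylow perfP sylS (cyclic_abelian cycS) nc.
have := card_Hall sylS; rewrite S1 cards1 => /esym/eqP.
by rewrite p_part_eq1 pi_pdiv cardG_gt1 ntP.
Qed.

Lemma odd_sol (gT : finGroupType) (G : {group gT}) :
  odd #|G| -> odd_cyclic_Sylow G -> solvable G.
Proof.
move=> oddG cycG; apply: contraT => /forall_inPn[P]; rewrite unfold_in subsetI => /andP[sPG perfP] ntP.
rewrite -derg1 in perfP; have [S sylS] := Sylow_exists (pdiv #|P|) P.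
case/negP: (perfect_pdiv_Sylow perfP ntP sylS).
have [T sylT sST] := Sylow_superset (subset_trans (pHall_sub sylS) sPG) (pHall_pgroup sylS).
apply: (cyclicS sST); apply: cycG sylT.
exact: dvdn_odd (dvdn_trans (pdiv_dvd _) (cardSg sPG)) oddG.
Qed.

Lemma grank2_lift (gT : finGroupType) (G N : {group gT}) :
  N <| G -> odd #|N| -> odd_cyclic_Sylow G -> 'm(G / N) <= 2 -> 'm(G) <= 2.
Proof.
have [n] := ubnP #|N|; elim: n gT G N => // n IHn gT G N /ltnSE leNn nsNG oddN cycG mGN.
have [N1 | ntN] := eqVneq (N : {set gT}) 1.
  by rewrite (isog_grank (quotient1_isog G)) -N1.
have solN : solvable N.
  apply: odd_sol => // p S p_odd sylS.
  have [T sylT sST] := Sylow_superset (subset_trans (pHall_sub sylS) (normal_sub nsNG)) (pHall_pgroup sylS).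
  exact: cyclicS sST (cycG p T p_odd sylT).
have [Q minQ sQN] := minnormal_exists ntN (normal_norm nsNG).
have [nQG ntQ abQ] := minnormal_solvable minQ sQN solN.
have sQG := subset_trans sQN (normal_sub nsNG).
have nsQG : Q <| G by apply/andP.
have [q q_pr abelQ] := is_abelemP abQ; have qQ := abelem_pgroup abelQ.
have [_ q_dvd _] := pgroup_pdiv qQ ntQ.
have q_odd : odd q := dvdn_odd (dvdn_trans q_dvd (cardSg sQN)) oddN.
have prQ : #|Q| = q.
  have [S sylS sQS] := Sylow_superset sQG qQ.
  have cycQ := cyclicS sQS (cycG q S q_odd sylS).
  apply/eqP; rewrite eqn_dvd q_dvd andbT -exponent_cyclic //.
  by move: abelQ; rewrite abelemE // => /andP[].
apply: (@grank2_lift_prime _ G Q) => //; rewrite ?prQ //; first by move=> S; apply: cycG.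
apply: (IHn _ (G / Q)%G (N / Q)%G).
- apply: leq_trans leNn; rewrite ltn_quotient //.
- exact: quotient_normal.
- by rewrite /= (dvdn_odd (dvdn_quotient _ _)).
- exact: odd_cyclic_quo.
- by rewrite (isog_grank (third_isog sQN nsQG nsNG)).
Qed.

(** * Solvable groups with at most one involution *)

Lemma index2_full (gT : finGroupType) (H S T : {group gT}) s :
  #|S : H| = 2 -> H \subset T -> T \subset S -> s \in T -> s \notin H -> T :=: S.
Proof.
move=> i2 sHT sTS Ts nHs; apply/eqP; rewrite eqEsubset sTS -indexg_eq1.
have [_ /(_ #|T : H|)] := primeP (isT : prime 2).
have := i2; rewrite -(Lagrange_index sTS sHT) => i2'; rewrite -{1}i2' dvdn_mull // => /(_ isT).
case/orP=> /eqP e; last by move: i2'; rewrite e; case: #|S : T| => [|[|]].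
by move/eqP: e; rewrite indexg_eq1 => /subsetP/(_ s Ts); rewrite (negPf nHs).
Qed.

Lemma index2_conj (gT : finGroupType) (H S : {group gT}) a t :
    #|S : H| = 2 -> H \subset S -> a \in 'N(S) -> a \in 'N(H) -> t \in S -> [~ t, a] \in H.
Proof.
move=> i2 sHS nSa nHa St; have [_ nHS] := andP (index2_normal sHS i2).
have Sta : t ^ a \in S by rewrite memJ_norm.
have [Ht | nHt] := boolP (t \in H).
  by rewrite commgEl groupM ?groupV // memJ_norm.
have: t ^ a \in S :\: H by rewrite inE Sta memJ_norm // nHt.
rewrite -(rcoset_index2 sHS i2 (_ : t \in S :\: H)) ?inE ?nHt // => /rcosetP[h Hh e].
by rewrite commgEl e -conjgE memJ_norm // (subsetP nHS).
Qed.

Lemma grank2_invol_2group (gT : finGroupType) (S : {group gT}) z :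
  2.-group S -> {in S, forall x, #[x] = 2 -> x = z} -> 'm(S) <= 2.
Proof.
move=> pS inv; apply/grank_le2P; case: (invol_2group pS inv) => [/cyclicP[x ->]|].
  by exists x, x; rewrite setUid.
case=> r [s [Sr /setDP[Ss nrs] [i2 _] _ _]]; exists r, s; apply/esym.
apply: (@index2_full _ <[r]> S <<[set r; s]>> s) => //.
- by rewrite cycle_subG mem_gen ?set21.
- by rewrite gen_subG subUset !sub1set Sr.
- by rewrite mem_gen ?set22.
Qed.

(** [a] acts trivially on [<[y]>], whose automorphism group is a 2-group, and on the quotient of
    order 2. *)
Lemma norm_cyclic_index2_cent (gT : finGroupType) (Y : {group gT}) y a :
    2.-group Y -> y \in Y -> #|Y : <[y]>| = 2 -> a \in 'N(Y) -> 2^'.-elt a ->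
  y ^ a \in <[y]> -> a \in 'C(Y).
Proof.
move=> pY Yy i2 nYa p'a ya; have sYy : <[y]> \subset Y by rewrite cycle_subG.
have nya : a \in 'N(<[y]>).
  by rewrite inE -cycleJ cycle_subG.
have pC : 2.-group <[y]> := pgroupS sYy pY.
have ca : a \in 'C(<[y]>) by have := cyclic_pgroup_cent (isT : prime 2) pC (cycle_cyclic y) nya p'a.
apply/centP=> t Yt; apply/commute_sym/(coprime_cent_factor ca); last by apply: (index2_conj i2 sYy nYa nya Yt).
exact: pnat_coprime pC p'a.
Qed.

Lemma p'elt_pgroup1 (gT : finGroupType) p (Y : {group gT}) a : p.-group Y -> p^'.-elt a -> a \in Y -> a = 1.
Proof. 
move=> pY p'a Ya; apply/eqP; rewrite -order_eq1; apply/eqP/(pnat_1 _ p'a).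
exact: mem_p_elt pY Ya.
Qed.

Lemma elt_cent_pgroup (gT : finGroupType) p (X K Y : {group gT}) :
    K \subset X -> p.-group Y -> 'C_X(Y) \subset Y ->
  {in K, forall a, p^'.-elt a -> a \in 'C(Y)} -> p.-group K.
Proof.
move=> sKX pY cY cK; apply/pgroupP=> q q_pr /(Cauchy q_pr)[t Kt ot].
apply: contraT => np; have p't : p^'.-elt t by rewrite /p_elt ot pnatE.
have Yt : t \in Y by rewrite (subsetP cY) // inE (subsetP sKX) // cK.
by move: q_pr; rewrite -ot (p'elt_pgroup1 pY p't Yt) order1.
Qed.

(** Otherwise a minimal normal subgroup of [X / Z] inside [C / Z] lifts to a normal [L] with
    [[L, L]] in [Z] and [Z] central in [L]. Such an [L] is nilpotent, so it lies in the Fitting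
    subgroup, hence in [Z]. *)
Lemma cent_sub_Fitting (gT : finGroupType) (X : {group gT}) :
  solvable X -> 'C_X('F(X)) \subset 'F(X).
Proof.
move=> solX; have nsFX := Fitting_normal X.
have nsCX : 'C_X('F(X)) <| X.
  by rewrite /normal subsetIl normsI ?normG // norms_cent ?normal_norm.
pose C := 'C_X('F(X))%G; pose Z := (C :&: 'F(X))%G.
have nsZX : Z <| X by apply: normalI.
have nZX := normal_norm nsZX; have nZC := subset_trans (normal_sub nsCX) nZX.
suff CZ1 : (C / Z)%G :=: 1.
  by have: C \subset Z by [rewrite -quotient_sub1 // CZ1]; case/subsetIP.
apply/eqP; apply: contraT => ntCZ.
have nsCZX : (C / Z)%G <| (X / Z)%G by apply: quotient_normal.
have [M minM sMC] := minnormal_exists ntCZ (normal_norm nsCZX).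
have [nMX ntM /is_abelemP[p _ abM]] := minnormal_solvable minM (subset_trans sMC (normal_sub nsCZX)) (quotient_sol _ solX).
have nsMX : M <| (X / Z)%G by rewrite /normal (subset_trans sMC (normal_sub nsCZX)).
have [L defM sZL nsLX] := inv_quotientN nsZX nsMX.
have nZL := subset_trans (normal_sub nsLX) nZX.
have sLC : L \subset C.
  by rewrite -(quotientSGK _ (subsetIl _ _ : Z \subset C)) -?defM // (subset_trans (normal_sub nsLX)).
have sLF : L \subset 'F(X).
  apply: Fitting_max => //; apply/forall_inP=> H; rewrite subsetI => /andP[sHL sHHL].
  have sHZ : H \subset Z.
    apply: subset_trans sHHL (subset_trans (commSg _ sHL) _).
    rewrite -quotient_cents2 ?(subset_trans (normal_sub nsLX)) // -defM.
    exact: (abelem_abelian abM).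
  rewrite -subG1 (subset_trans sHHL) // subG1; apply/eqP/commG1P.
  rewrite centsC (subset_trans sLC) // (subset_trans (subsetIr _ _)) // centS //.
  by rewrite (subset_trans sHZ) ?subsetIr.
case/negP: ntM; rewrite defM -subG1 quotient_sub1 //.
by apply/subsetIP.
Qed.

Section SolvableCore.

Variables (gT : finGroupType) (X : {group gT}) (z : gT).
Hypotheses (solX : solvable X) (invX : {in X, forall x, #[x] = 2 -> x = z}) (O1 : 'O_2^'(X) = 1).

(** Unless [X] is a 2-group, some [a] of odd order acts nontrivially on the Fitting subgroup, which
    is then quaternion of order 8. The second generator [w] spans a cyclic subgroup of index 2 in a
    Sylow 2-subgroup [S]; [<[set a; w]>] contains [S] properly, and [#|X : S|] divides 3. *)
Lemma grank2_core1 : 'm(X) <= 2.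
Proof.
pose Y := 'F(X)%G; have nsYX : Y <| X := Fitting_normal X; have [sYX nYX] := andP nsYX.
have cY : 'C_X(Y) \subset Y := cent_sub_Fitting solX.
have pY : 2.-group Y.
  by rewrite /Y /= (Fitting_eq_pcore O1) pcore_pgroup.
have case1 : {in X, forall a, 2^'.-elt a -> a \in 'C(Y)} -> 'm(X) <= 2.
  move=> c; apply: (grank2_invol_2group _ invX).
  exact: (elt_cent_pgroup (subxx X) pY cY c).
have invY : {in Y, forall x, #[x] = 2 -> x = z} by move=> x Yx; apply/invX/(subsetP sYX).
have caseC : cyclic Y -> {in X, forall a, 2^'.-elt a -> a \in 'C(Y)}.
  move=> cycY a Xa p'a.
  by have := cyclic_pgroup_cent (isT : prime 2) pY cycY (subsetP nYX _ Xa) p'a.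
have [cycY | [r [s [Yr /setDP[Ys nrs] [i2 r4] o4 _]]]] := invol_2group pY invY; first exact/case1/caseC.
have [/forall_inP c | /forall_inPn[a Xa]] := boolP [forall (a | a \in X), (2^'.-elt a) ==> (a \in 'C(Y))].
  by apply: case1 => a Xa; apply/implyP/c.
rewrite negb_imply => /andP[p'a nca]; have nYa := subsetP nYX a Xa.
have A y : y \in Y -> #|Y : <[y]>| = 2 -> y ^ a \notin <[y]>.
  by move=> Yy iy; apply: contra nca; apply: norm_cyclic_index2_cent.
(* [r ^ a] lies outside [<[r]>], where all elements have order 4. *)
have r4' : #[r] = 4.
  by rewrite -(orderJ r a) o4 // inE A // memJ_norm.
have oY : #|Y| = 8 by rewrite -(Lagrange (_ : <[r]> \subset Y)) ?cycle_subG // i2 -orderE r4'.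
have gen4 (M : {group gT}) y : y \in Y -> #[y] = 4 -> y \in M -> a \in M -> Y \subset M.
  move=> Yy oy My Ma; have iy : #|Y : <[y]>| = 2 by rewrite -divgS ?cycle_subG // -orderE oy oY.
  have <- : (M :&: Y)%G :=: Y; last exact: subsetIl.
  apply: (index2_full iy _ (subsetIr _ _) (_ : y ^ a \in _)); rewrite ?A //.
    by rewrite cycle_subG inE My.
  by rewrite inE groupJ // memJ_norm.
have [S sylS] := Sylow_exists 2 X.
have pS := pHall_pgroup sylS; have sSX := pHall_sub sylS.
have sub_S (K : {group gT}) : 2.-group K -> K <| X -> K \subset S.
  by move=> pK nK; rewrite (subset_trans _ (pcore_sub_Hall sylS)) // pcore_max.
have sYS := sub_S _ pY nsYX.
have invS : {in S, forall x, #[x] = 2 -> x = z} by move=> x Sx; apply/invX/(subsetP sSX).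
have [cycS | [w [s' [Sw _ [iw w4] _ invw]]]] := invol_2group pS invS.
  by case/negP: nca; apply: caseC (cyclicS sYS cycS) a Xa p'a.
have [t Yt nwt] : exists2 t, t \in Y & t \notin <[w]>.
  apply/subsetPn; apply: contra nca => sYw.
  by apply: caseC (cyclicS sYw (cycle_cyclic w)) a Xa p'a.
(* [t] inverts [w], so [[~ w, t]] is [w ^- 2], and it lies in the normal subgroup [Y]. *)
have Yw2 : w ^+ 2 \in Y.
  have : [~ w, t] \in Y by rewrite commgEr groupM // memJ_norm ?groupV // (subsetP nYX) // (subsetP sSX).
  by rewrite commgEl (invw _ _ (cycle_id w)) ?inE ?nwt ?(subsetP sYS) // -invMg groupV.
pose M := <<[set a; w]>>%G.
have Ma : a \in M by rewrite mem_gen ?set21.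
have Mw : w \in M by rewrite mem_gen ?set22.
have sMX : M \subset X by rewrite gen_subG subUset !sub1set Xa (subsetP sSX).
have oY4 y : y \in Y -> #[y] %| 4.
  move=> Yy; have [ry | nry] := boolP (y \in <[r]>); first by rewrite -r4' order_dvdG.
  by rewrite o4 // inE nry.
have sSM : S \subset M.
  have oS : #|S| = (#[w] * 2)%N by rewrite -(Lagrange (_ : <[w]> \subset S)) ?cycle_subG // iw.
  have [w8 | w4'] : #[w] = 8 \/ #[w] = 4.
    have := oY4 _ Yw2; rewrite orderXdiv; last exact: dvdn_trans w4.
    case/dvdnP: w4 => k ->; rewrite -[4]/(2 * 2)%N mulnA mulnK // dvdn_pmul2r // => k2.
    by have [_ /(_ k k2)/orP[]/eqP->] := primeP (isT : prime 2); [right | left].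
  - have sYM : Y \subset M by apply: (gen4 M _ Yw2); rewrite ?(groupX _ Mw) // orderXdiv w8.
    have iY : #|S : Y| = 2 by rewrite -divgS // oS w8 oY.
    have <- : (M :&: S)%G :=: S; last exact: subsetIl.
    apply: (index2_full iY _ (subsetIr _ _) (_ : w \in _)).
    + by rewrite subsetI sYM.
    + by rewrite inE Mw.
    by apply/negP=> /oY4; rewrite w8.
  have SY : S :=: Y by apply/esym/eqP; rewrite eqEcard sYS oS w4' oY.
  by rewrite SY (@gen4 M w) // -SY.
(* [X] permutes the four cosets of [<[z]>] in [Y], and the kernel is a 2-group: an element of odd
   order in it fixes [<[r]>]. So this odd index divides 4!. *)
have nsX3 : #|X : S| %| 3.
  have o2 : #[r ^+ 2] = 2 by rewrite orderXdiv r4'.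
  have zr : r ^+ 2 = z by rewrite (invX _ o2) // groupX // (subsetP sYX).
  have Yz : z \in Y by rewrite -zr groupX.
  have oz : #[z] = 2 by rewrite -zr.
  have szY : <[z]> \subset Y by rewrite cycle_subG.
  have zX x : x \in X -> <[z]> :^ x = <[z]>.
    by move=> Xx; rewrite -cycleJ (invX (_ : z ^ x \in X)) ?orderJ // groupJ // (subsetP sYX).
  have actS : [acts X, on rcosets <[z]> Y | 'Js].
    apply/subsetP=> x Xx; rewrite !inE /=; apply/subsetP=> _ /rcosetsP[u Yu ->].
    rewrite inE /= conjsMg zX // conjg_set1; apply/rcosetsP; exists (u ^ x) => //.
    by rewrite memJ_norm // (subsetP nYX).
  pose K := 'C_X(rcosets <[z]> Y | 'Js)%G.
  have nsKX : K <| X by apply: normalGI actS (astab_normal _ _).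
  have pK : 2.-group K.
    apply: (elt_cent_pgroup (normal_sub nsKX) pY cY) => k /setIP[Xk /astabP cK] p'k.
    apply: (norm_cyclic_index2_cent pY Yr i2) => //; first exact: (subsetP nYX).
    have /cK/= e : <[z]> :* r \in rcosets <[z]> Y by apply/rcosetsP; exists r.
    have : r ^ k \in <[z]> :* r by rewrite -e memJ_conjg rcoset_refl.
    by case/rcosetP=> u uz ->; rewrite groupM ?cycle_id // (subsetP _ u uz) // cycle_subG -zr mem_cycle.
  have := dvdn_trans (indexgS _ (sub_S _ pK nsKX)) (index_astab_dvd_fact actS).
  have -> : #|rcosets <[z]> Y| = 4 by rewrite -/(indexg _ _) -divgS // oY -orderE oz.
  rewrite -[4`!]/(8 * 3)%N Gauss_dvdr // coprime_sym (coprimeXl 3 (_ : coprime 2 _)) //.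
  by case/and3P: sylS => _ _ /(pnat_coprime (pnat_id (isT : prime 2))).
apply/grank_le2P; exists a, w; apply/eqP; rewrite eq_sym eqEsubset sMX /= -indexg_eq1.
have := nsX3; rewrite -(Lagrange_index sMX sSM).
have nMS : #|M : S| != 1%N.
  rewrite indexg_eq1; apply: contra nca => /subsetP/(_ a Ma) Sa.
  by rewrite (p'elt_pgroup1 pS p'a Sa) group1.
have [_ h] := primeP (isT : prime 3); case/h/orP; rewrite ?muln_eq1 ?(negPf nMS) ?andbF //.
move=> /eqP e; have /h/orP[/eqP m1 | /eqP m3] : #|M : S| %| 3 by rewrite -e dvdn_mull.
  by rewrite m1 in nMS.
by move: e; rewrite m3; case: #|X : M| => [|[|]].
Qed.
End SolvableCore.

Theorem grank2_solvable (gT : finGroupType) (G : {group gT}) z :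
  solvable G -> odd_cyclic_Sylow G -> {in G, forall x, #[x] = 2 -> x = z} -> 'm(G) <= 2.
Proof.
move=> solG cycG invG; pose N := 'O_2^'(G)%G.
have pN : 2^'.-group N := pcore_pgroup _ _.
have nsNG : N <| G := pcore_normal _ _.
apply: (@grank2_lift _ _ N) => //; first by rewrite odd_2'nat.
apply: (@grank2_core1 _ (G / N)%G (coset N z)); first exact: quotient_sol; last exact: trivg_pcore_quotient.
move=> _ /morphimP[x Nx Gx ->] /= ox.
(* The 2-part of [x] has the same image, and its square is a 2-element of the odd group [N]; so the
   involution lifts to an involution. *)
have Gx2 : x.`_2 \in G by rewrite groupX.
have Nx2 : x.`_2 \in 'N(N) by rewrite groupX.
have cx2 : coset N x = coset N x.`_2.
  by rewrite -[RHS]/(coset_morphism N _) morph_constt // constt_p_elt //= /p_elt /= ox.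
rewrite cx2 (invG _ Gx2) //; apply: nt_prime_order => //.
  apply: (p'elt_pgroup1 pN); first by rewrite /p_elt pnatNK; apply/p_eltX/p_elt_constt.
  apply: coset_idr; first exact: groupX.
  by rewrite morphX //= -cx2; apply/eqP; rewrite -order_dvdn ox.
by apply/eqP=> x1; move: ox; rewrite cx2 x1 morph1 order1.
Qed.

(** * Perfect subgroups *)

Lemma fpf_odd_cyclic_Sylow (gT : finGroupType) (R : unitRingType) (f : gT -> R) (G : {group gT}) :
  fpf_repr f -> odd_cyclic_Sylow G.
Proof.
move=> fpf p S p_odd sylS; have pS := pHall_pgroup sylS.
have [p_pr | np] := boolP (prime p); last first.
  have := card_Hall sylS; rewrite p_part lognE (negPf np) expn0 => /eqP.
  by rewrite -trivg_card1 => /eqP->; apply: cyclic1.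
rewrite (odd_pgroup_rank1_cyclic pS); last first.
  by have [n ->] := p_natP pS; rewrite oddX p_odd orbT.
have [E /pnElemP[_ abE dE]] := p_rank_witness p S.
have cE := fpf_abelian_cyclic fpf (abelem_abelian abE).
have [E1 | ntE] := eqVneq (E : {set gT}) 1; first by rewrite -dE E1 cards1 logn1.
by rewrite -dE (cyclic_abelem_prime abE cE ntE) logn_prime // eqxx.
Qed.

Section PerfectSubgroup.

Variables (gT : finGroupType) (R : unitRingType) (f : gT -> R) (z : gT).
Hypotheses (fpf : fpf_repr f) (oz : #[z] = 2).

Let invU x : #[x] = 2 -> x = z := @fpf_invol_uniq _ _ _ fpf z oz x.
Let zC x : commute z x := fpf_invol_comm fpf oz x.
Let zJ x : z ^ x = z.
Proof. by rewrite conjgE zC mulKg. Qed.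

Lemma exists_order4 (U : {group gT}) : 4 %| #|U| -> exists2 u, u \in U & #[u] = 4.
Proof.
move=> U4; have [S sylS] := Sylow_exists 2 U.
have l2 : 2 <= logn 2 #|S|.
  by rewrite (card_Hall sylS) logn_part -pfactor_dvdn.
have [Q [sQS _ oQ]] := normal_pgroup (pHall_pgroup sylS) (normal_refl S) l2.
have /cyclicP[u defQ] : cyclic Q by apply: (fpf_abelian_cyclic fpf); apply: (card_p2group_abelian (isT : prime 2)).
exists u; last by rewrite orderE -defQ oQ.
by rewrite (subsetP (pHall_sub sylS)) // (subsetP sQS) // defQ cycle_id.
Qed.

Lemma order4_sqr u : #[u] = 4 -> u ^+ 2 = z.
Proof. by move=> ou; apply: invU; rewrite orderXdiv ou. Qed.

Lemma order4_inv u : #[u] = 4 -> u^-1 = z * u.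
Proof.
by move=> ou; rewrite invg_expg ou -(order4_sqr ou) -expgSr.
Qed.

Variable P : {group gT}.
Hypotheses (perfP : P \subset P^`(1)) (ntP : P :!=: 1).

Lemma perfect_Sylow2_quat : exists S : {group gT}, 2.-Sylow(P) S /\
  exists r s, [/\ r \in S, s \in S :\: <[r]>, #|S : <[r]>| = 2 /\ 4 %| #[r],
    {in S :\: <[r]>, forall t, #[t] = 4}
    & {in <[r]> & S :\: <[r]>, forall x t, x ^ t = x^-1}].
Proof.
have [S sylS] := Sylow_exists (pdiv #|P|) P.
have ncS := perfect_pdiv_Sylow perfP ntP sylS.
have p2 : pdiv #|P| = 2.
  have [//|p_odd] : pdiv #|P| = 2 \/ odd (pdiv #|P|) by apply/even_prime/pdiv_prime; rewrite cardG_gt1.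
  by case/negP: ncS; apply: fpf_odd_cyclic_Sylow fpf _ _ p_odd sylS.
rewrite p2 in sylS; exists S; split=> //.
by case: (invol_2group (pHall_pgroup sylS) (fun x _ => @invU x)) ncS => [->|].
Qed.

Lemma perfect_order4_pair : exists v s, [/\ v \in P, s \in P, #[v] = 4, #[s] = 4 & ~ commute v s].
Proof.
have [S [sylS [r [s [Sr nSs [i2 r4] o4 invr]]]]] := perfect_Sylow2_quat.
have sSP := subsetP (pHall_sub sylS).
have /dvdnP[k rk] := r4.
have k_gt0 : 0 < k by case: k rk (order_gt0 r) => // ->.
have ov : #[r ^+ k] = 4 by rewrite orderXdiv rk ?mulKn // dvdn_mulr.
exists (r ^+ k), s; split; [by rewrite groupX ?sSP | by case/setDP: nSs => Ss _; apply: sSP | by [] | exact: o4 | ].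
move/commgP/conjg_fixP; rewrite invr ?mem_cycle // => /eqP.
by rewrite eq_invg_mul -[_ * _]/(_ ^+ 2) -order_dvdn ov.
Qed.

(** Elements of order 4 that commute with [u] are [u] and its inverse, but [P] contains two of order
    4 that do not commute. *)
Lemma perfect_not_cent_order4 u : #[u] = 4 -> ~~ (P \subset 'C[u]).
Proof.
move=> ou; apply/negP=> /subsetP cu.
have [v [s [Pv Ps ov os ncvs]]] := perfect_order4_pair.
have cuv : commute v u by apply/cent1P/cu.
have cus : commute s u by apply/cent1P/cu.
apply: ncvs; have [-> | ->] := fpf_order4_comm fpf oz ou ov (commute_sym cuv).
  exact: commute_sym.
by apply/commute_sym/commuteV.
Qed.

Lemma perfect_norm_order4 u : #[u] = 4 -> ~~ (P \subset 'N(<[u]>)).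
Proof.
move=> ou; apply/negP=> nP; case/negP: (perfect_not_cent_order4 ou).
by rewrite -cent_cycle (perfect_norm_abelian_aut perfP nP) // Aut_cycle_abelian.
Qed.

(** [L] has at most three Sylow 2-subgroups, so [P] normalises one, [U] of order 8. It then fixes
    the four cosets of [<[z]>] in [U], hence normalises a cyclic subgroup of order 4. *)
Lemma perfect_not_norm24 (L : {group gT}) :
    P \subset 'N(L) -> z \in L -> #|L| = 24 -> False.
Proof.
move=> nLP Lz oL.
have actS : [acts P, on 'Syl_2(L) | 'JG].
  apply/subsetP=> x Px; rewrite !inE /=; apply/subsetP=> Q; rewrite !inE /= => sylQ.
  by rewrite -(normsP nLP x Px) pHallJ2.
have [U sylU] := Sylow_exists 2 L.
have oU : #|U| = 8 by rewrite (card_Hall sylU) oL p_part -[logn 2 24]/3.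
have S4 : #|'Syl_2(L)| <= 4.
  rewrite (card_Syl sylU); apply: leq_trans (_ : 3 <= 4); last by [].
  apply: dvdn_leq => //; apply: dvdn_trans (indexgS L (_ : U \subset 'N_L(U))) _.
    by rewrite subsetI (pHall_sub sylU) normG.
  by rewrite -divgS ?(pHall_sub sylU) // oL oU.
have nUP : P \subset 'N(U).
  have cP := perfect_act_small perfP actS S4.
  apply/normsP=> x Px; have /astabP/(_ U) := subsetP cP x Px.
  by rewrite inE => /(_ sylU)/(congr1 val).
have pU := pHall_pgroup sylU.
have Uz : z \in U.
  have /(Cauchy (isT : prime 2))[u Uu ou] : 2 %| #|U| by rewrite oU.
  by rewrite -(invU ou).
have szU : <[z]> \subset U by rewrite cycle_subG.
have zX x : <[z]> :^ x = <[z]> by rewrite -cycleJ zJ.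
have actR : [acts P, on rcosets <[z]> U | 'Js].
  apply/subsetP=> x Px; rewrite !inE /=; apply/subsetP=> _ /rcosetsP[u Uu ->].
  rewrite inE /= conjsMg zX conjg_set1; apply/rcosetsP; exists (u ^ x) => //.
  by rewrite memJ_norm // (subsetP nUP).
have oR : #|rcosets <[z]> U| = 4 by rewrite -/(indexg _ _) -divgS // oU -orderE oz.
have [u Uu ou] : exists2 u, u \in U & #[u] = 4 by apply: exists_order4; rewrite oU.
case/negP: (perfect_norm_order4 ou); apply/subsetP=> x Px.
have cP := perfect_act_small perfP actR; rewrite oR in cP.
have /astabP/(_ (<[z]> :* u)) e := subsetP (cP isT) x Px.
rewrite -cycle_subG norms_cycle.
have : u ^ x \in <[z]> :* u.
  rewrite -e; first by rewrite /= memJ_conjg rcoset_refl.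
  by apply/rcosetsP; exists u.
case/rcosetP=> t tz ->; rewrite groupM ?cycle_id // (subsetP _ t tz) // cycle_subG.
by rewrite -(order4_sqr ou) mem_cycle.
Qed.

(** The subgroup of order 3 is then unique, and [P] centralises it. If a 3'-element [n] moved [t] in
    a cyclic Sylow 3-subgroup, it would invert [[~ t, n]], hence also an element of order 3. So the
    Sylow subgroup is central in its normaliser, which the transfer forbids. *)
Lemma perfect_not_comm_order3 :
    3 %| #|P| -> (forall x y, x \in P -> y \in P -> #[x] = 3 -> #[y] = 3 -> commute x y) -> False.
Proof.
move=> P3 c3; have [x Px ox] := Cauchy (isT : prime 3) P3.
have nxP : P \subset 'N(<[x]>).
  apply/subsetP=> y Py; rewrite -cycle_subG norms_cycle.
  have oxy : #[x ^ y] = 3 by rewrite orderJ.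
  have [->|->] := fpf_order3_comm fpf ox oxy (c3 _ _ Px (groupJ Px Py) ox oxy); by rewrite ?groupV cycle_id.
have cxP : P \subset 'C[x].
  by rewrite -cent_cycle (perfect_norm_abelian_aut perfP nxP) // Aut_cycle_abelian.
have [T sylT] := Sylow_exists 3 P; have pT := pHall_pgroup sylT.
have sTP := subsetP (pHall_sub sylT).
have cycT : cyclic T := fpf_odd_cyclic_Sylow fpf (isT : odd 3) sylT.
have abT := cyclic_abelian cycT.
have T1 : T :=: 1.
  apply: (perfect_Sylow perfP sylT abT); apply: (Sylow_sub_cent sylT abT) => n /setIP[Pn Nn] p'n.
  have := cyclic_pgroup_cent (isT : prime 3) pT cycT Nn p'n => cn2.
  apply/centP=> t Tt; apply/commute_sym/commgP; pose w := [~ t, n].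
  have Tw : w \in T by rewrite /w commgEl groupM ?groupV // memJ_norm.
  have wn : w ^ n = w^-1.
    rewrite /w commgEl conjMg -conjgM conjVg (invMg t^-1) invgK -[n * n]/(n ^+ 2).
    congr (_ * _); exact/conjg_fixP/commgP/commute_sym/(centP cn2).
  apply: contraT => ntw; have pw : 3.-group <[w]> by apply: pgroupS pT; rewrite cycle_subG.
  have ntcw : <[w]> != 1 by rewrite cycle_eq1.
  have [_ /(Cauchy (isT : prime 3))[y wy oy] _] := pgroup_pdiv pw ntcw.
  have Ty : y \in T by move: y wy {oy}; apply/subsetP; rewrite cycle_subG.
  have yn : y ^ n = y^-1 by case/cycleP: wy => i ->; rewrite conjXg wn expgVn.
  have cxy := c3 _ _ Px (sTP y Ty) ox oy.
  have cny : commute n y.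
    have cnx : commute n x by apply/cent1P/(subsetP cxP).
    by have [->|->] := fpf_order3_comm fpf ox oy cxy; last apply: commuteV.
  have: y ^ n = y by apply/conjg_fixP/commgP/commute_sym.
  move/eqP; rewrite yn eq_invg_mul -[_ * _]/(_ ^+ 2) -order_dvdn oy //.
have := card_Hall sylT; rewrite T1 cards1 => /esym/eqP.
by rewrite p_part_eq1 mem_primes P3 cardG_gt0.
Qed.

(** Otherwise the transfer into [<[r]>] would map [u] to [z], while a perfect group has only trivial
    abelian images. *)
Lemma perfect_order4_conj (S : {group gT}) r :
    2.-Sylow(P) S -> r \in S -> #|S : <[r]>| = 2 -> 4 %| #[r] ->
  forall u, u \in P -> #[u] = 4 -> exists2 g, g \in P & u ^ g \in <[r]>.
Proof.
move=> sylS Sr i2 r4 u Pu ou; apply/exists_inP; apply: contraT; rewrite negb_exists_in => /forall_inP nr.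
have sSP := pHall_sub sylS; have srP : <[r]> \subset P by rewrite cycle_subG (subsetP sSP).
have rz : z \in <[r]>.
  have /(Cauchy (isT : prime 2))[x rx ox] : 2 %| #|<[r]>| by apply: dvdn_trans r4.
  by rewrite -(invU ox).
have zP : z \in 'Z(P).
  by rewrite inE (subsetP srP) //; apply/centP=> x _; apply: zC.
have iP : #|P : <[r]>| = (2 * #|P : S|)%N.
  by rewrite -(@Lagrange_index _ P S <[r]>) ?cycle_subG // i2 mulnC.
have oddi : odd #|P : S| by rewrite odd_2'nat; case/and3P: sylS.
have [V [imV Vu Vz]] := transfer_involution srP (cycle_abelian r) rz zP oz Pu (order4_sqr ou) nr iP oddi.
have := perfect_hom perfP (abelianS imV (cycle_abelian r)) Pu.
by rewrite Vu => z1; have := oz; rewrite z1 order1.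
Qed.

Lemma order4_cyclic_eq (r u v : gT) : #[u] = 4 -> #[v] = 4 -> u \in <[r]> -> v \in <[r]> -> <[u]> = <[v]>.
Proof.
move=> ou ov ru rv; apply/eqP; rewrite (eq_subG_cyclic (cycle_cyclic r)) ?cycle_subG //.
by rewrite -!orderE ou ov.
Qed.

Lemma order4_comm_mem (u w : gT) : #[u] = 4 -> #[w] = 4 -> commute u w -> w \in <[u]>.
Proof. by move=> ou ow cuw; have [->|->] := fpf_order4_comm fpf oz ou ow cuw; rewrite ?groupV cycle_id. Qed.

Lemma order4_mem (u w : gT) : #[u] = 4 -> #[w] = 4 -> w \in <[u]> -> w = u \/ w = u^-1.
Proof.
move=> ou ow uw; apply: (fpf_order4_comm fpf oz ou ow).
by case/cycleP: uw => k ->; apply: commuteX.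
Qed.

(** * Quaternion subgroups of order 8 *)

Section Quaternion8.
Variables (Q : {group gT}) (i j : gT).
Hypotheses (oQ : #|Q| = 8) (Qi : i \in Q) (Qj : j \in Q) (ncij : ~ commute i j).

Lemma quat8_order4 u : u \in Q -> u \notin <[z]> -> #[u] = 4.
Proof.
move=> Qu nzu; have := order_dvdG Qu; rewrite oQ.
have n1 : #[u] != 1%N by rewrite order_eq1; apply: contraNneq nzu => ->; apply: group1.
have n2 : #[u] != 2 by apply: contraNneq nzu => /invU->; apply: cycle_id.
have n8 : #[u] != 8.
  apply/eqP=> ou; apply: ncij; have defQ : <[u]> :=: Q.
    by apply/eqP; rewrite eqEcard cycle_subG Qu -orderE ou oQ.
  by apply: (centsP (cycle_abelian u)); rewrite defQ.
rewrite dvdn_divisors // -[divisors 8]/[:: 1; 2; 4; 8]%N !inE.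
by rewrite (negPf n1) (negPf n2) (negPf n8) orbF => /eqP.
Qed.

Lemma quat8_nz u : #[u] = 4 -> u \notin <[z]>.
Proof. by move=> ou; apply/negP=> /order_dvdG; rewrite -orderE oz ou. Qed.

Lemma quat8_index u : u \in Q -> #[u] = 4 -> #|Q : <[u]>| = 2.
Proof. by move=> Qu ou; rewrite -divgS ?cycle_subG // -orderE ou oQ. Qed.

Lemma order4_z u : #[u] = 4 -> z \in <[u]>.
Proof. by move=> ou; rewrite -(order4_sqr ou) mem_cycle. Qed.

Lemma quat8_norm u : u \in Q -> #[u] = 4 -> Q \subset 'N(<[u]>).
Proof.
move=> Qu ou; have [//|_ ->//] := andP (index2_normal (_ : <[u]> \subset Q) (quat8_index Qu ou)).
by rewrite cycle_subG.
Qed.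

Lemma quat8_inv u w : u \in Q -> w \in Q -> #[u] = 4 -> #[w] = 4 -> w \notin <[u]> -> u ^ w = u^-1.
Proof.
move=> Qu Qw ou ow nuw; have ouw : #[u ^ w] = 4 by rewrite orderJ.
have : u ^ w \in <[u]> by rewrite memJ_norm ?cycle_id // (subsetP (quat8_norm Qu ou)).
case/(order4_mem ou ouw) => // /conjg_fixP/commgP cuw.
by case/negP: nuw; apply: order4_comm_mem.
Qed.

Lemma quat8_cover u w x : u \in Q -> w \in Q -> #[u] = 4 -> #[w] = 4 -> w \notin <[u]> ->
  x \in Q -> [|| x \in <[u]>, x \in <[w]> | x \in <[u * w]>].
Proof.
move=> Qu Qw ou ow nuw Qx; have [//|nux] := boolP (x \in <[u]>).
have suQ : <[u]> \subset Q by rewrite cycle_subG.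
have : x \in Q :\: <[u]> by rewrite inE nux.
have Dw : w \in Q :\: <[u]> by rewrite inE nuw.
rewrite -(rcoset_index2 suQ (quat8_index Qu ou) Dw) => /rcosetP[c uc ->].
have nz : u * w \notin <[z]>.
  apply: contra nuw => zuw; rewrite -(groupMl w (cycle_id u)).
  by apply: (subsetP _ _ zuw); rewrite cycle_subG order4_z.
have ouw := quat8_order4 (groupM Qu Qw) nz.
have [zc | nzc] := boolP (c \in <[z]>).
  by rewrite groupM ?cycle_id ?(subsetP _ _ zc) ?cycle_subG ?order4_z //= orbT.
have szu : <[z]> \subset <[u]> by rewrite cycle_subG order4_z.
have izu : #|<[u]> : <[z]>| = 2 by rewrite -divgS // -!orderE oz ou.
have : c \in <[u]> :\: <[z]> by rewrite inE nzc.
have Du : u \in <[u]> :\: <[z]> by rewrite inE cycle_id andbT quat8_nz.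
rewrite -(rcoset_index2 szu izu Du) => /rcosetP[t zt ->].
rewrite -mulgA [t * _ \in <[u * w]>]groupM ?cycle_id ?orbT //.
by apply: (subsetP _ _ zt); rewrite cycle_subG order4_z.
Qed.

(** A factor [q] in [Q] corrects [w] so that it centralises [i] and [j]. The product has no power of
    order 4, since that would be [i] or its inverse and commute with [j]; so it lies in [<[z]>]. *)
Lemma quat8_cent w : i \notin <[z]> -> j \notin <[z]> -> i ^ w \in <[i]> -> j ^ w \in <[j]> -> 2.-elt w ->
   w \in 'N(Q) -> w \in Q.
Proof.
move=> nzi nzj iw jw p2w NQw.
have oi := quat8_order4 Qi nzi; have oj := quat8_order4 Qj nzj.
have oiw : #[i ^ w] = 4 by rewrite orderJ.
have ojw : #[j ^ w] = 4 by rewrite orderJ.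
have nij : j \notin <[i]>.
  by apply/negP=> /cycleP[k jk]; apply: ncij; rewrite jk; apply: commuteX.
have nji : i \notin <[j]>.
  by apply/negP=> /cycleP[k ik]; apply: ncij; rewrite ik; apply/commute_sym/commuteX.
have ij := quat8_inv Qi Qj oi oj nij; have ji := quat8_inv Qj Qi oj oi nji.
have ijV : i^-1 ^ j^-1 = i by rewrite -ij conjgK.
have jiV : j^-1 ^ i^-1 = j by rewrite -ji conjgK.
have jj : j ^ j^-1 = j by apply/conjg_fixP/commgP/commuteV.
have ii : i ^ i^-1 = i by apply/conjg_fixP/commgP/commuteV.
have [q Qq [ciq cjq]] : exists2 q, q \in Q & i ^ (w * q) = i /\ j ^ (w * q) = j.
  have [iw'|iw'] := order4_mem oi oiw iw; have [jw'|jw'] := order4_mem oj ojw jw.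
  - by exists 1; rewrite ?group1 // mulg1.
  - by exists i^-1; rewrite ?groupV // !conjgM iw' jw'.
  - by exists j^-1; rewrite ?groupV // !conjgM iw' jw'.
  exists (j^-1 * i^-1); first by rewrite groupM ?groupV.
  by rewrite !conjgM iw' jw' ijV ii conjVg jj jiV.
have pQ : 2.-group Q by rewrite /pgroup oQ.
have Qc : w * q \in Q.
  have pc : 2.-elt (w * q).
    have p2 : 2.-group (Q <*> <[w]>).
      rewrite norm_joinEr ?cycle_subG // pgroupM pQ //.
    by apply: (mem_p_elt p2); rewrite groupM // mem_gen // inE ?cycle_id ?Qq ?orbT.
  have [c4 | nc4] := boolP (4 %| #[w * q]).
    have [k kc] := dvdnP c4; have k_gt0 : 0 < k by case: k kc (order_gt0 (w * q)) => // ->.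
    have oc : #[(w * q) ^+ k] = 4 by rewrite orderXdiv kc ?mulKn // dvdn_mulr.
    have /(order4_mem oi oc) : (w * q) ^+ k \in <[i]>.
      by apply: order4_comm_mem => //; apply/commuteX/commgP/conjg_fixP.
    have cjk : commute j ((w * q) ^+ k) by apply/commuteX/commgP/conjg_fixP.
    case=> e; case: ncij; rewrite e in cjk; first exact: commute_sym.
    by apply/commute_sym; rewrite -[i]invgK; apply: commuteV.
  have [n on] := p_natP pc; have : n <= 1.
    by rewrite leqNgt; apply: contra nc4 => n2; rewrite on (dvdn_exp2l 2 n2).
  case: n on => [|[|//]] on _; first by move/eqP: on; rewrite order_eq1 => /eqP->; apply: group1.
  by rewrite (invU on) (subsetP _ _ (order4_z oi)) // cycle_subG.
by rewrite -(mulgK q w) groupM ?groupV.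
Qed.

End Quaternion8.

(* If [S] is larger than [Q], a Sylow 2-subgroup of the normaliser of [<[i]>] contains some [w]
   normalising [Q] but not in [Q]; if [w] fixed [<[j]>] it would be inner on [Q]. *)
Lemma quat8_swap (Q : {group gT}) (i j : gT) (S : {group gT}) :
    #|Q| = 8 -> Q \subset P -> i \in Q -> j \in Q -> ~ commute i j ->
    2.-Sylow(P) S -> 8 < #|S| -> (exists2 g, g \in P & S :^ g \subset 'N(<[i]>)) ->
    i \notin <[z]> -> j \notin <[z]> ->
  exists2 w, w \in 'N_P(Q) & w \in 'N(<[i]>) /\ j ^ w \notin <[j]>.
Proof.
move=> oQ sQP Qi Qj ncij sylS oS [g Pg nSg] nzi nzj.
have oi := quat8_order4 oQ Qi Qj ncij Qi nzi.
have pQ : 2.-group Q by rewrite /pgroup oQ.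
have sQN : Q \subset 'N_P(<[i]>) by rewrite subsetI sQP (quat8_norm oQ Qi).
have [S1 sylS1 sQS1] := Sylow_superset sQN pQ.
have oS1 : 8 < #|S1|.
  apply: leq_trans oS _; rewrite (card_Hall sylS1) -(cardJg S g).
  rewrite -(part_pnat_id (_ : 2.-nat #|S :^ g|)); last by rewrite cardJg; apply: (pHall_pgroup sylS).
  rewrite dvdn_leq ?partn_gt0 // partn_dvd ?cardG_gt0 // (cardSg (_ : (S :^ g)%G \subset _)) //.
  by rewrite subsetI nSg -(conjGid Pg) conjSg (pHall_sub sylS).
have pS1 := pHall_pgroup sylS1.
have prQ : Q \proper S1 by rewrite properEcard sQS1 oQ.
have /properP[_ [w /setIP[S1w NQw] nQw]] := nilpotent_proper_norm (pgroup_nil pS1) prQ.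
have /setIP[Pw Niw] := subsetP (pHall_sub sylS1) w S1w.
exists w; first by rewrite inE Pw.
split=> //; apply: contra nQw => jw.
apply: (quat8_cent oQ Qi Qj ncij nzi nzj _ jw _ NQw); last exact: mem_p_elt pS1 S1w.
by rewrite memJ_norm ?cycle_id.
Qed.

(** [N_P(Q)] permutes transitively the three nontrivial cosets of [<[z]>] in a quaternion subgroup
    [Q] of order 8. *)
Lemma perfect_dvd3 : 3 %| #|P|.
Proof.
have [S [sylS [r [s [Sr Ds [i2 r4] o4 invr]]]]] := perfect_Sylow2_quat.
have sSP := pHall_sub sylS; have pS := pHall_pgroup sylS.
have [Ss nrs] := setDP Ds; have os := o4 _ Ds.
have /dvdnP[k rk] := r4.
have k_gt0 : 0 < k by case: k rk (order_gt0 r) => // ->.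
pose v := r ^+ k; have ov : #[v] = 4 by rewrite orderXdiv rk ?mulKn // dvdn_mulr.
have rv : v \in <[r]> by apply: mem_cycle.
have Sv : v \in S by apply: groupX.
have vs : v ^ s = v^-1 by apply: invr.
have ncvs : ~ commute v s.
  move/commgP/conjg_fixP/eqP; rewrite vs.
  by rewrite eq_invg_mul -[_ * _]/(_ ^+ 2) -order_dvdn ov.
have conjv u : u \in P -> #[u] = 4 -> exists2 g, g \in P & <[u]> :^ g = <[v]>.
  move=> Pu ou; have [g Pg ug] := perfect_order4_conj sylS Sr i2 r4 Pu ou.
  by exists g; rewrite // -cycleJ (order4_cyclic_eq _ ov ug rv) ?orderJ.
have nSv : S \subset 'N(<[v]>).
  apply/subsetP=> x Sx; rewrite -cycle_subG norms_cycle.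
  have [rx | nrx] := boolP (x \in <[r]>).
    by rewrite conjgE (centsP (cycle_abelian r) _ rv _ rx) mulKg cycle_id.
  by rewrite invr ?groupV ?cycle_id // inE nrx.
pose Q := (<[v]> <*> <[s]>)%G.
have sQS : Q \subset S by rewrite join_subG !cycle_subG Sv Ss.
have Qv : v \in Q by rewrite mem_gen // inE cycle_id.
have Qs : s \in Q by rewrite mem_gen // inE cycle_id orbT.
have oQ : #|Q| = 8.
  have zv : z \in <[v]> := order4_z ov; have zs : z \in <[s]> := order4_z os.
  have tivs : <[v]> :&: <[s]> = <[z]>.
    apply/eqP; rewrite eqEsubset subsetI !cycle_subG zv zs !andbT.
    apply/subsetP=> x /setIP[vx sx]; apply: contraT => nzx.
    have ox : #[x] = 4.
      have := order_dvdG sx; rewrite -orderE os dvdn_divisors // -[divisors 4]/[:: 1; 2; 4]%N !inE.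
      case/or3P=> /eqP // ox; case/negP: nzx; last by rewrite (invU ox) cycle_id.
      by move/eqP: ox; rewrite order_eq1 => /eqP->; apply: group1.
    case/negP: nrs; rewrite -cycle_subG -(order4_cyclic_eq ox os sx (cycle_id s)) cycle_subG.
    by apply: (subsetP _ _ vx); rewrite cycle_subG.
  have := mul_cardG <[v]> <[s]>; rewrite tivs -!orderE ov os oz.
  rewrite /Q /= norm_joinEr; last by rewrite cycle_subG (subsetP nSv).
  by move/eqP; rewrite -[(4 * 4)%N]/(8 * 2)%N eqn_pmul2r // => /eqP.
have sQP := subset_trans sQS sSP.
have nzv := quat8_nz ov.
have trans u : u \in Q -> #[u] = 4 -> exists2 g, g \in 'N_P(Q) & v ^ g \in <[u]>.
  move=> Qu ou; have Pu := subsetP sQP u Qu.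
  have [oS | oS] := leqP #|S| 8.
    (* Here [S = Q] normalises [<[v]>] and [<[u]>]. As in Burnside's fusion argument, the
       conjugating element is corrected inside the normaliser of [<[v]>] so as to normalise [S]. *)
    have SQ : Q :=: S by apply/eqP; rewrite eqEcard sQS oQ.
    have [g Pg ug] := conjv u Pu ou.
    have sylv : 2.-Sylow('N_P(<[v]>)) S.
      by rewrite (pHall_subl _ (subsetIl _ _) sylS) // subsetI sSP.
    have sylvg : 2.-Sylow('N_P(<[v]>)) (S :^ g).
      have sgN : S :^ g \subset 'N_P(<[v]>).
        rewrite subsetI -{1}(conjGid Pg) conjSg sSP -ug normJ conjSg /= -SQ.
        exact: (quat8_norm oQ).
      by apply: (pHall_subl sgN (subsetIl P _)); rewrite pHallJ.
    have [h /setIP[Ph Nh] Sgh] := Sylow_trans sylvg sylv.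
    exists (g * h)^-1.
      by rewrite groupV !inE groupM //= SQ conjsgM -Sgh.
    have : v \in <[u]> :^ (g * h) by rewrite conjsgM ug (normP Nh) cycle_id.
    by rewrite mem_conjg.
  have [vu | nvu] := boolP (u \in <[v]>).
    by exists 1; rewrite ?group1 // conjg1; have [->|->] := order4_mem ov ou vu; rewrite ?cycleV cycle_id.
  (* For larger [S], an element fixing the third cyclic subgroup [<[v * u]>] and moving [<[v]>] has
     to send [v] into [<[u]>]. *)
  have nc_i : ~ commute (v * u) v.
    move=> c; case/negP: nvu; apply: order4_comm_mem => //; apply/commute_sym.
    by rewrite -(mulKg v u); apply/commute_sym/commuteM; [apply: commuteV | apply: commute_sym].
  have nzi : v * u \notin <[z]>.
    by apply/negP=> /cycleP[m e]; apply: nc_i; rewrite e; apply/commute_sym/commuteX/commute_sym.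
  have Qi := groupM Qv Qu; have oi := quat8_order4 oQ Qi Qv nc_i Qi nzi.
  have [g Pg ig] := conjv _ (subsetP sQP _ Qi) oi.
  have gS : exists2 h, h \in P & S :^ h \subset 'N(<[v * u]>).
    by exists g^-1; rewrite ?groupV // sub_conjg invgK -normJ ig.
  have [w Nw [Niw nvw]] := quat8_swap oQ sQP Qi Qv nc_i sylS oS gS nzi nzv.
  exists w => //; have /setIP[_ NQw] := Nw.
  have Qvw : v ^ w \in Q by rewrite memJ_norm.
  case/or3P: (quat8_cover oQ Qv Qs ncvs Qv Qu ov ou nvu Qvw) => //; first by rewrite (negPf nvw).
  rewrite memJ_norm // => /cycleP[m vm]; case: nc_i; rewrite {2}vm.
  exact: commuteX.
pose N := 'N_P(Q)%G.
have zX x : <[z]> :^ x = <[z]> by rewrite -cycleJ zJ.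
have coJ x u : (<[z]> :* u) :^ x = <[z]> :* (u ^ x) by rewrite conjsMg zX conjg_set1.
have orbE : orbit 'Js N (<[z]> :* v) = rcosets <[z]> Q :\ (<[z]> : {set gT}).
  apply/setP=> B; rewrite !inE; apply/idP/andP => [|[ntB /rcosetsP[u Qu defB]]].
    case/orbitP=> x /setIP[Px Nx] <- /=; rewrite coJ; split.
      apply: contra (quat8_nz (_ : #[v ^ x] = 4)) => [/eqP<-|]; first exact: rcoset_refl.
      by rewrite orderJ.
    by apply/rcosetsP; exists (v ^ x); rewrite // memJ_norm.
  have nzu : u \notin <[z]> by apply: contra ntB => zu; rewrite defB rcoset_id.
  have ou := quat8_order4 oQ Qv Qs ncvs Qu nzu.
  have [g Ng vg] := trans u Qu ou.
  apply/orbitP; exists g => //=; rewrite coJ defB; apply/rcoset_eqP.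
  have ovg : #[v ^ g] = 4 by rewrite orderJ.
  have [->|->] := order4_mem ou ovg vg; first exact: rcoset_refl.
  by rewrite order4_inv // mem_rcoset mulgK cycle_id.
have : #|orbit 'Js N (<[z]> :* v)| = 3.
  have := cardsD1 (<[z]> : {set gT}) (rcosets <[z]> Q); rewrite -orbE.
  have -> : #|rcosets <[z]> Q| = 4 by rewrite -/(indexg _ _) -divgS ?oQ -?orderE ?oz // cycle_subG -(order4_sqr ov) groupX.
  have -> : (<[z]> : {set gT}) \in rcosets <[z]> Q by apply/rcosetsP; exists 1; rewrite ?group1 // rcoset1.
  by case.
rewrite card_orbit => <-; apply: dvdn_trans (dvdn_indexg _ _) (cardSg (subsetIl _ _)).
Qed.

End PerfectSubgroup.

(** * The case of order 120 *)

Section Order120.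

Variables (gT : finGroupType) (R : unitRingType) (f : gT -> R) (z : gT).
Hypotheses (fpf : fpf_repr f) (oz : #[z] = 2).
Variables (L : {group gT}) (A : {set gT}).
Hypotheses (nL : forall x, x \in 'N(L)) (Lz : z \in L) (oL : #|L| = 120).
Hypothesis cardCL : {in L, forall g, g ^+ 2 != 1 -> #|'C_L[g]| \in [:: 4; 6; 10]}.
Hypotheses (genL : L :=: <<z |: A>>) (oddA : {in A, forall x, odd #[x]}).

Let invU x : #[x] = 2 -> x = z := @fpf_invol_uniq _ _ _ fpf z oz x.
Let zC x : commute z x := fpf_invol_comm fpf oz x.

Lemma no_index2 (H : {group gT}) : H \subset L -> #|L : H| = 2 -> False.
Proof.
move=> sHL i2; suff sLH : L \subset H by rewrite (eqP (_ : #|L : H| == 1%N)) ?indexg_eq1 in i2.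
rewrite genL gen_subG subUset sub1set; apply/andP; split.
  have oH : #|H| = 60 by have := Lagrange sHL; rewrite i2 oL; move/eqP; rewrite -[120]/(60 * 2)%N eqn_pmul2r // => /eqP.
  have /(Cauchy (isT : prime 2))[x Hx ox] : 2 %| #|H| by rewrite oH.
  by rewrite -(invU ox).
apply/subsetP=> a Aa; have La : a \in L by rewrite genL mem_gen // inE Aa orbT.
apply: contraT => nHa; have D : a \in L :\: H by rewrite inE nHa.
have : a^-1 \in L :\: H by rewrite inE !groupV nHa.
rewrite -(rcoset_index2 sHL i2 D) mem_rcoset -invMg groupV => Ha2.
have : a \in <[a ^+ 2]>.
  have := generator_coprime a 2; rewrite coprimen2 oddA // => /eqP <-; exact: cycle_id.
have s2H : <[a ^+ 2]> \subset H by rewrite cycle_subG.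
by move/(subsetP s2H); rewrite (negPf nHa).
Qed.

Lemma order5_cent c : c \in L -> #[c] = 5 -> #|'C_L[c]| = 10.
Proof.
move=> Lc oc; have Cc : c \in 'C_L[c] by rewrite inE Lc cent1id.
have := order_dvdG Cc; rewrite oc.
have := cardCL Lc; rewrite -order_dvdn oc => /(_ isT); rewrite !inE.
by case/or3P=> /eqP->.
Qed.

Lemma order5_Sylow (M : {group gT}) c : M \subset L -> c \in M -> #[c] = 5 -> 5.-Sylow(M) <[c]>.
Proof.
move=> sML Mc oc; have s : 5.-Sylow(L) <[c]>.
  rewrite pHallE cycle_subG (subsetP sML) // -orderE oc oL.
  by rewrite p_part -[logn 5 120]/1%N.
by rewrite (pHall_subl _ sML s) // cycle_subG.
Qed.

Lemma card_Syl5_dvd (n : nat) : n %| 120 -> n %% 5 = 1%N -> n = 1%N \/ n = 6.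
Proof.
rewrite dvdn_divisors // => d m; have : all (fun k => (k %% 5 == 1%N) ==> (k \in [:: 1; 6]%N)) (divisors 120) by [].
by move/allP/(_ n d); rewrite m /= !inE => /orP[] /eqP; [left | right].
Qed.

Lemma Syl5_dvd (M : {group gT}) c c' : M \subset L -> c \in M -> c' \in M -> #[c] = 5 -> #[c'] = 5 -> c' \notin <[c]> ->
  #|'Syl_5(M)| = 6.
Proof.
move=> sML Mc Mc' oc oc' nc.
have d : #|'Syl_5(M)| %| 120.
  by rewrite -oL; apply: dvdn_trans (cardSg sML); apply: card_Syl_dvd.
have [c1 | //] := card_Syl5_dvd d (card_Syl_mod M (isT : prime 5)).
case/cards1P: (introT eqP c1) => Q Q1.
have s := order5_Sylow sML Mc oc; have s' := order5_Sylow sML Mc' oc'.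
have : <[c]>%G \in 'Syl_5(M) by rewrite inE.
have : <[c']>%G \in 'Syl_5(M) by rewrite inE.
rewrite Q1 !inE => /eqP e' /eqP e.
by case/negP: nc; rewrite -[<[c]>]/(gval <[c]>%G) e -e' /= cycle_id.
Qed.

(** [M] has six Sylow 5-subgroups, and the normaliser of one contains [c * z] of order 10. So 60
    divides [#|M|], and index 2 is excluded. *)
Lemma order5_gen (M : {group gT}) c c' :
    M \subset L -> c \in M -> c' \in M -> #[c] = 5 -> #[c'] = 5 -> c' \notin <[c]> -> M :=: L.
Proof.
move=> sML Mc Mc' oc oc' nc.
have n6 := Syl5_dvd sML Mc Mc' oc oc' nc.
have Lag : (#|'N_M(<[c]>)| * 6)%N = #|M|.
  by rewrite -n6 (card_Syl (order5_Sylow sML Mc oc)) Lagrange ?subsetIl.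
have Mz : z \in M.
  have /(Cauchy (isT : prime 2))[x Mx ox] : 2 %| #|M| by rewrite -Lag dvdn_mull.
  by rewrite -(invU ox).
have N10 : 10 %| #|'N_M(<[c]>)|.
  have ocz : #[c * z] = 10.
    rewrite orderM ?oc ?oz //; exact/commute_sym/zC.
  rewrite -ocz; apply: order_dvdG; rewrite inE groupM //=.
  rewrite -cycle_subG norms_cycle.
  have -> : c ^ (c * z) = c by apply/conjg_fixP/commgP/commuteM => //; apply/commute_sym/zC.
  exact: cycle_id.
have d60 : 60 %| #|M| by rewrite -Lag -[60]/(10 * 6)%N dvdn_pmul2r.
have /dvdnP[k kM] := d60; have := cardSg sML; rewrite oL kM -[120]/(2 * 60)%N dvdn_pmul2r //.
move=> k2; have [_ /(_ k k2)/orP[]/eqP ek] := primeP (isT : prime 2); rewrite ek in kM.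
  by case: (@no_index2 M sML); rewrite -divgS // oL kM.
by apply/eqP; rewrite eqEcard sML oL kM.
Qed.

Lemma order5_exists : exists c c', [/\ c \in L, c' \in L, #[c] = 5, #[c'] = 5 & c' \notin <[c]>].
Proof.
have /(Cauchy (isT : prime 5))[c Lc oc] : 5 %| #|L| by rewrite oL.
have [/exists_inP[c' Lc' /andP[/eqP oc' nc]] | ] := boolP [exists c' in L, (#[c'] == 5) && (c' \notin <[c]>)].
  by exists c, c'.
rewrite negb_exists_in => /forall_inP all5.
(* If [<[c]>] were normal, [L] modulo the centraliser of [c], of order 12, would embed in a group of
   order 4. *)
have nLc : L \subset 'N(<[c]>).
  apply/subsetP=> x Lx; rewrite -cycle_subG norms_cycle.
  by have := all5 _ (groupJ Lc Lx); rewrite orderJ oc /= negbK.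
have := order5_cent Lc oc => oC.
have i12 : #|L : 'C_L[c]| = 12 by rewrite -divgS ?subsetIl // oL oC.
have : #|conj_aut <[c]> @* L| %| 4.
  rewrite -[4]/(totient 5) -oc -card_Aut_cycle cardSg // Aut_conj_aut.
  by [].
rewrite card_morphim ker_conj_aut /= (setIidPr nLc) cent_cycle -indexgI i12.
by [].
Qed.

(* [c] fixes one of the six Sylow 5-subgroups of [L] and permutes the others transitively, so
   some [a * c ^- k] fixes them all. *)
Lemma cent_order5_gens c a : c \in L -> #[c] = 5 -> (exists2 c', c' \in L & #[c'] = 5 /\ c' \notin <[c]>) ->
  commute a c -> exists k, a * c ^- k \in 'C(L).
Proof.
move=> Lc oc [d Ld [od nd]] cac.
pose Om := 'Syl_5(L); have sylc x : x \in L -> #[x] = 5 -> <[x]>%G \in Om.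
  by move=> Lx ox; rewrite inE; apply: (order5_Sylow (subxx L)).
have actOm (x : gT) (Q : {group gT}) : Q \in Om -> (Q :^ x)%G \in Om.
  by rewrite !inE -{2}(normP (nL x)) pHallJ2.
have oOm : #|Om| = 6 := Syl5_dvd (subxx L) Lc Ld oc od nd.
have nJ x Q : Q \in Om -> x \in L -> #[x] = 5 -> x \in 'N(Q) -> <[x]>%G = Q.
  move=> sQ Lx ox Nx; have sylQ : 5.-Sylow(L) Q by rewrite inE in sQ.
  have sQN : 5.-Sylow('N_L(Q)) Q by rewrite (pHall_subl _ (subsetIl _ _) sylQ) // subsetI (pHall_sub sylQ) normG.
  have nsQ : Q <| 'N_L(Q) by rewrite /normal (pHall_sub sQN) subsetIr.
  have Qx : x \in Q by rewrite (mem_normal_Hall sQN nsQ); [rewrite /p_elt ox | rewrite inE Lx].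
  apply/val_inj/eqP; rewrite /= eqEcard cycle_subG Qx -orderE ox (card_Hall sylQ) oL.
  by rewrite p_part -[logn 5 120]/1%N.
pose P2 := <[d]>%G; have P2Om : P2 \in Om := sylc d Ld od.
have neP2 : P2 != <[c]>%G.
  by apply: contraNneq nd => e; rewrite -[<[c]>]/(gval <[c]>%G) -e /= cycle_id.
have orb : orbit 'JG <[c]> P2 = Om :\ <[c]>%G.
  apply/eqP; rewrite eqEcard; apply/andP; split.
    apply/subsetP=> _ /orbitP[_ /cycleP[k ->] <-] /=; rewrite in_setD1; apply/andP; split.
      apply: contra neP2 => /eqP e; apply/eqP/val_inj => /=.
      have /(congr1 (fun X : {group gT} => X :^ (c ^+ k)^-1)) /= := e.
      by rewrite conjsgK => ->; rewrite conjGid // groupV mem_cycle.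
    exact: actOm P2Om.
  have := cardsD1 <[c]>%G Om; rewrite oOm sylc // add1n => /eqP; rewrite eqSS => /eqP <-.
  rewrite card_orbit /=; have := dvdn_indexg <[c]> 'C_(<[c]>)[P2 | 'JG]; rewrite -orderE oc.
  have [_ p5] := primeP (isT : prime 5) => /p5/orP[] /eqP; last by move->.
  move/eqP; rewrite indexg_eq1 => /subsetIP[_] /subsetP/(_ c (cycle_id c)) /astab1P /= e.
  have Nc : c \in 'N(P2) by apply/normP; have := congr1 val e.
  by case/eqP: neP2; rewrite (nJ c P2).
have Jac : <[c]> :^ a = <[c]> by rewrite -cycleJ; congr <[_]>; apply/conjg_fixP/commgP/commute_sym.
have: (P2 :^ a)%G \in orbit 'JG <[c]> P2.
  rewrite orb in_setD1 actOm // andbT; apply: contra neP2 => /eqP e; apply/eqP/val_inj.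
  by apply: (@conjsg_inj _ a); rewrite /= Jac; have := congr1 val e.
case/orbitP=> _ /cycleP[k ->] /(congr1 val) /= e; exists k.
pose b := a * c ^- k; rewrite -/b.
have cbc : commute b c by apply/commute_sym/commuteM; [apply: commute_sym | apply/commuteV/commuteX].
have b2 : P2 :^ b = P2 by rewrite /b conjsgM -e conjsgK.
have ball (Q : {group gT}) : Q \in Om -> b \in 'N(Q).
  move=> OQ; apply/normP; have [-> /= | nQ] := eqVneq Q <[c]>%G.
    by rewrite -cycleJ; congr <[_]>; apply/conjg_fixP/commgP/commute_sym.
  have : Q \in orbit 'JG <[c]> P2 by rewrite orb in_setD1 nQ.
  case/orbitP=> _ /cycleP[m ->] <- /=.
  by rewrite -conjsgM -(commuteX m (cbc : commute b c)) conjsgM b2.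
(* [[~ b, x]] lies in [<[x]>] and normalises every Sylow 5-subgroup. If nontrivial it would generate
   both [<[c]>] and [P2]. *)
have cb x : x \in L -> #[x] = 5 -> commute b x.
  move=> Lx ox; apply/commgP; pose w := [~ b, x]; rewrite -/w.
  have xw : w \in <[x]>.
    by rewrite /w commgEr groupM ?cycle_id // memJ_norm ?groupV ?cycle_id //; have := ball _ (sylc x Lx ox).
  have wN (Q : {group gT}) : Q \in Om -> w \in 'N(Q).
    move=> OQ; rewrite /w commgEl groupM ?groupV ?ball //.
    have /ball : (Q :^ x^-1)%G \in Om by apply: actOm.
    by rewrite normJ mem_conjgV.
  apply: contraT => ntw.
  have Lw : w \in L by apply: (subsetP _ _ xw); rewrite cycle_subG.
  have ow : #[w] = 5.
    have := order_dvdG xw; rewrite -orderE ox; have [_ p5] := primeP (isT : prime 5).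
    by move=> /p5/orP[]/eqP // /eqP; rewrite order_eq1 (negPf ntw).
  have e1 := nJ w _ (sylc c Lc oc) Lw ow (wN _ (sylc c Lc oc)).
  have e2 := nJ w _ P2Om Lw ow (wN _ P2Om).
  by case/eqP: neP2; rewrite -e1 -e2.
have Cx x : x \in L -> #[x] = 5 -> x \in 'C_L[b].
  by move=> Lx ox; rewrite in_setI Lx; apply/cent1P/commute_sym/cb.
have defL := order5_gen (subsetIl _ _) (Cx c Lc oc) (Cx d Ld od) oc od nd.
have /subsetIP[_] : L \subset 'C_L[b] by rewrite defL.
by rewrite -cent_cycle centsC cycle_subG.
Qed.

(** An element of order 4 in ['C(L)] commutes with one of [L], so it lies in [L] and is central
    there, against the centraliser orders. So [<[z]>] is a Sylow 2-subgroup of ['C(L)], with a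
    normal complement. *)
Lemma cent_pcore_decomp : 'C(L) \subset 'O_2^'('C(L)) <*> <[z]>.
Proof.
pose C := 'C(L)%G; have no4 : ~~ (4 %| #|C|).
  apply/negP=> /(exists_order4 fpf)[u Cu ou].
  have [v Lv ov] : exists2 v, v \in L & #[v] = 4 by apply: (exists_order4 fpf); rewrite oL.
  have Lu : u \in L.
    apply: (subsetP _ _ (order4_comm_mem fpf oz ov ou _)); first by rewrite cycle_subG.
    exact/commute_sym/(centP Cu v Lv).
  have := cardCL Lu; rewrite -order_dvdn ou => /(_ isT).
  have -> : 'C_L[u] = L.
    by apply/setIidPl; rewrite -cent_cycle centsC cycle_subG.
  by rewrite oL.
have Cz : z \in C by apply/centP=> x _; apply: zC.
have [T sylT] := Sylow_exists 2 C; have pT := pHall_pgroup sylT.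
have TE : T :=: <[z]>.
  apply/esym/eqP; rewrite eqEcard; apply/andP; split.
    rewrite (subset_trans _ (pcore_sub_Hall sylT)) // pcore_max ?/pgroup -?orderE ?oz //.
    rewrite /normal cycle_subG Cz cents_norm // centsC cycle_subG.
    by apply/centP=> x _; apply: zC.
  have [n oT] := p_natP pT; rewrite -orderE oz oT -[leqRHS]/(2 ^ 1)%N leq_exp2l // leqNgt; apply: contra no4 => n2; apply: dvdn_trans (cardSg (pHall_sub sylT)).
  by rewrite oT (dvdn_exp2l 2 n2).
have abT : abelian T by rewrite TE cycle_abelian.
have cT : 'N_C(T) \subset 'C(T).
  by rewrite TE centsC cycle_subG; apply/centP=> x _; apply: zC.
have [K [nsK tiK KT]] := Burnside_complement sylT abT cT.
rewrite -/C -{1}KT TE mul_subG ?joing_subr // (subset_trans _ (joing_subl _ _)) // pcore_max //.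
rewrite /pgroup -odd_2'nat -[odd _]negbK -dvdn2; apply/negP=> /(Cauchy (isT : prime 2))[x Kx ox].
have : z \in K :&: T by rewrite inE TE cycle_id -(invU ox) Kx.
by rewrite tiK => /set1P z1; have := oz; rewrite z1 order1.
Qed.

Theorem grank2_order120 : 'm([set: gT]) <= 2.
Proof.
have [c [d [Lc Ld oc od nd]]] := order5_exists.
pose G := [set: gT]%G; pose C := 'C(L)%G; pose N := 'O_2^'(C)%G.
have nsLG : L <| G by rewrite /normal subsetT; apply/subsetP=> x _.
have nsNG : N <| G.
  apply: char_normal_trans (pcore_char _ _) _.
  by rewrite /normal subsetT norms_cent // normal_norm.
have oddN : odd #|N| by rewrite odd_2'nat; apply: pcore_pgroup.
have sylc := order5_Sylow (subxx L) Lc oc.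
have Frat := Frattini_arg nsLG sylc.
have [g0 Ng0 defAut] : exists2 g0, g0 \in 'N(<[c]>) & conj_aut <[c]> @* 'N(<[c]>) = <[conj_aut <[c]> g0]>.
  have cyc : cyclic (conj_aut <[c]> @* 'N(<[c]>)).
    by apply: cyclicS (Aut_conj_aut _ _) _; rewrite Aut_prime_cycle_cyclic ?oc.
  have /cyclicP[w wE] := cyc.
  have : w \in conj_aut <[c]> @* 'N(<[c]>) by rewrite wE cycle_id.
  by case/morphimP=> g0 _ Ng0 wg; exists g0; rewrite // wE wg.
have [l Ll dl] : exists2 l, l \in L & <[d]> = <[c]> :^ l.
  exact: (Sylow_trans sylc (order5_Sylow (subxx L) Ld od)).
(* [g0] generates the action of ['N(<[c]>)] on [<[c]>]. The factor [l] makes [g] move [<[c]>], so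
   that [c] and [c ^ g] already generate [L]. *)
pose g := g0 * l; pose M := <<[set c; g]>>%G.
have Mc : c \in M by rewrite mem_gen ?set21.
have Mg : g \in M by rewrite mem_gen ?set22.
have Lcg : c ^ g \in L by rewrite memJ_norm.
have ocg : #[c ^ g] = 5 by rewrite orderJ.
have ncg : c ^ g \notin <[c]>.
  apply: contra nd => ccg; have <- : <[c ^ g]> = <[c]>.
    by apply/eqP; rewrite eqEcard cycle_subG ccg -!orderE ocg oc.
  by rewrite cycleJ conjsgM (normP Ng0) -dl cycle_id.
have sLM : L \subset M.
  rewrite -(order5_gen (subsetIr M L) _ _ oc ocg ncg) ?subsetIl //.
    by rewrite inE Mc.
  by rewrite inE Lcg groupJ.
have Mg0 : g0 \in M by rewrite -(mulgK l g0) groupM ?groupV // (subsetP sLM).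
have nNM : M \subset 'N(N) by rewrite (subset_trans (subsetT _)) // normal_norm.
have sCMN : C \subset M <*> N.
  rewrite (subset_trans cent_pcore_decomp) // join_subG joing_subr cycle_subG.
  by rewrite mem_gen // inE (subsetP sLM).
have defG : M <*> N :=: G.
  apply/eqP; rewrite eqEsubset subsetT -{1}Frat mul_subG ?(subset_trans sLM) ?joing_subl //.
  (* [x] acts on [<[c]>] as a power of [g0]. The remaining factor commutes with [c], hence is in
     ['C(L)] up to a power of [c]. *)
  apply/subsetP=> x /setIP[_ Nx].
  have : conj_aut <[c]> x \in <[conj_aut <[c]> g0]> by rewrite -defAut mem_morphim.
  case/cycleP=> k xk; pose a := x * g0 ^- k.
  have cac : commute a c.
    have : a \in 'ker (conj_aut <[c]>).
      apply/kerP; first by rewrite groupM // groupV groupX.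
      have e : conj_aut <[c]> a = conj_aut <[c]> x * (conj_aut <[c]> g0 ^+ k)^-1.
        by rewrite /a morphM ?groupV ?groupX // morphV ?groupX // morphX.
      by rewrite /= e xk mulgV.
    by rewrite ker_conj_aut cent_cycle => /cent1P.
  have [m Cb] : exists m, a * c ^- m \in 'C(L).
    by apply: cent_order5_gens => //; exists d.
  have xE : x = (a * c ^- m) * c ^+ m * g0 ^+ k by rewrite mulgKV mulgKV.
  have sMJ := subsetP (joing_subl M N).
  rewrite xE; apply: groupM; last exact/groupX/sMJ.
  by apply: groupM; [apply: (subsetP sCMN) | apply/groupX/sMJ].
apply: (grank2_lift nsNG oddN); first exact: fpf_odd_cyclic_Sylow fpf.
rewrite -defG joingC /= quotientYidl // (leq_trans (quotient_grank nNM)) //.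
by apply/grank_le2P; exists c, g.
Qed.

End Order120.

(** * Frobenius complements *)

Theorem fpf_grank2 (gT : finGroupType) (R : unitRingType) (f : gT -> R) :
  fpf_repr f -> 'm([set: gT]) <= 2.
Proof.
move=> fpf; have cycG := @fpf_odd_cyclic_Sylow _ _ f [set: gT]%G fpf.
have [oddG | evG] := boolP (odd #|[set: gT]|).
  (* In odd order there is no involution; 1 is a placeholder for it. *)
  apply: (@grank2_solvable _ [set: gT]%G 1 (odd_sol oddG cycG) cycG) => x Gx ox.
  by have := dvdn_odd (order_dvdG Gx) oddG; rewrite ox.
have /(Cauchy (isT : prime 2))[z _ oz] : 2 %| #|[set: gT]%G| by rewrite dvdn2.
have [solG | ] := boolP (solvable [set: gT]).
  apply: (@grank2_solvable _ [set: gT]%G z solG cycG) => x _.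
  exact: (fpf_invol_uniq fpf oz).
case/forall_inPn=> P; rewrite unfold_in subsetI -derg1 => /andP[_ perfP] ntP.
have P3 := perfect_dvd3 fpf oz perfP ntP.
have [/existsP[x /existsP[y /and3P[/eqP ox /eqP oy /eqP ncxy]]] | ] :=
    boolP [exists x : gT, exists y : gT, [&& #[x] == 3, #[y] == 3 & [~ x, y] != 1]]; last first.
  rewrite negb_exists => /forallP nc; case: (perfect_not_comm_order3 fpf perfP P3) => x y _ _ ox oy.
  have := nc x; rewrite negb_exists => /forallP/(_ y); rewrite ox oy !eqxx /= negbK.
  by move/commgP.
have ncxy' : ~ commute x y by move/commgP/eqP.
have [gi [gj [gx trip]]] := exists_quat_triple fpf oz ox oy ncxy'.
have tcL := tc_order3 fpf oz trip.
pose A := [set h : gT | #[h] == 3]; pose L := <<z |: A>>%G.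
have Lz : z \in L by rewrite mem_gen // inE set11.
have L3 h : #[h] = 3 -> h \in L by move=> oh; rewrite mem_gen // !inE oh eqxx orbT.
have nabL : ~~ abelian L.
  by apply/negP=> /centsP abL; apply: ncxy'; apply: abL; apply: L3.
have oddA : {in A, forall h, odd #[h]} by move=> h; rewrite inE => /eqP->.
have nL g : g \in 'N(L).
  rewrite inE -genJ gen_subG; apply/subsetP=> _ /imsetP[h hA ->].
  case/setU1P: hA => [->|]; first by rewrite conjgE (fpf_invol_comm fpf oz) mulKg.
  by rewrite inE => /eqP oh; apply: L3; rewrite orderJ.
case: (tc_card fpf oz Lz tcL nabL (erefl _) oddA) => [[oL _] | [oL cL]].
  case: (perfect_not_norm24 fpf oz perfP ntP _ Lz oL).
  by apply/subsetP=> g _.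
exact: (grank2_order120 fpf oz nL Lz oL cL (erefl _) oddA).
Qed.

Lemma abelem_fpf_grank2 (gT : finGroupType) p (E H : {group gT}) :
    p.-abelem E -> E :!=: 1 -> H \subset 'N(E) ->
    {in H & E, forall h e, h != 1 -> e ^ h = e -> e = 1} ->
  'm(H) <= 2.
Proof.
move=> abE ntE nEH fpH; rewrite (isog_grank (isog_subg H)).
pose rH := abelem_repr abE ntE nEH.
pose f (h : subg_of H) : 'M['F_p]_((abelem_dim' E).+1) := rH (val h).
apply: (@fpf_grank2 _ _ f); split=> [|x y|x ntx].
- by rewrite /f repr_mx1.
- by rewrite /f /= repr_mxM ?subgP.
rewrite -[_ \is a _]/(_ \in unitmx) -row_free_unit -kermx_eq0.
apply/rowV0P=> v /sub_kermxP; rewrite mulmxBr mulmx1 => /GRing.subr0_eq vx.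
have := rVabelemJ abE ntE nEH v (subgP x); rewrite -/rH -/(f x) vx => ex.
have ntx' : val x != 1 by apply: contraNneq ntx => x1; apply/eqP/val_inj.
have := fpH _ _ (subgP x) (mem_rVabelem abE ntE v) ntx' (esym ex).
by rewrite -(rVabelem0 abE ntE) => /rVabelem_inj.
Qed.

(** [H] is replaced by a complement that normalises a Sylow subgroup [P] of the kernel: by the
    Frattini argument ['N_G(P)] covers [G / K], and Schur-Zassenhaus splits it over ['N_K(P)]. Both
    complements are isomorphic to [G / K], and the new one acts on ['Ohm_1('Z(P))]. *)
Theorem corollary2p5 (gT : finGroupType) (G H : {group gT}) :
  has_Frobenius_action G H -> 'm(H) <= 2.
Proof.
move/Frobenius_actionP/Frobenius_kernel_exists=> [K frobG].
have [defG ntK ntH _ _] := Frobenius_context frobG.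
have [nsKG _ KH nKH tiKH] := sdprod_context defG.
have coKH := Frobenius_coprime frobG; have sKG := normal_sub nsKG.
have p_pr : prime (pdiv #|K|) by rewrite pdiv_prime ?cardG_gt1.
move: (pdiv #|K|) (pdiv_dvd #|K|) p_pr => p p_dvd p_pr.
have [P sylP] := Sylow_exists p K; have pP := pHall_pgroup sylP.
have Frat := Frattini_arg nsKG sylP.
have ntP : P :!=: 1.
  by rewrite -cardG_gt1 (card_Hall sylP) p_part_gt1 mem_primes p_pr cardG_gt0.
have NKE : 'N_G(P) :&: K = 'N_K(P) by rewrite setIAC (setIidPr sKG).
have nsKN : 'N_K(P) <| 'N_G(P) by rewrite -NKE (normalGI (subsetIl G _) nsKG).
have iN : #|'N_G(P) : 'N_K(P)| = #|H|.
  have := mul_cardG K 'N_G(P); rewrite Frat setIC NKE -(sdprod_card defG) -mulnA.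
  move/eqP; rewrite eqn_pmul2l // -(Lagrange (normal_sub nsKN)) mulnC eqn_pmul2r //.
  by move/eqP.
have hallN : Hall 'N_G(P) 'N_K(P).
  by rewrite /Hall normal_sub // iN (coprimeSg (subsetIl K _)).
have /splitsP[H1 /complP[tiH1 defN]] := SchurZassenhaus_split hallN nsKN.
have sH1N : H1 \subset 'N_G(P) by rewrite -defN mulG_subr.
have [sH1G nPH1] := subsetIP sH1N.
have tiKH1 : K :&: H1 = 1.
  apply/trivgP; rewrite -tiH1 subsetI subsetIr andbT subsetI subsetIl.
  exact: subset_trans (subsetIr _ _) nPH1.
have KH1 : K * H1 = G.
  by rewrite -Frat -defN mulgA (mulGSid (subsetIl K _)).
have -> : 'm(H) = 'm(H1).
  have nK := normal_norm nsKG.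
  rewrite (isog_grank (quotient_isog nKH tiKH)) (isog_grank (quotient_isog (subset_trans sH1G nK) tiKH1)).
  have eHH : H / K = H1 / K by rewrite -(quotientMidl K H) KH -(quotientMidl K H1) KH1.
  by rewrite /= eHH.
pose E := 'Ohm_1('Z(P))%G.
have abE : p.-abelem E.
  by rewrite Ohm1_abelem ?(pgroupS (center_sub P)) ?center_abelian.
have sEP : E \subset P := subset_trans (Ohm_sub 1 _) (center_sub P).
have ntE : E :!=: 1.
  rewrite Ohm1_eq1; apply: contra ntP => /eqP Z1.
  by rewrite (trivg_center_pgroup pP Z1).
apply: (abelem_fpf_grank2 abE ntE).
  by apply: subset_trans nPH1 _; apply: char_norms; apply: char_trans (Ohm_char 1 _) (center_char P).
move=> h e H1h Ee nth eh; apply: contraNeq nth => nte.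
have Ke : e \in K^# by rewrite !inE nte (subsetP (pHall_sub sylP)) // (subsetP sEP).
rewrite -in_set1 -[[set 1]]tiKH1 inE H1h andbT; apply: (subsetP (Frobenius_cent1_ker frobG Ke)).
by rewrite inE (subsetP sH1G) //; apply/cent1P/commute_sym/commgP/conjg_fixP.
Qed.
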